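(* Let $n\ge 2$ be even, and suppose that for integers $k,l$ one has $r^ks^l=1$ if and only if $k=l=0$. Let $U=U_{r,s}(\mathfrak{so}_{2n+1})$ and let $\xi=\gamma^{-\rho}\circ\pi|_{Z(U)}: Z(U)\to U_0$ be the Harish-Chandra homomorphism. Then $\xi$ is injective.
   Context: Roots. $E=\mathbb{R}^n$ with inner product $(\cdot,\cdot)$ and orthonormal basis $\varepsilon_1,\dots,\varepsilon_n$; simple roots of type $B_n$: $\alpha_i=\varepsilon_i-\varepsilon_{i+1}$ ($1\le i<n$), $\alpha_n=\varepsilon_n$. $Q=\bigoplus_i\mathbb{Z}\alpha_i$, $Q^+=\bigoplus_i\mathbb{Z}_{\ge0}\alpha_i$, $\Lambda=\bigoplus_i\mathbb{Z}\varpi_i$ is the weight lattice ($\varpi_i$ fundamental weights), $\rho$ is the half sum of positive roots. Parameters. $r,s\in\mathbb{C}^\times$, $r\neq s$, $r^2+s^2\ne1$, $\mathbb{K}=\mathbb{Q}(r,s)\subset\mathbb{C}$; $r_i=r^{(\alpha_i,\alpha_i)}$, $s_i=s^{(\alpha_i,\alpha_i)}$. Define $\langle\omega'_i,\omega_j\rangle=r^{2(\varepsilon_j,\alpha_i)}s^{2(\varepsilon_{j+1},\alpha_i)}$ for $1\le i\le n$, $1\le j<n$; $\langle\omega'_i,\omega_n\rangle=r^{2(\varepsilon_n,\alpha_i)}$ for $i<n$; $\langle\omega'_n,\omega_n\rangle=rs^{-1}$. For $\eta=\sum\eta_i\alpha_i$, $\phi=\sum\phi_i\alpha_i\in Q$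 put $\omega'_\eta=\prod_i\omega_i'^{\eta_i}$, $\omega_\phi=\prod_i\omega_i^{\phi_i}$, $\langle\omega'_\eta,\omega_\phi\rangle=\prod_{i,j}\langle\omega'_i,\omega_j\rangle^{\eta_i\phi_j}$. Algebra. $U=U_{r,s}(\mathfrak{so}_{2n+1})$ is the associative unital $\mathbb{K}$-algebra generated by $e_i,f_i,\omega_i^{\pm1},\omega_i'^{\pm1}$ ($1\le i\le n$) with relations: all $\omega_i^{\pm1},\omega_j'^{\pm1}$ commute, $\omega_i\omega_i^{-1}=1=\omega'_i\omega_i'^{-1}$; $\omega_je_i\omega_j^{-1}=\langle\omega'_i,\omega_j\rangle e_i$, $\omega_jf_i\omega_j^{-1}=\langle\omega'_i,\omega_j\rangle^{-1}f_i$, $\omega'_je_i\omega_j'^{-1}=\langle\omega'_j,\omega_i\rangle^{-1}e_i$, $\omega'_jf_i\omega_j'^{-1}=\langle\omega'_j,\omega_i\rangle f_i$; $[e_i,f_j]=\delta_{ij}\frac{\omega_i-\omega'_i}{r_i-s_i}$; $[e_i,e_j]=[f_i,f_j]=0$ if $|i-j|>1$; for $1\le i<n$: $e_i^2e_{i+1}-(r_i+s_i)e_ie_{i+1}e_i+r_is_ie_{i+1}e_i^2=0$ and $f_{i+1}f_i^2-(r_i+s_i)f_if_{i+1}f_i+r_is_if_i^2f_{i+1}=0$; for $1\le j<n-1$: $e_{j+1}^2e_j-(r_{j+1}^{-1}+s_{j+1}^{-1})e_{j+1}e_je_{j+1}+r_{j+1}^{-1}s_{j+1}^{-1}e_je_{j+1}^2=0$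 and $f_jf_{j+1}^2-(r_{j+1}^{-1}+s_{j+1}^{-1})f_{j+1}f_jf_{j+1}+r_{j+1}^{-1}s_{j+1}^{-1}f_{j+1}^2f_j=0$; with $c=r_n^{-2}+r_n^{-1}s_n^{-1}+s_n^{-2}$ and $d=r_n^{-1}s_n^{-1}$: $e_n^3e_{n-1}-c\,e_n^2e_{n-1}e_n+dc\,e_ne_{n-1}e_n^2-d^3e_{n-1}e_n^3=0$ and $f_{n-1}f_n^3-c\,f_nf_{n-1}f_n^2+dc\,f_n^2f_{n-1}f_n-d^3f_n^3f_{n-1}=0$. $U_0$ is the subalgebra generated by all $\omega_i^{\pm1},\omega_i'^{\pm1}$ (with basis $\omega'_\eta\omega_\phi$, $\eta,\phi\in Q$). For $\nu=\sum\nu_i\alpha_i\in Q^+$, $U^{\nu}(\mathfrak{n}^+)$ (resp. $U^{-\nu}(\mathfrak{n}^-)$) is the span of monomials in the $e_i$ (resp. $f_i$) in which each index $i$ occurs $\nu_i$ times. $U\cong U^-\otimes U_0\otimes U^+$ (triangular decomposition), where $U^\pm$ are generated by the $e_i$, resp. $f_i$. Harish-Chandra map. For $\lambda=\sum_i\lambda_i\alpha_i\in\Lambda$ ($\lambda_i\in\frac12\mathbb{Z}$), $\varrho^\lambda:U_0\to\mathbb{K}$ is the algebra homomorphism with $\varrho^\lambda(\omega_j)=r^{2(\varepsilon_j,\lambda)}s^{2(\varepsilon_{j+1},\lambda)}$, $\varrho^\lambda(\omega'_j)=r^{2(\varepsilon_{j+1},\lambda)}s^{2(\varepsilon_j,\lambda)}$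 for $j<n$, $\varrho^\lambda(\omega_n)=r^{2(\varepsilon_n,\lambda)}(rs)^{-\lambda_n}$, $\varrho^\lambda(\omega'_n)=s^{2(\varepsilon_n,\lambda)}(rs)^{-\lambda_n}$ (for $\lambda\in Q$ this is $\varrho^\lambda(\omega_j)=\langle\omega'_\lambda,\omega_j\rangle$, $\varrho^\lambda(\omega'_j)=\langle\omega'_j,\omega_\lambda\rangle^{-1}$; for $n$ even all exponents are integers). $Z(U)$ is the center of $U$; it is contained in the subalgebra $U^0=\bigoplus_{\nu\in Q^+}U^{-\nu}(\mathfrak{n}^-)U_0U^{\nu}(\mathfrak{n}^+)$. $\pi:U^0\to U_0$ is the projection with kernel $\bigoplus_{\nu\in Q^+\setminus\{0\}}U^{-\nu}(\mathfrak{n}^-)U_0U^{\nu}(\mathfrak{n}^+)$, and $\gamma^{-\rho}:U_0\to U_0$ is the algebra automorphism $\gamma^{-\rho}(\omega'_\eta\omega_\phi)=\varrho^{-\rho}(\omega'_\eta\omega_\phi)\,\omega'_\eta\omega_\phi$. *)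

(* Defs.v *)
From HB Require Import structures.
From mathcomp Require Import -(notations) monalg.
From mathcomp Require Import all_boot all_order all_algebra.
From mathcomp Require Import complex.
From mathcomp Require Import all_classical all_reals.
From mathcomp Require Import ring.

Set Implicit Arguments.
Unset Strict Implicit.
Unset Printing Implicit Defensive.

Import Order.TTheory GRing.Theory Num.Theory.

Local Open Scope classical_set_scope.
Local Open Scope ring_scope.

Section AdjoinedField.
Context {R : realType}.
Variables r s : R[i].

Definition Qrs_pred : {pred R[i]} :=
  [in smallest [set S : set R[i] | GRing.divring_closed [in S]] [set r; s]].

Lemma Qrs_divring_closed : GRing.divring_closed Qrs_pred.
Proof.
split; first by apply/mem_set => S /= [[h _ _] _]; exact/set_mem.
- move=> x y /set_mem hx /set_mem hy; apply/mem_set => S /= hS.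
  have [[_ h _] _] := hS.
  by apply/set_mem/h; apply/mem_set; [exact: hx | exact: hy].
- move=> x y /set_mem hx /set_mem hy; apply/mem_set => S /= hS.
  have [[_ _ h] _] := hS.
  by apply/set_mem/h; apply/mem_set; [exact: hx | exact: hy].
Qed.

HB.instance Definition _ :=
  GRing.isDivringClosed.Build R[i] Qrs_pred Qrs_divring_closed.

(* The subfield Q(r, s) of the complex numbers, as a field in its own right. *)
Record Qrs := MkQrs { Qrs_val : R[i]; Qrs_valP : Qrs_val \in Qrs_pred }.

HB.instance Definition _ := [isSub for Qrs_val].
HB.instance Definition _ := [Choice of Qrs by <:].
HB.instance Definition _ := [SubChoice_isSubIntegralDomain of Qrs by <:].
HB.instance Definition _ := [SubIntegralDomain_isSubField of Qrs by <:].

Lemma rQ_subproof : r \in Qrs_pred.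
Proof. by apply/mem_set => S /= [_]; apply; left. Qed.
Lemma sQ_subproof : s \in Qrs_pred.
Proof. by apply/mem_set => S /= [_]; apply; right. Qed.

Definition rQ : Qrs := MkQrs rQ_subproof.
Definition sQ : Qrs := MkQrs sQ_subproof.

End AdjoinedField.

Section RootsB.
Context {R : realType}.
Variable n : nat.

Definition dot (u v : 'rV[R]_n) : R := \sum_k u 0 k * v 0 k.

(* Indices start at 0: eps k is the (k+1)-st basis vector, eps n = 0, and the
   last simple root is the one whose index i satisfies i.+1 = n. *)
Definition eps (k : nat) : 'rV[R]_n := \row_j (j == k :> nat)%:R.

Definition alpha (i : 'I_n) : 'rV[R]_n :=
  if (i.+1 < n)%N then eps i - eps i.+1 else eps i.

(* Half sum of the positive roots eps i - eps j, eps i + eps j (i < j), eps i. *)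
Definition rho : 'rV[R]_n :=
  2^-1 *: (\sum_(i < n) \sum_(j < n | (i < j)%N)
             ((eps i - eps j) + (eps i + eps j)) + \sum_(i < n) eps i).

Definition acoord (i : 'I_n) (v : 'rV[R]_n) : R :=
  coord [tuple alpha j | j < n] i v.

(* Coordinates, in the basis of simple roots, of an element of Q. *)
Definition rootlattice := {ffun 'I_n -> int}.

Lemma acoord_last (i : 'I_n) (v : 'rV[R]_n) :
  i.+1 = n -> acoord i v = \sum_k v 0 k.
Proof.
move=> hi; pose X := [tuple alpha j | j < n].
pose P (u : 'rV[R]_n) (m : nat) := \sum_(k < n | (k <= m)%N) u 0 k.
have alphaE (j k : 'I_n) : alpha j 0 k = (k == j)%:R - (k == j.+1 :> nat)%:R.
  rewrite /alpha; case: ltnP => hj; rewrite !mxE // [X in _ - X]mulrb.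
  by rewrite [X in if X then _ else _]ltn_eqF ?subr0 //; exact: leq_trans (ltn_ord k) hj.
have abel u : u = \sum_(j < n) P u j *: alpha j.
  apply/rowP => k; rewrite summxE.
  under eq_bigr => j _ do rewrite mxE alphaE mulrBr.
  rewrite sumrB (bigD1 k) //= eqxx mulr1 big1 ?addr0; last first.
    by move=> j jk; rewrite eq_sym (negbTE jk) mulr0.
  have Pk : P u k = u 0 k + \sum_(k' < n | (k' < k)%N) u 0 k'.
    rewrite /P (bigD1 k) //=; congr (_ + _); apply: eq_bigl => k'.
    by rewrite [RHS]ltn_neqAle andbC.
  rewrite Pk -[LHS]addr0 -addrA; congr (_ + _); apply/esym/eqP.
  rewrite subr_eq0; apply/eqP; case: k {Pk} => [[|k] hk] /=.
    by rewrite !big1 // => j _; rewrite mulr0.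
  have hk' : (k < n)%N by exact: ltnW.
  rewrite [RHS](bigD1 (Ordinal hk')) //= eqxx mulr1 [X in _ = _ + X]big1 ?addr0 // => j jk.
  rewrite eqSS eq_sym -[k]/(val (Ordinal hk')) val_eqE (negbTE jk).
  by rewrite mulr0.
have Xi (j : 'I_n) : X`_j = alpha j by rewrite -tnth_nth tnth_mktuple.
have Xfree : free X.
  rewrite /free; have -> : <<X>>%VS = fullv.
    apply/eqP; rewrite eqEsubv subvf; apply/subvP => u _; rewrite (abel u).
    apply: rpred_sum => j _; apply: rpredZ; rewrite -Xi.
    by apply: memv_span; rewrite mem_nth // size_tuple.
  by rewrite dimvf size_tuple /dim /= mul1n.
rewrite /acoord {1}(abel v).
under eq_bigr => j _ do rewrite -Xi.
rewrite -/X coord_sum_free //; apply: eq_bigl => k.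
by rewrite -ltnS hi ltn_ord.
Qed.

Lemma dot_eps (k : 'I_n) (v : 'rV[R]_n) : dot (eps k) v = v 0 k.
Proof.
rewrite /dot (bigD1 k) //= big1 ?addr0 ?mxE ?eqxx ?mul1r // => j jk.
by rewrite mxE val_eqE (negbTE jk) mul0r.
Qed.

Lemma dot_eps_n (v : 'rV[R]_n) : dot (eps n) v = 0.
Proof. by apply: big1 => j _; rewrite mxE ltn_eqF ?mul0r. Qed.

Lemma rhoE (k : 'I_n) : rho 0 k = (n - k)%:R - 2^-1.
Proof.
have epsE (j : 'I_n) : eps j 0 k = (k == j)%:R by rewrite mxE.
have two0 : 2 != 0 :> R by rewrite pnatr_eq0.
have S2 : \sum_(i < n) eps i 0 k = 1.
  rewrite (bigD1 k) //= epsE eqxx big1 ?addr0 // => j jk.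
  by rewrite epsE eq_sym (negbTE jk).
have S1 : \sum_(i < n) \sum_(j < n | (i < j)%N)
    ((eps i - eps j) + (eps i + eps j)) 0 k = (n - k.+1)%:R * 2.
  transitivity (\sum_(i < n) \sum_(j < n | (i < j)%N) ((k == i)%:R * 2 : R)).
    apply: eq_bigr => i _; apply: eq_bigr => j _.
    by rewrite addrACA addNr addr0 mxE epsE mulr_natr mulr2n.
  rewrite (bigD1 k) //= [X in _ + X]big1 ?addr0 => [|i ik]; last first.
    by rewrite big1 // => j _; rewrite eq_sym (negbTE ik) mul0r.
  rewrite eqxx mul1r mulr_natl -sumr_const_nat big_geq_mkord.
  exact: eq_bigl.
rewrite /rho mxE mxE !summxE; under eq_bigr => i _ do rewrite summxE.
rewrite S1 S2 mulrDr mulr1 mulrCA mulVf // mulr1.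
by rewrite -(subnSK (ltn_ord k)) -natr1; field.
Qed.

Lemma acoord_rho (i : 'I_n) : i.+1 = n -> acoord i rho = (n ^ 2)%:R / 2.
Proof.
move=> hi; rewrite (acoord_last _ hi); under eq_bigr => k _ do rewrite rhoE.
elim: {i hi}n => [|m IH]; first by rewrite big_ord0 mul0r.
rewrite big_ord_recl subn0.
under eq_bigr => k _ do rewrite lift0 subSS.
rewrite IH -[m.+1]addn1 sqrnD !natrD !natrM.
by field.
Qed.

(* The exponents of varrho^(-rho) are integers when n is even. *)
Lemma rho_exponents_int (k i : 'I_n) : ~~ odd n -> i.+1 = n ->
  2 * dot (eps k) rho \is a Num.int /\ acoord i rho \is a Num.int.
Proof.
move=> hn hi; split.
  rewrite dot_eps rhoE mulrBr divff ?pnatr_eq0 // rpredB ?rpred1 //.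
  by rewrite rpredM ?rpred_nat.
rewrite (acoord_rho hi) -(even_halfK hn) -muln2 expnMn -[(2 ^ 2)%N]/(2 * 2)%N.
by rewrite mulnA natrM mulfK ?pnatr_eq0 ?rpred_nat.
Qed.

End RootsB.

Section Presentation.
Context {R : realType}.
Variable n : nat.
Variables r s : R[i].
Local Notation K := (Qrs r s).
Local Notation rK := (rQ r s).
Local Notation sK := (sQ r s).
Implicit Types i j l m : 'I_n.

(* x to the power a, only meant for real numbers a that are integers. This holds
   of (alpha_i, alpha_i) and 2 (eps_j, alpha_i) for all n, and of the exponents
   in varrho^lam for every weight lam when n is even (see rho_exponents_int for
   lam = - rho). *)
Definition zexp (x : K) (a : R) : K := x ^ Num.floor a.

Definition r_ i : K := zexp rK (dot (alpha i) (alpha i)).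
Definition s_ i : K := zexp sK (dot (alpha i) (alpha i)).

(* pairing i j = < omega'_i, omega_j > *)
Definition pairing i j : K :=
  if (j.+1 < n)%N then
    zexp rK (2 * dot (eps n j) (alpha i)) * zexp sK (2 * dot (eps n j.+1) (alpha i))
  else if (i.+1 < n)%N then zexp rK (2 * dot (eps n j) (alpha i))
  else rK * sK^-1.

(* GenO primed inverted i is omega_i, with a prime when primed holds and an
   exponent -1 when inverted holds. *)
Inductive gen : Type :=
| GenE of 'I_n
| GenF of 'I_n
| GenO of bool & bool & 'I_n.

HB.instance Definition _ := gen_eqMixin gen.
HB.instance Definition _ := gen_choiceMixin gen.

Definition cst_c i : K := (r_ i)^-1 ^+ 2 + (r_ i)^-1 * (s_ i)^-1 + (s_ i)^-1 ^+ 2.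
Definition cst_d i : K := (r_ i)^-1 * (s_ i)^-1.

Section Relations.
Variables (A : lalgType K) (g : gen -> A).

Local Notation e i := (g (GenE i)).
Local Notation f i := (g (GenF i)).
Local Notation w i := (g (GenO false false i)).
Local Notation wV i := (g (GenO false true i)).
Local Notation w' i := (g (GenO true false i)).
Local Notation w'V i := (g (GenO true true i)).

(* relU x y: "x = y" is one of the defining relations of U, written with g x
   in place of each generator x. *)
Inductive relU : A -> A -> Prop :=
| rel_toral p q p' q' i j :
    relU (g (GenO p q i) * g (GenO p' q' j))
         (g (GenO p' q' j) * g (GenO p q i))
| rel_wV i : relU (w i * wV i) 1
| rel_w'V i : relU (w' i * w'V i) 1
| rel_we i j : relU (w j * e i * wV j) (pairing i j *: e i)
| rel_wf i j : relU (w j * f i * wV j) ((pairing i j)^-1 *: f i)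
| rel_w'e i j : relU (w' j * e i * w'V j) ((pairing j i)^-1 *: e i)
| rel_w'f i j : relU (w' j * f i * w'V j) (pairing j i *: f i)
| rel_ef i j :
    relU (e i * f j - f j * e i)
         (if i == j then (r_ i - s_ i)^-1 *: (w i - w' i) else 0)
| rel_ee i j : (i.+1 < j)%N || (j.+1 < i)%N -> relU (e i * e j - e j * e i) 0
| rel_ff i j : (i.+1 < j)%N || (j.+1 < i)%N -> relU (f i * f j - f j * f i) 0
| rel_eSerre i i1 : i1 = i.+1 :> nat ->
    relU (e i ^+ 2 * e i1 - (r_ i + s_ i) *: (e i * e i1 * e i)
          + (r_ i * s_ i) *: (e i1 * e i ^+ 2)) 0
| rel_fSerre i i1 : i1 = i.+1 :> nat ->
    relU (f i1 * f i ^+ 2 - (r_ i + s_ i) *: (f i * f i1 * f i)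
          + (r_ i * s_ i) *: (f i ^+ 2 * f i1)) 0
| rel_eSerre' j j1 : j1 = j.+1 :> nat -> (j1.+1 < n)%N ->
    relU (e j1 ^+ 2 * e j - ((r_ j1)^-1 + (s_ j1)^-1) *: (e j1 * e j * e j1)
          + ((r_ j1)^-1 * (s_ j1)^-1) *: (e j * e j1 ^+ 2)) 0
| rel_fSerre' j j1 : j1 = j.+1 :> nat -> (j1.+1 < n)%N ->
    relU (f j * f j1 ^+ 2 - ((r_ j1)^-1 + (s_ j1)^-1) *: (f j1 * f j * f j1)
          + ((r_ j1)^-1 * (s_ j1)^-1) *: (f j1 ^+ 2 * f j)) 0
| rel_eSerreN l m : m = l.+1 :> nat -> m.+1 = n ->
    relU (e m ^+ 3 * e l - cst_c m *: (e m ^+ 2 * e l * e m)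
          + (cst_d m * cst_c m) *: (e m * e l * e m ^+ 2)
          - (cst_d m ^+ 3) *: (e l * e m ^+ 3)) 0
| rel_fSerreN l m : m = l.+1 :> nat -> m.+1 = n ->
    relU (f l * f m ^+ 3 - cst_c m *: (f m * f l * f m ^+ 2)
          + (cst_d m * cst_c m) *: (f m ^+ 2 * f l * f m)
          - (cst_d m ^+ 3) *: (f m ^+ 3 * f l)) 0.

End Relations.

Lemma relU_morph (A B : lalgType K) (h : {lrmorphism A -> B}) (g : gen -> A) y z :
  relU g y z -> relU (h \o g) (h y) (h z).
Proof.
have hZ (a : K) x : h (a *: x) = a *: h x by exact: linearZ.
have hB x x' : h (x - x') = h x - h x' by exact: rmorphB.
have hD x x' : h (x + x') = h x + h x' by exact: rmorphD.
have hM x x' : h (x * x') = h x * h x' by exact: rmorphM.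
have h1 : h 1 = 1 by exact: rmorph1.
have h0 : h 0 = 0 by exact: rmorph0.
have hG x : h (g x) = (h \o g) x by [].
move: (h \o g) hG => G hG.
case=> *; rewrite ?(hB, hD) ?hZ ?hM ?h1 ?h0 ?hG; try by constructor.
match goal with |- context [?i == ?j] =>
  have := rel_ef G i j; case: ifP => _ end.
all: by rewrite ?hZ ?hB ?h0 ?hG.
Qed.

Definition counit_gen (x : gen) : K := if x is GenO _ _ _ then 1 else 0.

Lemma counit_relU y z : relU (counit_gen : gen -> K^o) y z -> y = z.
Proof.
case=> *; try case: ifP => _.
all: rewrite /= ?expr0n /= ?(mulr0, mul0r, mulr1, subrr, addr0, scaler0) //.
Qed.

Definition freeU : lalgType K := malg (fmonom gen) K.

Definition genU (x : gen) : freeU := mkmalgU (fmu x) 1.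

Definition ideal2_closed (A : nzRingType) (S : {pred A}) : Prop :=
  zmod_closed S /\ forall a b, {in S, forall u, a * u * b \in S}.

Definition idealU : {pred freeU} :=
  [in smallest [set S : set freeU | ideal2_closed [in S]]
               [set x | exists y z, relU genU y z /\ x = y - z]].

Lemma idealU_smallest (S : set freeU) :
  ideal2_closed [in S] -> (forall y z, relU genU y z -> y - z \in S) ->
  {subset idealU <= S}.
Proof.
move=> hS hrel x /set_mem hx; apply/mem_set; apply: (hx S); split=> // u.
by move=> /= [y [z [/hrel hyz ->]]]; exact/set_mem.
Qed.

Lemma relU_ideal y z : relU genU y z -> y - z \in idealU.
Proof. by move=> h; apply/mem_set => S /= [_]; apply; exists y, z. Qed.

Lemma idealU_closed : ideal2_closed idealU.
Proof.
split; first split.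
- by apply/mem_set => S /= [[[h _] _] _]; exact/set_mem.
- move=> x y /set_mem hx /set_mem hy; apply/mem_set => S /= hS.
  have [[[_ h] _] _] := hS.
  by apply/set_mem/h; apply/mem_set; [exact: hx | exact: hy].
- move=> a b x /set_mem hx; apply/mem_set => S /= hS.
  have [[_ h] _] := hS.
  by apply/set_mem/h; apply/mem_set; exact: hx.
Qed.

Lemma idealU_zmod_closed : zmod_closed idealU.
Proof. by have [] := idealU_closed. Qed.

HB.instance Definition _ :=
  GRing.isZmodClosed.Build freeU idealU idealU_zmod_closed.

(* The counit e, f |-> 0, omega |-> 1 shows that the ideal is proper. *)
Definition counit_mon (m : fmonom gen) : K := \prod_(x <- m) counit_gen x.

Lemma counit_mon_mmorphism : mmorphism counit_mon.
Proof.
split=> [x y|]; rewrite /counit_mon; first by rewrite fmM big_cat.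
by rewrite fm1 big_nil.
Qed.
HB.instance Definition _ :=
  monalg.isMultiplicative.Build _ _ counit_mon counit_mon_mmorphism.

Definition counit : freeU -> K^o := mmap idfun counit_mon.
HB.instance Definition _ := GRing.RMorphism.on counit.
HB.instance Definition _ := GRing.isScalable.Build K freeU K^o *:%R counit
  (mmap_is_linear (h := counit_mon)).

Lemma counit_genU : counit \o genU = counit_gen.
Proof.
apply: funext => x.
by rewrite /= /counit mmapU /= mul1r /counit_mon fmU big_seq1.
Qed.

Lemma idealU1 : 1 \notin idealU.
Proof.
have cB x y : counit (x - y) = counit x - counit y by exact: rmorphB.
have cM x y : counit (x * y) = counit x * counit y by exact: rmorphM.
have c0 : counit 0 = 0 by exact: rmorph0.
have c1 : counit 1 = 1 by exact: rmorph1.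
pose S : set freeU := [set x | counit x = 0].
have SE x : (x \in S) = (counit x == 0).
  by apply/idP/eqP => [/set_mem //|?]; exact/mem_set.
have h : {subset idealU <= S}.
  apply: idealU_smallest => [|y z].
    split; first split; first by rewrite SE c0.
      by move=> x y; rewrite !SE cB => /eqP-> /eqP->; rewrite subrr.
    by move=> a b x; rewrite !SE !cM => /eqP->; rewrite mulr0 mul0r.
  move=> /(@relU_morph _ _ counit); rewrite counit_genU => /counit_relU hyz.
  by rewrite SE cB hyz subrr.
by apply/negP => /h; rewrite SE c1 oner_eq0.
Qed.

Lemma freeU_scalerAr (a : K) (x y : freeU) : a *: (x * y) = x * (a *: y).
Proof.
have malgC_comm (z : freeU) : z * mkmalgU monalg.one a = mkmalgU monalg.one a * z.
  rewrite !malgM_def fgmulUg fgmulgU; apply: eq_bigr => k _.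
  by rewrite mulrC mul1m mulm1.
by rewrite -!mul_malgC !mulrA malgC_comm.
Qed.

Lemma idealUM x y u : u \in idealU -> x * u * y \in idealU.
Proof. by have [_ h] := idealU_closed; exact: h. Qed.

Lemma idealUZ (a : K) u : u \in idealU -> a *: u \in idealU.
Proof. by move/(idealUM (a *: 1) 1); rewrite mulr1 -scalerAl mul1r. Qed.

(* The algebra U_{r,s}(so_{2n+1}). *)
Definition U : Type := Quotient.quot idealU.

HB.instance Definition _ := GRing.Zmodule.on U.

Definition piU (x : freeU) : U := \pi_(Quotient.quot idealU)%qT x.

Lemma piU_eq x y : piU x = piU y <-> x - y \in idealU.
Proof.
by rewrite Quotient.idealrBE; split => [/eqP | /eqP].
Qed.

Lemma piU_relU x y : relU genU x y -> piU x = piU y.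
Proof. by move=> h; apply/piU_eq; exact: relU_ideal. Qed.

Lemma piUB x y : piU (x - y) = piU x - piU y.
Proof. exact: (raddfB \pi_(Quotient.quot idealU)%qT). Qed.

Lemma piUD x y : piU (x + y) = piU x + piU y.
Proof. exact: (raddfD \pi_(Quotient.quot idealU)%qT). Qed.

Definition oneU : U := piU 1.
Definition mulU (x y : U) : U := piU (repr x * repr y).
Definition scaleU (a : K) (x : U) : U := piU (a *: repr x).

Lemma piU_repr (x : U) : piU (repr x) = x.
Proof. exact: (@reprK _ (Quotient.quot idealU)). Qed.

Lemma piU_surj (x : U) : exists y, x = piU y.
Proof. by exists (repr x); rewrite piU_repr. Qed.

Lemma repr_piU x : repr (piU x) - x \in idealU.
Proof. by apply/piU_eq; rewrite piU_repr. Qed.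

Lemma piUM x y : piU (x * y) = mulU (piU x) (piU y).
Proof.
apply/esym/piU_eq; set x' := repr _; set y' := repr _.
have -> : x' * y' - x * y = 1 * (x' - x) * y' + x * (y' - y) * 1.
  by rewrite mul1r mulr1 mulrBl mulrBr addrA subrK.
by apply: rpredD; apply: idealUM; exact: repr_piU.
Qed.

Lemma piUZ a x : piU (a *: x) = scaleU a (piU x).
Proof.
apply/esym/piU_eq; rewrite -scalerBr; apply: idealUZ; exact: repr_piU.
Qed.

Fact mulUA : associative mulU.
Proof.
move=> x y z; have [[x' ->] [[y' ->] [z' ->]]] := (piU_surj x, (piU_surj y, piU_surj z)).
by rewrite -!piUM mulrA.
Qed.
Fact mul1U : left_id oneU mulU.
Proof. by move=> x; have [x' ->] := piU_surj x; rewrite -piUM mul1r. Qed.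
Fact mulU1 : right_id oneU mulU.
Proof. by move=> x; have [x' ->] := piU_surj x; rewrite -piUM mulr1. Qed.
Fact mulUDl : left_distributive mulU +%R.
Proof.
move=> x y z; have [x' ->] := piU_surj x; have [y' ->] := piU_surj y.
by have [z' ->] := piU_surj z; rewrite -piUD -!piUM -piUD mulrDl.
Qed.
Fact mulUDr : right_distributive mulU +%R.
Proof.
move=> x y z; have [x' ->] := piU_surj x; have [y' ->] := piU_surj y.
by have [z' ->] := piU_surj z; rewrite -piUD -!piUM -piUD mulrDr.
Qed.
Fact oneU_neq0 : oneU != 0.
Proof.
apply/negP => /eqP; rewrite -(subrr oneU) -piUB => /piU_eq.
by rewrite subrr subr0; exact/negP/idealU1.
Qed.

HB.instance Definition _ :=
  GRing.Zmodule_isNzRing.Build U mulUA mul1U mulU1 mulUDl mulUDr oneU_neq0.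

Fact scaleUA a b x : scaleU a (scaleU b x) = scaleU (a * b) x.
Proof. by have [x' ->] := piU_surj x; rewrite -!piUZ scalerA. Qed.
Fact scale1U : left_id 1 scaleU.
Proof. by move=> x; have [x' ->] := piU_surj x; rewrite -piUZ scale1r. Qed.
Fact scaleUDr : right_distributive scaleU +%R.
Proof.
move=> a x y; have [x' ->] := piU_surj x; have [y' ->] := piU_surj y.
by rewrite -piUD -!piUZ -piUD scalerDr.
Qed.
Fact scaleUDl x : {morph scaleU^~ x : a b / a + b}.
Proof.
by move=> a b; have [x' ->] := piU_surj x; rewrite /= -!piUZ -piUD scalerDl.
Qed.

HB.instance Definition _ :=
  GRing.Zmodule_isLmodule.Build K U scaleUA scale1U scaleUDr scaleUDl.

Fact scaleUAl (a : K) (x y : U) : a *: (x * y) = (a *: x) * y.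
Proof.
have [x' ->] := piU_surj x; have [y' ->] := piU_surj y.
change (scaleU a (mulU (piU x') (piU y')) = mulU (scaleU a (piU x')) (piU y')).
by rewrite -piUM -!piUZ -piUM scalerAl.
Qed.

HB.instance Definition _ := GRing.Lmodule_isLalgebra.Build K U scaleUAl.

Fact scaleUAr (a : K) (x y : U) : a *: (x * y) = x * (a *: y).
Proof.
have [x' ->] := piU_surj x; have [y' ->] := piU_surj y.
change (scaleU a (mulU (piU x') (piU y')) = mulU (piU x') (scaleU a (piU y'))).
by rewrite -piUM -!piUZ -piUM freeU_scalerAr.
Qed.

HB.instance Definition _ := GRing.Lalgebra_isAlgebra.Build K U scaleUAr.

Fact piU_is_zmod_morphism : zmod_morphism piU. Proof. exact: piUB. Qed.
Fact piU_is_monoid_morphism : monoid_morphism piU.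
Proof. by split; [change (piU 1 = oneU) | move=> x y; exact: piUM]. Qed.
Fact piU_is_scalable : scalable piU. Proof. by move=> a x; exact: piUZ. Qed.

HB.instance Definition _ :=
  GRing.isZmodMorphism.Build freeU U piU piU_is_zmod_morphism.
HB.instance Definition _ :=
  GRing.isMonoidMorphism.Build freeU U piU piU_is_monoid_morphism.
HB.instance Definition _ :=
  GRing.isScalable.Build K freeU U *:%R piU piU_is_scalable.

Definition Ue i : U := piU (genU (GenE i)).
Definition Uf i : U := piU (genU (GenF i)).
Definition Uomega (primed inverted : bool) i : U :=
  piU (genU (GenO primed inverted i)).

(* x to the power k, where y is the inverse of x. *)
Definition zpow (x y : U) (k : int) : U :=
  match k with Posz m => x ^+ m | Negz m => y ^+ m.+1 end.

Definition omega_mon (eta phi : rootlattice n) : U :=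
  (\prod_i zpow (Uomega true false i) (Uomega true true i) (eta i))
  * (\prod_i zpow (Uomega false false i) (Uomega false true i) (phi i)).

Definition lspan (G : set U) : set U :=
  smallest [set S : set U | GRing.submod_closed [in S]] G.

Definition U0 : set U :=
  smallest [set S : set U | GRing.subalg_closed [in S]]
           [set x | exists p q i, x = Uomega p q i].

(* The word w has weight nu (or -nu): each index i occurs nu i times in w. *)
Definition has_weight (nu : 'I_n -> nat) (w : seq 'I_n) : Prop :=
  forall i, count_mem i w = nu i.

Definition Uplus (nu : 'I_n -> nat) : set U :=
  lspan [set x | exists2 w, has_weight nu w & x = \prod_(i <- w) Ue i].

Definition Uminus (nu : 'I_n -> nat) : set U :=
  lspan [set x | exists2 w, has_weight nu w & x = \prod_(i <- w) Uf i].

Definition varrho_omega (lam : 'rV[R]_n) j : K :=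
  if (j.+1 < n)%N then
    zexp rK (2 * dot (eps n j) lam) * zexp sK (2 * dot (eps n j.+1) lam)
  else zexp rK (2 * dot (eps n j) lam) * zexp (rK * sK) (- acoord j lam).

Definition varrho_omega' (lam : 'rV[R]_n) j : K :=
  if (j.+1 < n)%N then
    zexp rK (2 * dot (eps n j.+1) lam) * zexp sK (2 * dot (eps n j) lam)
  else zexp sK (2 * dot (eps n j) lam) * zexp (rK * sK) (- acoord j lam).

(* varrho^lam (omega'_eta omega_phi) *)
Definition varrho (lam : 'rV[R]_n) (eta phi : rootlattice n) : K :=
  (\prod_i varrho_omega' lam i ^ eta i) * (\prod_i varrho_omega lam i ^ phi i).

(* The sum of the U^{-nu}(n^-) U_0 U^nu(n^+) over the nonzero nu in Q^+. *)
Definition HC_kernel : set U :=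
  lspan [set x | exists nu y t z,
    [/\ exists i, nu i != 0%N, Uminus nu y, U0 t, Uplus nu z & x = y * t * z]].

(* The projection pi. An element u of U_0 with x - u in HC_kernel exists if and
   only if x lies in U^0, the domain of pi; by the triangular decomposition it
   is then unique. Outside U^0 the value is the irrelevant default 0. *)
Definition HC_proj (x : U) : U :=
  xget 0 [set u | U0 u /\ HC_kernel (x - u)].

(* The linear map multiplying each omega'_eta omega_phi by
   varrho^lam (omega'_eta omega_phi). These monomials form a basis of U_0, so
   that y exists and is unique for x in U_0; elsewhere the value is 0. *)
Definition HC_gamma (lam : 'rV[R]_n) (x : U) : U :=
  xget 0 [set y | exists c : seq (K * (rootlattice n * rootlattice n)),
    x = \sum_(p <- c) p.1 *: omega_mon p.2.1 p.2.2 /\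
    y = \sum_(p <- c) (p.1 * varrho lam p.2.1 p.2.2) *: omega_mon p.2.1 p.2.2].

Definition HC : U -> U := HC_gamma (- rho n) \o HC_proj.

Definition centerU : set U := [set z | forall x, z * x = x * z].

End Presentation.

Arguments centerU {R} n r s.
Arguments HC {R} n r s x.

(* Main.v *)
From HB Require Import structures.
From mathcomp Require finmap.
From mathcomp Require Import -(notations) monalg.
From mathcomp Require Import all_boot all_order all_algebra.
From mathcomp Require Import complex.
From mathcomp Require Import all_classical all_reals.
From mathcomp Require Import ring zify.
Require Import Defs.

(** If z and z' are central with the same image, their difference is central
and lies in the kernel of the projection: it is a combination of monomials
f_(i1) ... f_(ih) t e_(j1) ... e_(jh) with h > 0 and t in the torus.  A central
element of that shape kills the highest weight vector of every Verma module,
so the point is that Verma modules separate such elements from 0.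

Verma modules enter through one number.  For nonzero scalars lam i, lam' i,
there is a linear form [vev lam lam'] on U which is 1 at 1, kills U e_i and
f_i U, and is multiplied by lam i or lam' i when its argument is multiplied on
the right by omega_i or omega'_i: the coefficient of the highest weight vector
in x v.  It is read off an action of the free algebra on words in the f_i,
where e_i acts by a combination of two skew derivations ([raiseE]).  The
Serre relations among the f_i act there by operators whose values generate a
proper submodule, without component on the highest weight vector ([relU_ev],
[act_radical]).

[faithful] is the separation statement.  For an element x as above, consider
vev (e_(w1) x f_(w2)) for words w1, w2 whose length is the smallest h that
occurs in x.  On one monomial it is the product of the contravariant form at
(w1, w'), the weight at t, and the contravariant form at (w, w2).  Along a
curve lam i = b^(N i), lam' i = b^(N' i) with N i < N' i, the lowest term in b
of the contravariant form is, up to a nonzero factor, a bilinear form [form]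
on words that no longer depends on N and N' ([low_vpair]), and a good choice
of N and N' gives distinct exponents to the torus monomials in x
([separating_exponents]).  So the part of x with smallest h and lowest
exponent satisfies sum c form(w1, w') form(w, w2) = 0 for all w1, w2.  A
combination of words of f's which is orthogonal to all words vanishes in U
([sol_radical]), the anti-automorphism [tau] transports this to the e's
([ew_sum]), and linear algebra ([kernel_factor]) then shows that this part of x
is 0.

[radical_evf], behind [sol_radical], is an argument on singular vectors.
Let y be a combination of words of one weight beta, in the radical of the form,
and suppose that shorter elements of the radical vanish in U.  Then the image u of y commutes with every e_i.  By the Serre relations, u is
killed by a power of the q-adjoint action of f_i ([proj_nilf]), and the
computation of quantum sl_2 gives (alpha_i, beta) <= 0 whenever u is nonzero
([primitive_weight]).  This for all i forces beta = 0 ([weight_definite]).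

Two facts connect this with the map itself.  Conjugation by the omega_k
separates weights because r^k s^l = 1 only for k = l = 0 and n >= 2
([pairing_weight_perm]), so that a central element only involves monomials of
weight 0 ([central_balanced]) and its projection has the expected property
([HC_projP]).  The torus monomials are linearly independent ([torus_indep]),
so that the rescaling gamma^(-rho) is injective ([HC_gamma_inj]). *)

Set Implicit Arguments.
Unset Strict Implicit.
Unset Printing Implicit Defensive.
Import Order.TTheory GRing.Theory Num.Theory.

Local Open Scope ring_scope.

(** * Linear identities by comparison of coefficients *)

Section LinearCombination.
Variables (K : nzRingType) (V : lmodType K).

(** Syntax of linear combinations over an environment of atoms, so that an
equality of vectors can be reduced to scalar equalities by computation. *)
Inductive lexpr := LAtom of nat | LZero | LAdd of lexpr & lexpr
  | LOpp of lexpr | LScale of K & lexpr.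

Fixpoint leval (env : seq V) (t : lexpr) : V :=
  match t with
  | LAtom i => env`_i
  | LZero => 0
  | LAdd t u => leval env t + leval env u
  | LOpp t => - leval env t
  | LScale c t => c *: leval env t
  end.

Fixpoint lcoef (t : lexpr) (i : nat) : K :=
  match t with
  | LAtom j => if eqn i j then 1 else 0
  | LZero => 0
  | LAdd t u => lcoef t i + lcoef u i
  | LOpp t => - lcoef t i
  | LScale c t => c * lcoef t i
  end.

Lemma levalE env t : leval env t = \sum_(i < size env) lcoef t i *: env`_i.
Proof.
elim: t => [j||t IHt u IHu|t IH|c t IH] /=.
- have [ji|ji] := ltnP j (size env).
    rewrite (bigD1 (Ordinal ji)) //= big1 => [|i /negbTE ne].
      by rewrite -[eqn j j]/(j == j) eqxx scale1r addr0.
    by rewrite -[eqn i j]/(i == j :> nat) -[j]/(val (Ordinal ji)) val_eqE ne scale0r.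
  rewrite nth_default // big1 // => i _.
  rewrite -[eqn i j]/(i == j :> nat) ltn_eqF ?scale0r //.
  exact: leq_trans (ltn_ord i) ji.
- by rewrite big1 // => i _; rewrite scale0r.
- by rewrite IHt IHu -big_split; apply: eq_bigr => i _; rewrite scalerDl.
- by rewrite IH -sumrN; apply: eq_bigr => i _; rewrite scaleNr.
- by rewrite IH scaler_sumr; apply: eq_bigr => i _; rewrite scalerA.
Qed.

Fixpoint lcoef_eq (t u : lexpr) (m : nat) : Prop :=
  if m is m'.+1 then lcoef t m' = lcoef u m' /\ lcoef_eq t u m' else True.

Lemma leval_eq env t u : lcoef_eq t u (size env) -> leval env t = leval env u.
Proof.
move=> h; rewrite !levalE; apply: eq_bigr => -[i /= lt _]; congr (_ *: _).
elim: (size env) h lt => //= m IH [hm h]; rewrite ltnS leq_eqVlt.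
by case/orP => [/eqP->|/IH]; last exact.
Qed.

End LinearCombination.

Ltac lindex env t :=
  lazymatch env with
  | ?x :: ?env' =>
    match constr:(tt) with
    | _ => let _ := match constr:(tt) with _ => unify x t end in constr:(0%N)
    | _ => let i := lindex env' t in constr:(S i)
    end
  end.
Ltac linsert env t :=
  match constr:(tt) with
  | _ => let _ := lindex env t in env
  | _ => constr:(t :: env)
  end.
Ltac latoms env t :=
  lazymatch t with
  | (?a + ?b)%R => let env := latoms env a in latoms env b
  | (- ?a)%R => latoms env a
  | (?c *: ?a)%R => latoms env a
  | 0%R => env
  | _ => linsert env t
  end.
Ltac lreify K env t :=
  lazymatch t with
  | (?a + ?b)%R =>
    let a := lreify K env a in let b := lreify K env b in constr:(@LAdd K a b)
  | (- ?a)%R => let a := lreify K env a in constr:(@LOpp K a)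
  | (?c *: ?a)%R => let a := lreify K env a in constr:(@LScale K c a)
  | 0%R => constr:(@LZero K)
  | _ => let i := lindex env t in constr:(@LAtom K i)
  end.
(* Reduces an equality in a K-module to equalities of coefficients. *)
Ltac lin_split K :=
  lazymatch goal with
  | |- @eq ?V ?a ?b =>
    let env := latoms (@nil V) a in let env := latoms env b in
    let ta := lreify K env a in let tb := lreify K env b in
    refine (@leval_eq K _ env ta tb _); cbn [size lcoef_eq lcoef eqn];
    repeat split
  end.

(** * Lowest terms of one-parameter families *)

Section LowestTerm.
Variable K : fieldType.
Implicit Types (g : K -> K) (D : int) (c : K).

(** On nonzero b, g is b^D times a polynomial with constant term c: the lowest
term of g at b = 0 is c b^D, with c = 0 allowed when the order is higher. *)
Definition low g D c := exists2 p : {poly K}, p.[0] = c &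
  forall b, b != 0 -> g b = b ^ D * p.[b].

Lemma low_eq g g' D c : (forall b, b != 0 -> g b = g' b) -> low g D c -> low g' D c.
Proof. by move=> e [p p0 h]; exists p => // b b0; rewrite -e ?h. Qed.

Lemma low0 D : low (fun=> 0) D 0.
Proof. by exists 0 => [|b _]; rewrite ?horner0 ?mulr0. Qed.

Lemma lowX D : low (fun b => b ^ D) D 1.
Proof. by exists 1 => [|b _]; rewrite hornerC ?mulr1. Qed.

Lemma lowD g g' D c c' : low g D c -> low g' D c' -> low (fun b => g b + g' b) D (c + c').
Proof.
move=> [p p0 h] [p' p0' h']; exists (p + p') => [|b b0]; rewrite hornerD ?p0 ?p0' //.
by rewrite h // h' // mulrDr.
Qed.

Lemma lowM g g' D D' c c' :
  low g D c -> low g' D' c' -> low (fun b => g b * g' b) (D + D') (c * c').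
Proof.
move=> [p p0 h] [p' p0' h']; exists (p * p') => [|b b0]; rewrite hornerM ?p0 ?p0' //.
by rewrite h // h' // expfzDr // mulrACA.
Qed.

Lemma lowC c : low (fun=> c) 0 c.
Proof. by exists c%:P => [|b _]; rewrite hornerC // expr0z mul1r. Qed.

Lemma lowZ a g D c : low g D c -> low (fun b => a * g b) D (a * c).
Proof. by move=> h; rewrite -[D]add0r; apply: lowM => //; exact: lowC. Qed.

Lemma low_weaken g D D' c : D' < D -> low g D c -> low g D' 0.
Proof.
move=> lt [p p0 h]; have E : D = D' + (absz (D - D')).-1.+1%:Z by lia.
exists ('X^((absz (D - D')).-1.+1) * p) => [|b b0].
  by rewrite hornerM hornerXn exprS !mul0r.
by rewrite h // hornerM hornerXn E expfzDr // -mulrA -exprnP; congr (_ * (_ ^+ _ * _)); lia.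
Qed.

Lemma low_sum (I : eqType) (l : seq I) (G : I -> K -> K) D (c : I -> K) :
  (forall i, i \in l -> low (G i) D (c i)) ->
  low (fun b => \sum_(i <- l) G i b) D (\sum_(i <- l) c i).
Proof.
elim: l => [|i l IH] h.
  by rewrite big_nil; apply: low_eq (low0 D) => b _; rewrite big_nil.
have {}IH := IH (fun j jl => h j (mem_behead (s := i :: l) jl)).
rewrite big_cons; apply: low_eq (lowD (h i (mem_head _ _)) IH) => b _.
by rewrite big_cons.
Qed.

Variable q : K.
Hypothesis q_neq0 : q != 0.
Hypothesis q_generic : forall m, q ^+ m.+1 != 1.

(** The powers of q are pairwise distinct, so that a polynomial vanishing at
all nonzero scalars is 0 although K is an abstract field. *)
Lemma low_zero g D c : (forall b, b != 0 -> g b = 0) -> low g D c -> c = 0.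
Proof.
move=> g0 [p <- h]; suff -> : p = 0 by rewrite horner0.
apply/eqP; apply: contraT => p0.
(* One zero more than the degree allows. *)
pose rs := [seq q ^+ i | i <- iota 0 (size p)].
have inj : uniq rs.
  rewrite map_inj_uniq ?iota_uniq // => i j.
  wlog ij : i j / (i <= j)%N => [H|].
    by case: (leqP i j) => [/H //|/ltnW/H h' /esym/h'].
  have [->//|ne] := eqVneq i j.
  have -> : j = (i + (j - i).-1.+1)%N by lia.
  rewrite exprD -{1}[q ^+ i]mulr1 => /(mulfI (expf_neq0 i q_neq0))/esym/eqP.
  by rewrite (negbTE (q_generic _)).
have roots : all (root p) rs.
  apply/allP => _ /mapP[i _ ->]; have qi0 : q ^+ i != 0 by rewrite expf_neq0.
  have := h _ qi0; rewrite g0 // => /esym/eqP; rewrite mulf_eq0 => /orP[|//].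
  by rewrite expfz_eq0 (negbTE qi0) andbF.
by have := max_poly_roots p0 roots inj; rewrite size_map size_iota ltnn.
Qed.

Lemma low_unique g D c c' : low g D c -> low g D c' -> c = c'.
Proof.
move=> h /(lowZ (-1)) h'; apply/eqP; rewrite -subr_eq0 -mulN1r; apply/eqP.
by apply: low_zero (lowD h h') => b _; rewrite mulN1r subrr.
Qed.

End LowestTerm.

(** A family F that satisfies every linear relation satisfied by the columns of
M is determined linearly by these columns; the pseudo-inverse of M does it. *)
Lemma kernel_factor (K : fieldType) (W : finType) (V : lmodType K) (M : W -> W -> K) (F : W -> V) :
  (forall c : W -> K, (forall v, \sum_w c w * M v w = 0) -> \sum_w c w *: F w = 0) ->
  exists Q : W -> W -> K, forall w, F w = \sum_u (\sum_v Q u v * M v w) *: F u.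
Proof.
move=> h; pose Mx : 'M[K]_#|W| := \matrix_(i, j) M (enum_val i) (enum_val j).
pose Q u v := pinvmx Mx (enum_rank u) (enum_rank v).
have MQM v w : \sum_u M v u * (\sum_t Q u t * M t w) = M v w.
  have E : Mx *m (pinvmx Mx *m Mx) = Mx by rewrite mulmxA mulmxKpV.
  have := congr1 (fun X : 'M_ _ => X (enum_rank v) (enum_rank w)) E.
  rewrite mxE [RHS]mxE !enum_rankK => <-.
  rewrite [RHS](reindex enum_rank) /=; last by exists enum_val => ? _; rewrite ?enum_rankK ?enum_valK.
  apply: eq_bigr => u _; rewrite [Mx (enum_rank v) _]mxE !enum_rankK; congr (_ * _).
  rewrite [RHS]mxE.
  rewrite [RHS](reindex enum_rank) /=; last by exists enum_val => ? _; rewrite ?enum_rankK ?enum_valK.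
  by apply: eq_bigr => t _; rewrite [Mx _ _]mxE !enum_rankK.
exists Q => w; pose c u := (u == w)%:R - \sum_t Q u t * M t w.
have /h : forall v, \sum_u c u * M v u = 0.
  move=> v; rewrite /c; under eq_bigr do rewrite mulrBl.
  rewrite sumrB (bigD1 w) //= eqxx mul1r big1 => [|u /negbTE->]; last by rewrite mul0r.
  by rewrite addr0 -[X in X - _]MQM; apply/eqP; rewrite subr_eq0; apply/eqP; apply: eq_bigr => u _; rewrite mulrC.
rewrite /c; under eq_bigr do rewrite scalerBl.
rewrite sumrB (bigD1 w) //= eqxx scale1r big1 => [|u /negbTE->]; last by rewrite scale0r.
by rewrite addr0 => /eqP; rewrite subr_eq0 => /eqP.
Qed.

(** The exponent of b in the value of the character omega_i |-> b^(N i),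
omega'_i |-> b^(N' i) at the torus monomial with exponents m. *)
Definition expdot (n : nat) (N N' : 'I_n -> nat) (m : rootlattice n * rootlattice n) : int :=
  \sum_i (N' i)%:Z * m.1 i + \sum_i (N i)%:Z * m.2 i.

(** With N i = B^i and N' i = B^(n + i), the exponent of m is the value at B of
a polynomial that has the entries of m as coefficients.  The nonzero
differences of these finitely many polynomials have a common non-root B. *)
Lemma separating_exponents (n : nat) (s : seq (rootlattice n * rootlattice n)) :
  exists N N' : 'I_n -> nat, (forall i, (N i < N' i)%N) /\
  {in s &, injective (expdot N N')}.
Proof.
pose P (m m' : rootlattice n * rootlattice n) : {poly int} :=
  \sum_(i < n) (m.1 i - m'.1 i) *: 'X^(n + i) + \sum_(i < n) (m.2 i - m'.2 i) *: 'X^i.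
have coefP m m' : P m m' = 0 -> m = m'.
  move=> P0.
  have S (a : 'I_n -> int) k : (\sum_(i < n) a i *: 'X^i)`_k = \sum_(i < n) a i * (k == i :> nat)%:R.
    by rewrite coef_sum; apply: eq_bigr => i _; rewrite coefZ coefXn.
  have S' (a : 'I_n -> int) k : (\sum_(i < n) a i *: 'X^(n + i))`_k = \sum_(i < n) a i * (k == n + i :> nat)%:R.
    by rewrite coef_sum; apply: eq_bigr => i _; rewrite coefZ coefXn.
  case: m m' P0 => [a b] [a' b'] P0; congr (_, _); apply/ffunP => k.
    have := congr1 (fun p : {poly int} => p`_(n + k)) P0; rewrite coefD S S' coef0 /=.
    rewrite (bigD1 k) //= eqxx mulr1 !big1 ?addr0 => [/eqP|i _|i ik].
    - by rewrite subr_eq0 => /eqP.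
    - by rewrite gtn_eqF ?mulr0 //; apply: leq_trans (ltn_ord i) (leq_addr _ _).
    - by rewrite eqn_add2l eq_sym val_eqE (negbTE ik) mulr0.
  have := congr1 (fun p : {poly int} => p`_k) P0; rewrite coefD S S' coef0 /=.
  rewrite [X in _ + X](bigD1 k) //= eqxx mulr1 !big1 ?add0r ?addr0 => [/eqP|i ik|i _].
  - by rewrite subr_eq0 => /eqP.
  - by rewrite eq_sym val_eqE (negbTE ik) mulr0.
  - by rewrite ltn_eqF ?mulr0 //; apply: leq_trans (ltn_ord k) (leq_addr _ _).
pose Q : {poly int} := \prod_(m <- s) \prod_(m' <- s | m' != m) P m m'.
have Q0 : Q != 0.
  rewrite prodf_seq_neq0; apply/allP => m _ /=; rewrite prodf_seq_neq0; apply/allP => m' _.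
  by apply/implyP => ne; apply: contraNneq ne => /coefP ->.
have [B [B2 QB]] : exists B : nat, (1 < B)%N /\ Q.[B%:Z] != 0.
  apply: contrapT => no; pose rts := [seq (i.+2)%:Z | i <- iota 0 (size Q)].
  have := @max_poly_roots int Q rts Q0; rewrite size_map size_iota ltnn => H.
  suff : false by []; apply: H; last by rewrite map_inj_uniq ?iota_uniq // => i j []; lia.
  apply/allP => _ /mapP[i _ ->]; rewrite rootE; apply/negPn/negP => z.
  by apply: no; exists i.+2.
exists (fun i => B ^ i)%N, (fun i => B ^ (n + i))%N; split=> [i|m m' ms m's /= E].
  by rewrite ltn_exp2l //; have := ltn_ord i; lia.
apply/eqP; apply: contraNT QB => ne; rewrite horner_prod.
rewrite prodf_seq_eq0; apply/hasP; exists m => //=; rewrite horner_prod prodf_seq_eq0.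
apply/hasP; exists m' => //=; rewrite eq_sym ne /=.
have X (a b : 'I_n -> int) (k : 'I_n -> nat) : (\sum_(i < n) (a i - b i) *: 'X^(k i)).[B%:Z] =
    \sum_i (B ^ k i)%N%:Z * a i - \sum_i (B ^ k i)%N%:Z * b i.
  rewrite horner_sum -sumrB; apply: eq_bigr => i _.
  by rewrite hornerZ hornerXn -mulrBr mulrC; congr (_ * _); elim: (k i) => // t IHt; rewrite exprS IHt expnS.
by rewrite /root hornerD !X addrACA -opprD -/(expdot _ _ _) subr_eq0; apply/eqP.
Qed.

Lemma exists_min (I : eqType) (l : seq I) (k : I -> int) : l != [::] ->
  exists2 x, x \in l & forall y, y \in l -> k x <= k y.
Proof.
elim: l => // i [|j l] IH _.
  by exists i; rewrite ?mem_head // => y; rewrite inE => /eqP->.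
have [x xl xm] := IH isT; have [le|/ltW le] := lerP (k i) (k x).
  exists i; first exact: mem_head.
  by move=> y; rewrite in_cons => /predU1P[->//|/xm]; exact: le_trans.
exists x; first by rewrite in_cons xl orbT.
by move=> y; rewrite in_cons => /predU1P[->//|/xm].
Qed.

(** * Free modules *)

Section MalgExtension.
Context {K : nzRingType} {G : choiceType}.
Implicit Types (y : malg G K).

Lemma malgU_scale (k : G) (c : K) : mkmalgU k c = c *: mkmalgU k 1.
Proof. by apply/malgP => x; rewrite mcoeffZ !mcoeffU mulrnAr mulr1. Qed.

Lemma malg_ind (P : malg G K -> Prop) :
  P 0 -> (forall c k y, P y -> P (c *: mkmalgU k 1 + y)) -> forall y, P y.
Proof.
move=> P0 PS y; rewrite [y]monalgE; elim: (finmap.enum_fset _) => [|k s IH].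
  by rewrite big_nil.
by rewrite big_cons malgU_scale; apply: PS.
Qed.

Definition malg_ext (W : lmodType K) (g : G -> W) y : W :=
  \sum_(k <- finmap.enum_fset (msupp y)) mcoeff k y *: g k.

Lemma malg_extEw (W : lmodType K) (g : G -> W) (d : finmap.finSet G) y :
  finmap.fsubset (msupp y) d ->
  malg_ext g y = \sum_(k <- finmap.enum_fset d) mcoeff k y *: g k.
Proof.
move=> le; rewrite /malg_ext.
by apply: (finmap.big_fset_incl _ le) => x xd /mcoeff_outdom ->; rewrite scale0r.
Qed.

Lemma malg_ext_is_linear (W : lmodType K) (g : G -> W) : linear (malg_ext g).
Proof.
move=> a y z; pose d := finmap.fsetU (msupp y) (msupp z).
have sy : finmap.fsubset (msupp y) d by exact: finmap.fsubsetUl.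
have sz : finmap.fsubset (msupp z) d by exact: finmap.fsubsetUr.
have s : finmap.fsubset (msupp (a *: y + z)) d.
  apply: finmap.fsubset_trans (msuppD_le _ _) _.
  by apply: finmap.fsetUSS => //; exact: msuppZ_le.
rewrite !(@malg_extEw _ _ d) // scaler_sumr -big_split /=.
by apply: eq_bigr => k _; rewrite mcoeffD mcoeffZ scalerDl scalerA.
Qed.
HB.instance Definition _ (W : lmodType K) (g : G -> W) :=
  GRing.isLinear.Build K (malg G K) W *:%R (malg_ext g) (@malg_ext_is_linear W g).

Lemma malg_extU (W : lmodType K) (g : G -> W) k : malg_ext g (mkmalgU k 1) = g k.
Proof.
rewrite (@malg_extEw _ _ (finmap.fset1 k)); last exact: msuppU_le.
by rewrite finmap.big_seq_fset1 mcoeffUU scale1r.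
Qed.

End MalgExtension.

(** The free module on G by its interface: a basis, coordinates and linear
extensions.  Going through a record keeps conversion from unfolding the
finitely supported functions which realize it. *)
Record free_module (K : nzRingType) (G : choiceType) := FreeModule {
  free_module_sort :> lmodType K;
  free_single : G -> free_module_sort;
  free_coef : G -> free_module_sort -> K;
  free_ext : forall W : lmodType K, (G -> W) -> free_module_sort -> W;
  free_coefP : forall k a y z,
    free_coef k (a *: y + z) = a * free_coef k y + free_coef k z;
  free_coef_single : forall k l, free_coef l (free_single k) = (k == l)%:R;
  free_ext_linear : forall W g, linear (@free_ext W g);
  free_ext_single : forall W g k, @free_ext W g (free_single k) = g k;
  free_coef_inj : forall y z, (forall k, free_coef k y = free_coef k z) -> y = z;
  free_ind : forall P : free_module_sort -> Prop, P 0 ->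
    (forall c k y, P y -> P (c *: free_single k + y)) -> forall y, P y }.

Definition free_module_on (K : nzRingType) (G : choiceType) : free_module K G.
Proof.
apply: (@FreeModule K G (malg G K : lmodType K) (fun k => mkmalgU k 1) (fun k y => mcoeff k y)
  (fun W g y => malg_ext g y)).
- by move=> k a y z; rewrite mcoeffD mcoeffZ.
- by move=> k l; rewrite mcoeffU.
- exact: malg_ext_is_linear.
- exact: malg_extU.
- by move=> y z /malgP.
- exact: malg_ind.
Qed.

Section FreeModule.
Context {K : nzRingType} {G : choiceType}.
Local Notation T := (free_module_on K G).
Implicit Types (y z : T).

Definition single (k : G) : T := free_single _ k.
Definition coef (k : G) (y : T) : K := free_coef k y.
Definition lext (W : lmodType K) (g : G -> W) (y : T) : W := free_ext g y.

HB.instance Definition _ (W : lmodType K) (g : G -> W) :=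
  GRing.isLinear.Build K T W *:%R (lext g) (free_ext_linear g).

Lemma lext_single (W : lmodType K) (g : G -> W) k : lext g (single k) = g k.
Proof. exact: free_ext_single. Qed.

Lemma coefP k a y z : coef k (a *: y + z) = a * coef k y + coef k z.
Proof. exact: free_coefP. Qed.

Lemma coefD k y z : coef k (y + z) = coef k y + coef k z.
Proof. by rewrite -[y]scale1r coefP mul1r scale1r. Qed.

Lemma coef0 k : coef k (0 : T) = 0.
Proof. by apply: (addrI (coef k (0 : T))); rewrite -coefD !addr0. Qed.

Lemma coefZ k a y : coef k (a *: y) = a * coef k y.
Proof. by rewrite -[_ *: _]addr0 coefP coef0 addr0. Qed.

Lemma coef_single k l : coef l (single k) = (k == l)%:R.
Proof. exact: free_coef_single. Qed.

Lemma coef_inj y z : (forall k, coef k y = coef k z) -> y = z.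
Proof. exact: free_coef_inj. Qed.

Lemma single_ind (P : T -> Prop) :
  P 0 -> (forall c k y, P y -> P (c *: single k + y)) -> forall y, P y.
Proof. exact: free_ind. Qed.

Lemma eq_linear (W : lmodType K) (f g : {linear T -> W}) :
  (forall k, f (single k) = g (single k)) -> f =1 g.
Proof.
move=> fg; apply: single_ind => [|c k y IH]; first by rewrite !linear0.
by rewrite !linearP fg IH.
Qed.

Definition restr (Q : pred G) : T -> T :=
  lext (fun k => if Q k then single k else 0).
HB.instance Definition _ Q := GRing.Linear.on (restr Q).

Lemma restr_single (Q : pred G) k : restr Q (single k) = if Q k then single k else 0.
Proof. exact: lext_single. Qed.

Lemma coef_restr (Q : pred G) k y : coef k (restr Q y) = if Q k then coef k y else 0.
Proof.
move: y; apply: single_ind => [|c l y IH]; first by rewrite linear0 coef0 if_same.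
rewrite linearP /= !coefP IH restr_single.
have [<-|lk] := eqVneq l k; first by case: (Q l) => //; rewrite coef0 mulr0 addr0.
by case: (Q l); case: (Q k); rewrite ?coef_single ?coef0 ?(negbTE lk) ?mulr0 ?addr0.
Qed.

Definition insupp (Q : pred G) y := forall k, coef k y != 0 -> Q k.

Lemma insupp0 (Q : pred G) : insupp Q 0.
Proof. by move=> k; rewrite coef0 eqxx. Qed.

Lemma insuppP (Q : pred G) c y z :
  insupp Q y -> insupp Q z -> insupp Q (c *: y + z).
Proof.
move=> hy hz k; rewrite coefP.
have [y0|/hy //] := eqVneq (coef k y) 0.
by have [z0|/hz //] := eqVneq (coef k z) 0; rewrite y0 z0 mulr0 addr0 eqxx.
Qed.

Lemma insuppZ (Q : pred G) c y : insupp Q y -> insupp Q (c *: y).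
Proof. by move=> h; rewrite -[_ *: _]addr0; apply: insuppP => //; exact: insupp0. Qed.

Lemma insuppD (Q : pred G) y z : insupp Q y -> insupp Q z -> insupp Q (y + z).
Proof. by move=> h; rewrite -[y]scale1r; exact: insuppP. Qed.

Lemma insupp_single (Q : pred G) k : Q k -> insupp Q (single k).
Proof. by move=> Qk l; rewrite coef_single; case: (k =P l) => [<- //|_]; rewrite eqxx. Qed.

Lemma insupp_sub (Q Q' : pred G) y : subpred Q Q' -> insupp Q y -> insupp Q' y.
Proof. by move=> h Qy w /Qy/h. Qed.

Lemma insupp_pred0 y : insupp pred0 y -> y = 0.
Proof. by move=> h; apply: coef_inj => k; rewrite coef0; apply/eqP/negP => /negP/h. Qed.

Lemma insupp_seq y : exists s : seq G, insupp (fun k => k \in s) y.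
Proof.
move: y; apply: single_ind => [|c k y [s hs]]; first by exists [::]; exact: insupp0.
exists (k :: s); apply: insuppP; first by apply: insupp_single; rewrite mem_head.
by apply: insupp_sub hs => l; rewrite in_cons => ->; rewrite orbT.
Qed.

Lemma insupp_ind (Q : pred G) (P : T -> Prop) :
  P 0 -> (forall c k y, Q k -> P y -> P (c *: single k + y)) ->
  forall y, insupp Q y -> P y.
Proof.
move=> P0 PS y Qy; have -> : y = restr Q y.
  apply: coef_inj => k; rewrite coef_restr; case: ifP => // Qk.
  by apply/eqP/negPn/negP => /Qy; rewrite Qk.
move: {Qy} y; apply: single_ind => [|c k y IH]; first by rewrite linear0.
rewrite linearP /= restr_single; case: ifP => Qk; first exact: PS.
by rewrite scaler0 add0r.
Qed.

Lemma insupp_restr (Q Q' : pred G) y :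
  insupp Q' y -> insupp (predI Q Q') (restr Q y).
Proof.
by move=> h k; rewrite coef_restr /=; case: (Q k) => [/h //|]; rewrite eqxx.
Qed.

Lemma restr_split (Q : pred G) y : y = restr Q y + restr (predC Q) y.
Proof.
by apply: coef_inj => k; rewrite coefD !coef_restr /=; case: (Q k); rewrite ?addr0 ?add0r.
Qed.

Lemma restr_restr (P Q : pred G) y : restr P (restr Q y) = restr (predI P Q) y.
Proof. by apply: coef_inj => k; rewrite !coef_restr /=; case: (P k). Qed.

End FreeModule.

Lemma insupp_lext (K : nzRingType) (G H : choiceType) (Q : pred G) (Q' : pred H)
    (g : G -> free_module_on K H) (y : free_module_on K G) :
  (forall k, Q k -> insupp Q' (g k)) -> insupp Q y -> insupp Q' (lext g y).
Proof.
move=> h; move: y; apply: insupp_ind => [|c k z Qk IH]; first by rewrite linear0; exact: insupp0.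
by rewrite linearP /= lext_single; apply: insuppP => //; exact: h.
Qed.

(** * Words, skew derivations and the form *)

Section Words.
Context {K : fieldType} {n : nat}.
Local Notation word := (seq 'I_n).
Local Notation T := (free_module_on K word).
Implicit Types (w u v : word) (y : T) (i j k : 'I_n).

Definition mulw k : T -> T := lext (fun w => single (k :: w)).
HB.instance Definition _ k := GRing.Linear.on (mulw k).

Lemma mulw_single k w : mulw k (single w) = single (k :: w).
Proof. exact: lext_single. Qed.

Definition weightf (c : 'I_n -> K) w := \prod_(j <- w) c j.

Lemma weightf_cons c j w : weightf c (j :: w) = c j * weightf c w.
Proof. exact: big_cons. Qed.

Definition scal (c : 'I_n -> K) : T -> T := lext (fun w => weightf c w *: single w).
HB.instance Definition _ c := GRing.Linear.on (scal c).

Lemma scal_single c w : scal c (single w) = weightf c w *: single w.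
Proof. exact: lext_single. Qed.

(** The skew derivation dual to the letter i: it deletes an occurrence of i and
multiplies by the value of the character c on the letters that follow it. *)
Fixpoint derw (c : 'I_n -> K) i w : T :=
  if w is j :: w' then
    mulw j (derw c i w') + (j == i)%:R *: (weightf c w' *: single w')
  else 0.

Definition der c i : T -> T := lext (derw c i).
HB.instance Definition _ c i := GRing.Linear.on (der c i).

Lemma der_single c i w : der c i (single w) = derw c i w.
Proof. exact: lext_single. Qed.

Lemma scal_mulw c j y : scal c (mulw j y) = c j *: mulw j (scal c y).
Proof.
apply: (eq_linear (f := scal c \o mulw j) (g := c j \*: (mulw j \o scal c))) => w.
by rewrite /= mulw_single !scal_single linearZ /= mulw_single weightf_cons scalerA.
Qed.

Lemma der_mulw c i j y :
  der c i (mulw j y) = mulw j (der c i y) + (j == i)%:R *: scal c y.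
Proof.
apply: (eq_linear (f := der c i \o mulw j)
  (g := (mulw j \o der c i) \+ ((j == i)%:R \*: scal c))) => w.
by rewrite /= mulw_single !der_single /= scal_single.
Qed.

Lemma scal_der (c d : 'I_n -> K) i y : d i != 0 ->
  scal d (der c i y) = (d i)^-1 *: der c i (scal d y).
Proof.
move=> di0.
apply: (eq_linear (f := scal d \o der c i) (g := (d i)^-1 \*: (der c i \o scal d))).
elim=> [|j w IH] /=; first by rewrite scal_single linearZ /= der_single /= !(linear0, scaler0).
move: IH; rewrite /= !der_single !scal_single !linearZ /= !der_single /= => IH.
rewrite linearD /= scal_mulw IH !linearZ /= scal_single weightf_cons.
rewrite !scalerDr.
rewrite !scalerA.
apply: congr2; apply: (congr1 (fun a => a *: _)); first by ring.
by case: eqP => [->|_]; rewrite ?mul0r ?mulr0 ?mul0r // !mul1r !mulr1 mulKf // mulrC.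
Qed.

(** Deleting an i and a j in either order gives the same words; the scalars
differ by d i or by (c j)^-1 according to the relative position of the two
letters, whence the hypothesis. *)
Lemma der_der (c d : 'I_n -> K) i j y : c j * d i = 1 ->
  der c i (der d j y) = d i *: der d j (der c i y).
Proof.
move=> cd.
have di0 : d i != 0 by apply: contraPneq cd => ->; rewrite mulr0 => /esym/eqP; rewrite oner_eq0.
have cj0 : c j != 0 by apply: contraPneq cd => ->; rewrite mul0r => /esym/eqP; rewrite oner_eq0.
have cE : c j = (d i)^-1 by rewrite -[LHS](mulfK di0) cd mul1r.
apply: (eq_linear (f := der c i \o der d j) (g := d i \*: (der d j \o der c i))).
elim=> [|k w IH] /=; first by rewrite !der_single /= !(linear0, scaler0).
move: IH; rewrite /= !der_single /= => IH.
rewrite !linearD !linearZ /= !der_mulw IH !linearZ /= !der_single /=.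
rewrite -[derw d j w]der_single -[derw c i w]der_single (scal_der _ _ di0).
rewrite (scal_der _ _ cj0) !scal_single !linearZ /= !der_single !scalerDr !scalerA.
rewrite cE invrK -!addrA.
apply: congr2; first by [].
rewrite addrC.
by apply: congr2; apply: (congr1 (fun a => a *: _)); [field | ring].
Qed.

Lemma coef_mulw_nil j y : coef [::] (mulw j y) = 0.
Proof.
move: y; apply: single_ind => [|c w y IH]; first by rewrite linear0 coef0.
by rewrite linearP /= mulw_single coefD coefZ IH coef_single mulr0 addr0.
Qed.

Lemma coef_der_nil c j y : coef [::] (der c j y) = coef [:: j] y.
Proof.
move: y; apply: single_ind => [|a w y IH]; first by rewrite linear0 !coef0.
rewrite linearP /= der_single !coefD !coefZ IH coef_single.
apply: congr2 => //; apply: congr2 => //.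
case: w => [|k w] /=; first by rewrite coef0.
rewrite coefD coef_mulw_nil add0r !coefZ coef_single eqseq_cons.
case: w => [|l w]; first by rewrite /weightf big_nil mul1r mulr1 andbT.
by rewrite andbF !mulr0.
Qed.

Lemma insupp_mulw (Q Q' : pred word) j y :
  (forall w, Q w -> Q' (j :: w)) -> insupp Q y -> insupp Q' (mulw j y).
Proof. by move=> h; apply: insupp_lext => w /h Qw; exact: insupp_single. Qed.

Lemma insupp_derw c i w : insupp (fun u => perm_eq w (i :: u)) (derw c i w).
Proof.
elim: w => [|j w IH] /=; first exact: insupp0.
apply: insuppD.
  apply: insupp_mulw IH => u; rewrite -(perm_cons j) => /perm_trans; apply.
  by rewrite -cat1s -[i :: _]cat1s perm_catCA.
case: eqP => [->|_]; last by rewrite scale0r; exact: insupp0.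
by do 2 apply: insuppZ; exact: insupp_single.
Qed.

Lemma insupp_der (Q Q' : pred word) c i y :
  (forall w u, Q w -> perm_eq w (i :: u) -> Q' u) ->
  insupp Q y -> insupp Q' (der c i y).
Proof.
move=> h; apply: insupp_lext => w Qw u /insupp_derw; exact: h.
Qed.

Variable pr : 'I_n -> 'I_n -> K.
Hypothesis pr_neq0 : forall i j, pr i j != 0.

Definition chi i j := (pr j i)^-1.
Definition chi' i j := pr i j.
(** In U the commutator of e_i with an element y of U^- is, up to a scalar,
derA i y * omega_i - derB i y * omega'_i: these are the two q-derivations of
Lusztig and Kashiwara. *)
Definition derA i := der (chi i) i.
Definition derB i := der (chi' i) i.
HB.instance Definition _ i := GRing.Linear.on (derA i).
HB.instance Definition _ i := GRing.Linear.on (derB i).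

Lemma derAB i j y : derA i (derB j y) = pr j i *: derB j (derA i y).
Proof. by apply: der_der; rewrite /chi /chi' mulVf. Qed.

Definition derAs w y : T := foldr derA y w.

Lemma derAs_is_linear w : linear (derAs w).
Proof. by move=> a y z; elim: w => //= i w ->; rewrite linearP. Qed.
HB.instance Definition _ w :=
  GRing.isLinear.Build K T T *:%R (derAs w) (derAs_is_linear w).

Lemma derAs_derB w j y : derAs w (derB j y) = weightf (chi' j) w *: derB j (derAs w y).
Proof.
elim: w => [|i w IH] /=; first by rewrite /weightf big_nil scale1r.
by rewrite IH linearZ /= derAB weightf_cons scalerA mulrC.
Qed.

(** The pairing of a word of e's with an element of U^-. *)
Definition form w y : K := coef [::] (derAs w y).

Lemma form_linear w a y z : form w (a *: y + z) = a * form w y + form w z.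
Proof. by rewrite /form linearP /= coefD coefZ. Qed.

Lemma form0 w : form w 0 = 0.
Proof. by rewrite /form linear0 coef0. Qed.

Definition radical y := forall w, form w y = 0.

Lemma radical_derA i y : radical y -> radical (derA i y).
Proof. by move=> h w; rewrite -(h (rcons w i)) /form /derAs foldr_rcons. Qed.

(** derB commutes with all derA up to scalars, and agrees with derA on words of
length one: pairing with derB j y is pairing y with a longer word. *)
Lemma radical_derB i y : radical y -> radical (derB i y).
Proof.
move=> h w; rewrite /form derAs_derB coefZ coef_der_nil.
by have := h (i :: w); rewrite /form /= /derA coef_der_nil => ->; rewrite mulr0.
Qed.

Lemma form_perm w y : insupp (fun u => ~~ perm_eq w u) y -> form w y = 0.
Proof.
elim/last_ind: w y => [|w i IH] y h.
  by apply/eqP/negP => /negP /h; rewrite perm_refl.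
rewrite /form /derAs foldr_rcons; apply: IH.
apply: insupp_der h => v u /negP wv vu; apply/negP => wu; apply: wv.
rewrite perm_sym; apply: (perm_trans vu).
by rewrite perm_sym perm_rcons perm_cons.
Qed.

Lemma form_restr (Q : pred word) w y :
  (forall u v, perm_eq u v -> Q u = Q v) ->
  form w (restr Q y) = if Q w then form w y else 0.
Proof.
move=> hQ; move: y; apply: single_ind => [|c u y IH].
  by rewrite linear0 form0 if_same.
rewrite linearP /= !form_linear IH restr_single.
have [wu|wu] := boolP (perm_eq w u).
  by rewrite (hQ _ _ wu); case: (Q u); rewrite // form0 mulr0 addr0.
have f0 : form w (single u) = 0 by apply: form_perm; exact: insupp_single.
by rewrite f0 [form w (if _ then _ else _)](_ : _ = 0) ?mulr0 ?add0r //; case: ifP => // _; exact: form0.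
Qed.

Lemma radical_restr (Q : pred word) y :
  (forall u v, perm_eq u v -> Q u = Q v) -> radical y -> radical (restr Q y).
Proof. by move=> hQ h w; rewrite form_restr // h if_same. Qed.

End Words.

(** * The radical of the form vanishes under the Serre relations *)

Section RestrPerm.
Context {K : fieldType} {n : nat}.
Local Notation word := (seq 'I_n).
Local Notation T := (free_module_on K word).
Implicit Types (w u v : word) (y : T).

(** Two words have the same weight when they are permutations of each other, so
this is the decomposition of y into weight components. *)
Lemma restr_perm_ind (W : lmodType K) (ev : {linear T -> W}) y :
  (forall w, ev (restr (perm_eq w) y) = 0) -> ev y = 0.
Proof.
have [s] := insupp_seq y; elim: s y => [|w s IH] y sy h.
  by rewrite (insupp_pred0 sy) linear0.
rewrite (restr_split (perm_eq w) y) linearD /= h add0r; apply: IH => [|v].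
  apply: insupp_sub (insupp_restr sy) => u /= /andP[+]; rewrite in_cons.
  by case: eqP => // ->; rewrite perm_refl.
rewrite restr_restr; have [wv|wv] := boolP (perm_eq w v).
  rewrite [restr _ _](_ : _ = 0) ?linear0 //; apply: coef_inj => u.
  rewrite coef_restr /= coef0; case: ifP => // /andP[vu].
  by rewrite (perm_trans wv vu).
rewrite -[RHS](h v); congr (ev _); apply: coef_inj => u; rewrite !coef_restr /=.
have [vu|//] := boolP (perm_eq v u).
by rewrite (contraNN _ wv) // => wu; apply: (perm_trans wu); rewrite perm_sym.
Qed.

End RestrPerm.

Section NoPrimitive.
Context {K : fieldType} {n : nat} {A : algType K}.
Local Notation word := (seq 'I_n).
Local Notation T := (free_module_on K word).
Implicit Types (x : word) (y : T) (i j k : 'I_n) (u v : A).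
Variables (pr : 'I_n -> 'I_n -> K) (delta : 'I_n -> K).
Variables e f w wV w' w'V : 'I_n -> A.

Local Notation q i := (pr i i)^-1.
Definition qint i m := \sum_(t < m) q i ^+ t.

Definition torus_conj i u := w i * u * wV i.
(** The q-adjoint action of f_i, a skew derivation twisted by conjugation with
omega_i. *)
Definition skew_ad i u := f i * u - torus_conj i u * f i.

Hypothesis pr_neq0 : forall i j, pr i j != 0.
Hypothesis delta_neq0 : forall i, delta i != 0.
Hypothesis q_generic : forall i m, q i ^+ m.+1 != 1.
Hypothesis wK : forall i, w i * wV i = 1.
Hypothesis wVK : forall i, wV i * w i = 1.
Hypothesis w'K : forall i, w' i * w'V i = 1.
Hypothesis hwf : forall i j, w j * f i = (pr i j)^-1 *: (f i * w j).
Hypothesis hw'f : forall i j, w' j * f i = pr j i *: (f i * w' j).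
Hypothesis hef : forall i j,
  e i * f j = f j * e i + (j == i)%:R *: (delta i *: (w i - w' i)).

Definition evf : T -> A := lext (fun x => \prod_(k <- x) f k).
HB.instance Definition _ := GRing.Linear.on evf.

Lemma evf_single x : evf (single x) = \prod_(k <- x) f k.
Proof. exact: lext_single. Qed.

Lemma evf_mulw k y : evf (mulw k y) = f k * evf y.
Proof.
move: y; apply: single_ind => [|c x y IH]; first by rewrite !linear0 mulr0.
by rewrite !linearP /= mulw_single !evf_single big_cons IH mulrDr -scalerAr.
Qed.

Lemma w_evf i y : w i * evf y = evf (scal (chi pr i) y) * w i.
Proof.
move: y; apply: single_ind => [|c x y IH]; first by rewrite !linear0 mulr0 mul0r.
rewrite !linearP /= mulrDr mulrDl IH; congr (_ + _).
rewrite scal_single linearZ /= evf_single -!scalerAr -!scalerAl; congr (_ *: _).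
elim: x => [|k x IHx]; first by rewrite big_nil /weightf big_nil mul1r mulr1 scale1r.
by rewrite big_cons mulrA hwf -!scalerAl -!mulrA IHx weightf_cons -scalerAr scalerA.
Qed.

Lemma w'_evf i y : w' i * evf y = evf (scal (chi' pr i) y) * w' i.
Proof.
move: y; apply: single_ind => [|c x y IH]; first by rewrite !linear0 mulr0 mul0r.
rewrite !linearP /= mulrDr mulrDl IH; congr (_ + _).
rewrite scal_single linearZ /= evf_single -!scalerAr -!scalerAl; congr (_ *: _).
elim: x => [|k x IHx]; first by rewrite big_nil /weightf big_nil mul1r mulr1 scale1r.
by rewrite big_cons mulrA hw'f -!scalerAl -!mulrA IHx weightf_cons -scalerAr scalerA.
Qed.

Lemma e_evf i y : e i * evf y =
  evf y * e i + delta i *: (evf (derA pr i y) * w i - evf (derB pr i y) * w' i).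
Proof.
move: y; apply: single_ind => [|c x y IH].
  by rewrite !linear0 mulr0 !mul0r subrr scaler0 addr0.
rewrite !linearP /= mulrDr !mulrDl IH -scalerAr -!scalerAl.
suff -> : e i * evf (single x) = evf (single x) * e i +
    delta i *: (evf (derA pr i (single x)) * w i - evf (derB pr i (single x)) * w' i).
  rewrite scalerDr addrACA; congr (_ + _).
  by rewrite opprD addrACA -scalerBr [in RHS]scalerDr !scalerA mulrC.
elim: x {IH} => [|k x IH].
  by rewrite evf_single big_nil /derA /derB !der_single /= !linear0 !mul0r subrr scaler0 addr0 mulr1 mul1r.
rewrite -mulw_single evf_mulw mulrA hef mulrDl -!mulrA IH /derA /derB !der_mulw !linearD !linearZ /=.
rewrite !evf_mulw mulrDr -addrA; congr (_ + _).
rewrite !(mulrDl, mulrDr, mulrN, mulNr, scalerN, opprD, scalerDr) -!scalerAr.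
rewrite -!scalerAl ?(scalerN, mulNr) -?scalerAl w_evf w'_evf !mulrA addrACA.
by [].
Qed.

Lemma conjw_is_linear i : linear (torus_conj i).
Proof. by move=> a u v; rewrite /torus_conj mulrDr mulrDl -scalerAr -scalerAl. Qed.
HB.instance Definition _ i :=
  GRing.isLinear.Build K A A *:%R (torus_conj i) (conjw_is_linear i).

Lemma adf_is_linear i : linear (skew_ad i).
Proof.
move=> a u v; rewrite /skew_ad linearP mulrDr mulrDl -scalerAr -scalerAl scalerBr.
by rewrite opprD addrACA.
Qed.
HB.instance Definition _ i :=
  GRing.isLinear.Build K A A *:%R (skew_ad i) (adf_is_linear i).

Lemma iter_adf_linear i m : linear (iter m (skew_ad i)).
Proof. by move=> a u v; elim: m => //= m ->; rewrite linearP. Qed.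
HB.instance Definition _ i m :=
  GRing.isLinear.Build K A A *:%R (iter m (skew_ad i)) (iter_adf_linear i m).

Lemma conjwM i u v : torus_conj i (u * v) = torus_conj i u * torus_conj i v.
Proof. by rewrite /torus_conj -!mulrA; do 2 congr (_ * _); rewrite !mulrA wVK mul1r. Qed.

Lemma conjw_f i : torus_conj i (f i) = q i *: f i.
Proof. by rewrite /torus_conj hwf -scalerAl -mulrA wK mulr1. Qed.

Lemma adfM i u v : skew_ad i (u * v) = skew_ad i u * v + torus_conj i u * skew_ad i v.
Proof. by rewrite /skew_ad conjwM mulrBl mulrBr !mulrA addrA subrK. Qed.

Lemma conjw_adf i u : torus_conj i (skew_ad i u) = q i *: skew_ad i (torus_conj i u).
Proof.
by rewrite /skew_ad linearB /= !conjwM conjw_f -scalerAl -scalerAr scalerBr.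
Qed.

Definition nilf i u := exists m, iter m (skew_ad i) u = 0.

Lemma nilf_linear i a u v : nilf i u -> nilf i v -> nilf i (a *: u + v).
Proof.
move=> [m um] [l vl]; exists (l + m)%N.
by rewrite linearP /= iterD um addnC iterD vl !(linear0, addr0).
Qed.

Lemma nilf_adf i u : nilf i (skew_ad i u) <-> nilf i u.
Proof.
split=> [[m um]|[m um]]; first by exists m.+1; rewrite iterSr.
by exists m; rewrite -iterSr /= um linear0.
Qed.

Lemma iter_adf_conjw i m u : iter m (skew_ad i) u = 0 -> iter m (skew_ad i) (torus_conj i u) = 0.
Proof.
move=> um; suff [a [a0 /esym]] : exists a, a != 0 /\
    torus_conj i (iter m (skew_ad i) u) = a *: iter m (skew_ad i) (torus_conj i u).
  by rewrite um linear0 => /eqP; rewrite scaler_eq0 (negbTE a0) => /eqP.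
elim: m {um} => [|m [a [a0 IH]]] /=; first by exists 1; rewrite oner_neq0 scale1r.
exists (q i * a); rewrite mulf_neq0 ?invr_neq0 //; split=> //.
by rewrite conjw_adf IH linearZ /= scalerA.
Qed.

(** Skew Leibniz rule and induction on the two nilpotency orders. *)
Lemma nilfM i u v : nilf i u -> nilf i v -> nilf i (u * v).
Proof.
move=> [a ua] [b vb]; have [N] := ubnP (a + b).
elim: N a b u v ua vb => // N IH [|a] [|b] u v /= ua vb.
- by exists 0%N; rewrite /= ua mul0r.
- by exists 0%N; rewrite /= ua mul0r.
- by exists 0%N; rewrite /= vb mulr0.
rewrite ltnS addSn addnS => lt; apply/nilf_adf; rewrite adfM.
rewrite -[_ * v]scale1r; apply: nilf_linear.
  by apply: (IH a b.+1) => //; [rewrite -iterSr | rewrite addnS].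
apply: (IH a.+1 b) => //; last by rewrite -iterSr.
by rewrite -[LHS]/(iter a.+1 (skew_ad i) _); apply: iter_adf_conjw.
Qed.

Lemma qintSl i m : qint i m.+1 = 1 + q i * qint i m.
Proof.
rewrite /qint big_ord_recl expr0 mulr_sumr; congr (_ + _).
by apply: eq_bigr => t _; rewrite lift0 exprS.
Qed.

Lemma qint_neq0 i m : qint i m.+1 != 0.
Proof.
have E : (q i - 1) * qint i m.+1 = q i ^+ m.+1 - 1.
  by rewrite subrX1; congr (_ * _); apply: eq_bigr => t _.
by apply: contraNneq (q_generic i m) => z; rewrite -subr_eq0 -E z mulr0.
Qed.

Section Projection.
Variable i : 'I_n.

(** The coefficients are determined by [proj_mulw]: in
proj M (f_i y) = skew_ad i (proj M y), comparison of the terms with f_i ^+ a.+1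
gives the recursion. *)
Fixpoint pcoef a : K :=
  if a is b.+1 then - (pcoef b * q i ^+ b) / qint i b.+1 else 1.

(** A q-analogue of the projection of U^- onto the elements killed by the
derivation derA i, along U^- f_i; it fixes the image of y when the image of
each iterated derivative of y is 0. *)
Definition proj M y : A :=
  \sum_(a < M) pcoef a *: (evf (iter a (derA pr i) y) * f i ^+ a).

Lemma iter_derAP a c y z : iter a (derA pr i) (c *: y + z) =
  c *: iter a (derA pr i) y + iter a (derA pr i) z.
Proof. by elim: a => //= a ->; rewrite linearP. Qed.

Lemma iter_derA0 a : iter a (derA pr i) 0 = 0.
Proof. by elim: a => //= a ->; rewrite linear0. Qed.

Lemma proj_is_linear M : linear (proj M).
Proof.
move=> c y z; rewrite /proj scaler_sumr -big_split /=; apply: eq_bigr => a _.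
by rewrite iter_derAP linearP mulrDl -scalerAl scalerDr !scalerA mulrC.
Qed.
HB.instance Definition _ M :=
  GRing.isLinear.Build K T A *:%R (proj M) (proj_is_linear M).

Lemma iter_derA_mulw_neq k a y : k != i ->
  iter a (derA pr i) (mulw k y) = mulw k (iter a (derA pr i) y).
Proof.
move=> ki; elim: a => //= a ->.
by rewrite /derA der_mulw (negbTE ki) scale0r addr0.
Qed.

Lemma iter_derA_mulw a y :
  iter a.+1 (derA pr i) (mulw i y) = mulw i (iter a.+1 (derA pr i) y) +
    qint i a.+1 *: scal (chi pr i) (iter a (derA pr i) y).
Proof.
elim: a => [|a IH].
  by rewrite /= /derA der_mulw eqxx /qint big_ord1.
rewrite iterS IH linearD linearZ /= {1}/derA der_mulw eqxx scale1r -addrA.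
apply: congr2 => //.
have -> z : derA pr i (scal (chi pr i) z) = q i *: scal (chi pr i) (derA pr i z).
  rewrite /derA scal_der ?scalerA /chi ?invr_neq0 // mulfV ?scale1r //.
  by rewrite invr_neq0.
by rewrite scalerA -{1}[scal _ _]scale1r -scalerDl (qintSl i a.+1) mulrC.
Qed.

Lemma proj_mulw_neq M k y : k != i -> proj M (mulw k y) = f k * proj M y.
Proof.
move=> ki; rewrite /proj mulr_sumr; apply: eq_bigr => a _.
by rewrite iter_derA_mulw_neq // evf_mulw -mulrA -scalerAr.
Qed.

Lemma conjw_evf y : torus_conj i (evf y) = evf (scal (chi pr i) y).
Proof. by rewrite /torus_conj w_evf -mulrA wK mulr1. Qed.

Lemma conjwX a : torus_conj i (f i ^+ a) = q i ^+ a *: f i ^+ a.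
Proof.
elim: a => [|a IH]; first by rewrite !expr0 /torus_conj mulr1 wK scale1r.
by rewrite !exprS conjwM IH conjw_f -scalerAl -scalerAr scalerA.
Qed.

Lemma proj_mulw M y : iter M (derA pr i) y = 0 ->
  proj M.+1 (mulw i y) = skew_ad i (proj M.+1 y).
Proof.
move=> yM; rewrite /skew_ad /proj linear_sum mulr_suml mulr_sumr.
have -> : \sum_(a < M.+1) torus_conj i (pcoef a *: (evf (iter a (derA pr i) y) * f i ^+ a)) * f i =
  \sum_(a < M) (pcoef a * q i ^+ a) *: (evf (scal (chi pr i) (iter a (derA pr i) y)) * f i ^+ a.+1).
  rewrite big_ord_recr /= yM !(linear0, mul0r, scaler0) addr0.
  apply: eq_bigr => a _; rewrite linearZ /= conjwM conjw_evf conjwX -scalerAr.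
  by rewrite scalerA -scalerAl -mulrA -exprSr.
rewrite big_ord_recl [X in _ = X - _]big_ord_recl /= !expr0 !mulr1 !scale1r evf_mulw.
rewrite -addrA -sumrB; apply: congr2 => //; apply: eq_bigr => a _.
rewrite /bump /= add1n -[derA _ _ _]/(iter a.+1 (derA pr i) (mulw i y)).
rewrite iter_derA_mulw !linearD linearZ /= evf_mulw mulrDl scalerDr -scalerAr mulrA.
apply: congr2 => //; rewrite -scalerAl scalerA -scaleNr.
by rewrite divfK // qint_neq0.
Qed.

Lemma insupp_iter_derA a m y : insupp (fun x => size x < m + a)%N y ->
  insupp (fun x => size x < m)%N (iter a (derA pr i) y).
Proof.
elim: a m y => [|a IH] m y; first by rewrite addn0.
move=> h; rewrite iterSr; apply: IH; apply: insupp_der h => x z + /perm_size E.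
by rewrite E addnS ltnS.
Qed.

Hypothesis serre : forall k, k != i -> nilf i (f k).

(** proj turns left multiplication by f_i into skew_ad i, and commutes with
left multiplication by the other f_k, which are nilpotent by the Serre
relations.  So induction along words shows that its values are nilpotent. *)
Lemma proj_nilf M y : insupp (fun x => size x < M)%N y -> nilf i (proj M y).
Proof.
case: M => [|M].
  by move=> /insupp_pred0 ->; rewrite linear0; exists 0%N.
move: y; apply: insupp_ind => [|c x y sx IH]; first by rewrite linear0; exists 0%N.
rewrite linearP /=; apply: nilf_linear => // {c y IH}.
elim: x sx => [_|k x IH sx].
  exists 1%N; rewrite /proj big_ord_recl big1 => [|a _].
    rewrite /= addr0 scale1r mulr1 evf_single big_nil /skew_ad /torus_conj.
    by rewrite !mulr1 wK mul1r subrr.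
  by rewrite iterSr {2}/derA der_single /= iter_derA0 linear0 mul0r scaler0.
rewrite -mulw_single; have [ki|ki] := eqVneq k i.
  rewrite {k}ki in sx *; rewrite proj_mulw; last first.
    by apply: insupp_pred0; apply: (@insupp_iter_derA _ 0); exact: insupp_single.
  by apply/nilf_adf; apply: IH; exact: ltnW.
rewrite proj_mulw_neq //; apply: nilfM; first exact: serre.
by apply: IH; exact: ltnW.
Qed.

Variables (c c' : K) (u : A).
Hypothesis c'_neq0 : c' != 0.
Hypothesis wu : w i * u = c *: (u * w i).
Hypothesis w'u : w' i * u = c' *: (u * w' i).
Hypothesis eu : e i * u = u * e i.

Lemma w_iter m : w i * iter m (skew_ad i) u = (c * q i ^+ m) *: (iter m (skew_ad i) u * w i).
Proof.
elim: m => [|m IH]; first by rewrite mulr1.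
rewrite /=; set U := iter m (skew_ad i) u in IH *; rewrite /skew_ad /torus_conj IH.
rewrite -(scalerAl _ (U * w i)) -(mulrA U) wK mulr1 mulrBr mulrBl mulrA hwf.
rewrite -!scalerAl -mulrA IH -!scalerAr mulrA (mulrA (w i)) IH.
rewrite -!scalerAl -(mulrA U (w i)) hwf -!scalerAr !mulrA exprSr.
by lin_split K; ring.
Qed.

Lemma adf_iter m : iter m.+1 (skew_ad i) u =
  f i * iter m (skew_ad i) u - (c * q i ^+ m) *: (iter m (skew_ad i) u * f i).
Proof. by rewrite /= {1}/skew_ad /torus_conj w_iter -!scalerAl -!mulrA (mulrA (w i)) wK mul1r. Qed.

Lemma w'_iter m :
  w' i * iter m (skew_ad i) u = (c' * pr i i ^+ m) *: (iter m (skew_ad i) u * w' i).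
Proof.
elim: m => [|m IH]; first by rewrite mulr1.
rewrite adf_iter; set U := iter m (skew_ad i) u in IH *; rewrite mulrBr mulrBl mulrA hw'f.
rewrite -!scalerAl -mulrA IH -!scalerAr mulrA (mulrA (w' i)) IH.
rewrite -!scalerAl -(mulrA U (w' i)) hw'f -!scalerAr !mulrA exprSr.
by lin_split K; ring.
Qed.

(** Quantum sl_2: if e_i commutes with the weight vector u, its commutator with
skew_ad i ^ m u is a multiple of skew_ad i ^ (m - 1) u * omega'_i. *)
Lemma e_iter m : e i * iter m (skew_ad i) u = iter m (skew_ad i) u * e i +
  (delta i * \sum_(t < m) (c * q i ^+ t - c' * pr i i ^+ t))
    *: (iter m.-1 (skew_ad i) u * w' i).
Proof.
elim: m => [|m IH]; first by rewrite big_ord0 mulr0 scale0r addr0.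
set S := \sum_(t < m) _ in IH.
rewrite big_ord_recr /= -/S -[skew_ad _ _]/(iter m.+1 (skew_ad i) u) adf_iter.
set U := iter m (skew_ad i) u in IH *; set U' := iter m.-1 (skew_ad i) u in IH.
have UfE : (delta i * S) *: (f i * U') =
    (delta i * S) *: (U + (c * q i ^+ m * pr i i) *: (U' * f i)).
  move: @S @U @U' {IH}; case: m => [|m] S U U'.
    by rewrite /S big_ord0 mulr0 !scale0r.
  congr (_ *: _); rewrite /U adf_iter -[in LHS](subrK ((c * q i ^+ m) *: (iter m (skew_ad i) u * f i)) (f i * _)).
  by rewrite exprSr -!mulrA mulVf // mulr1.
have F1 : e i * (f i * U) = f i * U * e i + (delta i * S) *: (U * w' i)
    + (delta i * S * (c * q i ^+ m * pr i i)) *: (U' * f i * w' i)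
    + (delta i * (c * q i ^+ m)) *: (U * w i)
    - (delta i * (c' * pr i i ^+ m)) *: (U * w' i).
  rewrite mulrA hef eqxx scale1r mulrDl -mulrA IH mulrDr -scalerAr -scalerAl.
  rewrite mulrBl w_iter w'_iter -/U !mulrA scalerAl UfE scalerDr scalerA mulrDl -!scalerAl.
  by lin_split K; ring.
have F2 : e i * (U * f i) = U * f i * e i + delta i *: (U * w i) - delta i *: (U * w' i)
    + (delta i * S * pr i i) *: (U' * f i * w' i).
  rewrite mulrA IH mulrDl -mulrA hef eqxx scale1r mulrDr -scalerAl -!mulrA hw'f.
  rewrite -!scalerAr mulrBr !mulrA.
  by lin_split K; ring.
rewrite mulrBr -scalerAr F1 F2 mulrBl -scalerAl.
by lin_split K; ring.
Qed.

(** Let m.+1 be the first iterate that vanishes.  Commuting e_i past it leaves a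
multiple of the m-th iterate, whose coefficient is therefore 0. *)
Lemma primitive_weight : nilf i u -> u != 0 -> exists m, q i ^+ m * (c / c') = 1.
Proof.
move=> [l ul] u0; have ex : exists m, iter m (skew_ad i) u == 0 by exists l; rewrite ul.
case: (ex_minnP ex) => -[|m]; first by rewrite (negbTE u0).
move=> /eqP um min; have Um0 : iter m (skew_ad i) u != 0.
  by apply/negP => /min; rewrite ltnn.
have := e_iter m.+1; rewrite um mulr0 mul0r add0r => /esym/(congr1 (fun z => z * w'V i)).
rewrite mul0r -scalerAl -mulrA w'K mulr1 => /eqP; rewrite scaler_eq0 (negbTE Um0) orbF.
rewrite mulf_eq0 (negbTE (delta_neq0 i)) /= sumrB -!mulr_sumr.
(* Both sums are multiples of the same nonzero q-integer. *)
have -> : \sum_(t < m.+1) pr i i ^+ t = pr i i ^+ m * qint i m.+1.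
  rewrite (reindex_inj rev_ord_inj) /qint mulr_sumr; apply: eq_bigr => t _ /=.
  rewrite subSS expfB_cond ?(negbTE (pr_neq0 i i)) ?exprVn //.
  by rewrite add0n -ltnS.
rewrite mulrA -mulrBl mulf_eq0 (negbTE (qint_neq0 i m)) orbF subr_eq0 => /eqP cE.
exists m; rewrite cE exprVn; field.
by rewrite c'_neq0 expf_neq0.
Qed.

End Projection.

Hypothesis serre : forall i k, k != i -> nilf i (f k).
Hypothesis weight_definite : forall x, (forall i, exists m,
  q i ^+ m * (weightf (chi pr i) x / weightf (chi' pr i) x) = 1) -> x = [::].

Lemma weightf_perm (c : 'I_n -> K) x z : perm_eq x z -> weightf c x = weightf c z.
Proof. exact: perm_big. Qed.

Lemma scal_perm (c : 'I_n -> K) x y : insupp (perm_eq x) y -> scal c y = weightf c x *: y.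
Proof.
move: y; apply: insupp_ind => [|a z y xz IH]; first by rewrite linear0 scaler0.
rewrite linearP /= IH scal_single -(weightf_perm c xz) scalerDr !scalerA.
by rewrite mulrC.
Qed.

Lemma weightf_neq0 (c : 'I_n -> K) x : (forall j, c j != 0) -> weightf c x != 0.
Proof. by move=> c0; rewrite /weightf prodf_seq_neq0; apply/allP => j _; rewrite c0. Qed.

(** Induction on the length.  A component of weight x of an element of the
radical has derivatives that vanish in A.  So its image commutes with each e_i
and is fixed by proj, hence nilpotent under skew_ad i for every i;
[primitive_weight] then contradicts [weight_definite] unless the image is 0. *)
Lemma radical_evf_lt h y : insupp (fun x => size x < h)%N y -> radical pr y -> evf y = 0.
Proof.
elim: h y => [|h IH] y; first by move=> /insupp_pred0 ->; rewrite linear0.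
move=> sy ry; apply: (restr_perm_ind (ev := evf)) => x.
set z := restr _ y.
have rz : radical pr z.
  by apply: radical_restr ry => // a b ab; have /permPr -> := ab.
have xz : insupp (perm_eq x) z by apply: insupp_sub (insupp_restr sy) => a /andP[].
have sz : insupp (fun x => size x < h.+1)%N z.
  by apply: insupp_sub (insupp_restr sy) => a /andP[].
clearbody z; clear y sy ry.
have size_der c i t : insupp (fun x => size x < h.+1)%N t ->
    insupp (fun x => size x < h)%N (der c i t).
  by apply: insupp_der => a b + /perm_size ab; rewrite ab.
case: x xz => [|k x] xz.
  suff -> : z = 0 by rewrite linear0.
  apply: coef_inj => a; rewrite coef0; have := xz a; case: eqP => // _ /(_ isT).
  by rewrite perm_sym => /perm_nilP ->; exact: (rz [::]).
have [//|z0] := eqVneq (evf z) 0.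
suff : k :: x = [::] by [].
apply: weight_definite => i.
have sA : insupp (fun x => size x < h)%N (derA pr i z) by exact: size_der.
have zA a : evf (iter a.+1 (derA pr i) z) = 0.
  have : insupp (fun x => size x < h)%N (iter a.+1 (derA pr i) z).
    elim: a => //= a IHa; apply: size_der; apply: insupp_sub IHa => b /=.
    exact: ltnW.
  move/IH; apply; elim: a.+1 => //= b; exact: radical_derA.
apply: (@primitive_weight i _ _ (evf z)) => //.
- by apply: weightf_neq0 => j; exact: pr_neq0.
- by rewrite w_evf (scal_perm _ xz) linearZ /= scalerAl.
- by rewrite w'_evf (scal_perm _ xz) linearZ /= scalerAl.
- rewrite e_evf (zA 0%N) (IH (derB pr i z)) ?mul0r ?subrr ?scaler0 ?addr0 //.
    exact: size_der.
  exact: radical_derB.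
(* Only the term a = 0 of proj survives, by zA. *)
suff -> : evf z = proj i h.+1 z by apply: proj_nilf => // j; exact: serre.
rewrite /proj big_ord_recl big1 ?addr0 => [|a _]; first by rewrite /= scale1r mulr1.
by rewrite lift0 zA mul0r scaler0.
Qed.

Theorem radical_evf y : radical pr y -> evf y = 0.
Proof.
have [s hs] := insupp_seq y; apply: (@radical_evf_lt (\max_(x <- s) size x).+1).
apply: insupp_sub hs => x xs /=; rewrite ltnS.
by rewrite (big_rem _ xs) /= leq_maxl.
Qed.

End NoPrimitive.

(** * Arithmetic of the structure constants *)

Section Pairing.
Context {R : realType} {n : nat}.
Variables r s : R[i].
Hypothesis r_neq0 : r != 0.
Hypothesis s_neq0 : s != 0.
Hypothesis rs_generic : forall k l : int, r ^ k * s ^ l = 1 <-> k = 0 /\ l = 0.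
Local Notation K := (Qrs r s).
Implicit Types (i j k : 'I_n).

(** All structure constants are monomials in r and s, and by the hypothesis on
r and s these are determined by their exponents. *)
Definition rs_mon (a b : int) : K := rQ r s ^ a * sQ r s ^ b.

Lemma val_exprz (x : K) (a : int) : val (x ^ a) = val x ^ a :> R[i].
Proof.
case: a => m; first by rewrite -!exprnP rmorphXn.
by rewrite !NegzE -!exprz_inv -!exprnP rmorphXn fmorphV.
Qed.

Lemma rQ_neq0 : rQ r s != 0.
Proof. by apply: contraNneq r_neq0 => /(congr1 val); rewrite raddf0 /= => ->. Qed.

Lemma sQ_neq0 : sQ r s != 0.
Proof. by apply: contraNneq s_neq0 => /(congr1 val); rewrite raddf0 /= => ->. Qed.

Lemma rs_mon_eq1 a b : rs_mon a b = 1 -> a = 0 /\ b = 0.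
Proof.
move=> E; apply/rs_generic.
have := congr1 (fun x : K => \val x) E; rewrite /rs_mon rmorphM rmorph1 /= => <-.
by apply: congr2; apply: esym; exact: val_exprz.
Qed.

Lemma rs_monM a b a' b' : rs_mon a b * rs_mon a' b' = rs_mon (a + a') (b + b').
Proof. by rewrite /rs_mon !expfzDr ?rQ_neq0 ?sQ_neq0 // mulrACA. Qed.

Lemma rs_mon0 : rs_mon 0 0 = 1.
Proof. by rewrite /rs_mon !expr0z mulr1. Qed.

Lemma rs_monV a b : (rs_mon a b)^-1 = rs_mon (- a) (- b).
Proof. by rewrite /rs_mon invfM !invr_expz. Qed.

Lemma rs_monX a b (m : nat) : rs_mon a b ^+ m = rs_mon (a * m) (b * m).
Proof. by rewrite /rs_mon exprMn !exprnP !exprz_exp. Qed.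

Lemma rs_mon_neq0 a b : rs_mon a b != 0.
Proof. by rewrite /rs_mon mulf_neq0 // expfz_neq0 // ?rQ_neq0 ?sQ_neq0. Qed.

Lemma rs_mon_inj a b a' b' : rs_mon a b = rs_mon a' b' -> a = a' /\ b = b'.
Proof.
move=> E; have : rs_mon a b * (rs_mon a' b')^-1 = 1 by rewrite E mulfV ?rs_mon_neq0.
by rewrite rs_monV rs_monM => /rs_mon_eq1 [/eqP + /eqP]; rewrite !subr_eq0 => /eqP-> /eqP->.
Qed.

Lemma zexpE (x : K) (a : int) : zexp x a%:~R = x ^ a.
Proof. by rewrite /zexp intrKfloor. Qed.

(** The inner product of alpha_i with the basis vector of index k. *)
Definition acoef i (k : nat) : int := (i == k :> nat)%:Z - (i.+1 == k)%:Z.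

Lemma alphaE i k : alpha (R := R) i 0 k = (acoef i k)%:~R.
Proof.
rewrite /alpha /acoef; case: ltnP => hi; rewrite !mxE rmorphB /=.
  by rewrite eq_sym (eq_sym (k : nat)).
rewrite (eq_sym (k : nat)) [X in _ - X](_ : _ = 0) ?subr0 //.
by rewrite gtn_eqF //; exact: leq_trans (ltn_ord k) hi.
Qed.

Lemma dot_eps_alpha i k : dot (eps n k) (alpha (R := R) i) = (acoef i k)%:~R.
Proof. by rewrite dot_eps alphaE. Qed.

(** The squared length of alpha_i. *)
Definition rlen i : nat := if (i.+1 < n)%N then 2 else 1.

Lemma dot_alpha i : dot (alpha (R := R) i) (alpha i) = (rlen i)%:~R.
Proof.
have dotB (u v t : 'rV[R]_n) : dot (u - v) t = dot u t - dot v t.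
  by rewrite /dot -sumrB; apply: eq_bigr => k _; rewrite !mxE mulrBl.
rewrite {1}/alpha /rlen; case: ltnP => hi; last by rewrite dot_eps_alpha /acoef eqxx gtn_eqF.
rewrite dotB dot_eps_alpha -[i.+1]/(val (Ordinal hi)) dot_eps_alpha -rmorphB /acoef /=.
by congr (_%:~R); move: (i : nat) => m; clear; lia.
Qed.

Lemma r_E i : r_ r s i = rs_mon (rlen i) 0.
Proof. by rewrite /r_ dot_alpha zexpE /rs_mon expr0z mulr1. Qed.

Lemma s_E i : s_ r s i = rs_mon 0 (rlen i).
Proof. by rewrite /s_ dot_alpha zexpE /rs_mon expr0z mul1r. Qed.

Definition pexp_r i j : int :=
  if i == j then (rlen i)%:Z else if j == i.+1 :> nat then - 2 else 0.
Definition pexp_s i j : int :=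
  if i == j then - (rlen i)%:Z else if i == j.+1 :> nat then 2 else 0.

Lemma pairingE i j : pairing r s i j = rs_mon (pexp_r i j) (pexp_s i j).
Proof.
have two (k : int) : 2 * (k%:~R : R) = (2 * k)%:~R by rewrite rmorphM.
have rE a : rQ r s ^ a = rs_mon a 0 by rewrite /rs_mon expr0z mulr1.
have sE a : sQ r s ^ a = rs_mon 0 a by rewrite /rs_mon expr0z mul1r.
rewrite /pairing dot_eps_alpha two zexpE.
case: ltnP => hj.
  rewrite -[j.+1]/(val (Ordinal hj)) dot_eps_alpha two zexpE; congr (_ ^ _ * _ ^ _).
    by rewrite /pexp_r /rlen /acoef -val_eqE /=; do ?[case: ifP => ?]; lia.
  by rewrite /pexp_s /rlen /acoef -val_eqE /=; do ?[case: ifP => ?]; lia.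
have jn : j.+1 = n by apply/eqP; rewrite eqn_leq hj ltn_ord.
case: ltnP => hi.
  rewrite rE; congr rs_mon; rewrite /pexp_r /pexp_s /rlen /acoef -val_eqE /=; do ?[case: ifP => ?]; lia.
have in_ : i.+1 = n by apply/eqP; rewrite eqn_leq hi ltn_ord.
have -> : i = j by apply: val_inj => /=; lia.
by rewrite /rs_mon /pexp_r /pexp_s eqxx /rlen jn ltnn expr1z.
Qed.

Lemma pairing_neq0 i j : pairing r s i j != 0.
Proof. by rewrite pairingE rs_mon_neq0. Qed.

Lemma pairing_generic i m : (pairing r s i i)^-1 ^+ m.+1 != 1.
Proof.
rewrite pairingE rs_monV rs_monX; apply/eqP => /rs_mon_eq1[+ _].
by rewrite /pexp_r eqxx /rlen; case: ifP => _; lia.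
Qed.

Lemma rs_diff_neq0 i : r_ r s i - s_ r s i != 0.
Proof.
rewrite r_E s_E subr_eq0; apply/eqP => /rs_mon_inj[+ _].
by rewrite /rlen; case: ifP => _; lia.
Qed.

Local Notation rr := (rQ r s).
Local Notation ss := (sQ r s).

Lemma r_X i : r_ r s i = rr ^+ rlen i.
Proof. by rewrite r_E /rs_mon expr0z mulr1. Qed.

Lemma s_X i : s_ r s i = ss ^+ rlen i.
Proof. by rewrite s_E /rs_mon expr0z mul1r. Qed.

Lemma pairing_diag i : pairing r s i i = rr ^+ rlen i / ss ^+ rlen i.
Proof. by rewrite pairingE /rs_mon /pexp_r /pexp_s !eqxx /= -invr_expz. Qed.

Lemma pairing_far i k : (i.+1 < k)%N || (k.+1 < i)%N -> pairing r s i k = 1.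
Proof.
move=> far; rewrite pairingE /rs_mon /pexp_r /pexp_s -val_eqE /=.
by do ?[case: ifP => ?]; try lia; rewrite !expr0z mulr1.
Qed.

Lemma pairing_succ i k : k = i.+1 :> nat -> pairing r s i k = rr ^- 2.
Proof.
move=> ki; rewrite pairingE /rs_mon /pexp_r /pexp_s -val_eqE /=.
by do ?[case: ifP => ?]; try lia; rewrite !expr0z mulr1.
Qed.

Lemma pairing_pred i k : k = i.+1 :> nat -> pairing r s k i = ss ^+ 2.
Proof.
move=> ki; rewrite pairingE /rs_mon /pexp_r /pexp_s -val_eqE /=.
by do ?[case: ifP => ?]; try lia; rewrite !expr0z mul1r.
Qed.

Lemma weightf_rs_mon (a b : 'I_n -> int) (x : seq 'I_n) :
  weightf (fun j => rs_mon (a j) (b j)) x = rs_mon (\sum_(j <- x) a j) (\sum_(j <- x) b j).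
Proof.
elim: x => [|j x IH]; first by rewrite /weightf !big_nil rs_mon0.
by rewrite weightf_cons IH !big_cons rs_monM.
Qed.

Lemma eq_weightf (c d : 'I_n -> K) x : c =1 d -> weightf c x = weightf d x.
Proof. by move=> cd; apply: eq_bigr => j _; rewrite cd. Qed.

(** Twice the inner product of alpha_i with the weight of x, in terms of the
multiplicities of i and of its two neighbours. *)
Lemma sum_pexp i (x : seq 'I_n) :
  \sum_(j <- x) (pexp_r j i + pexp_r i j) =
  2 * ((rlen i)%:Z * (count_mem i x)%:Z
       - (count (fun j : 'I_n => j.+1 == i) x)%:Z
       - (count (fun j : 'I_n => j == i.+1 :> nat) x)%:Z).
Proof.
elim: x => [|j x IH]; first by rewrite big_nil /=; lia.
rewrite big_cons IH /= /pexp_r -!val_eqE /= /rlen.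
do ?[case: ifP => ?]; lia.
Qed.

(** Comparing exponents of r, the hypothesis says that the weight beta of x has
nonpositive inner product with each alpha_i: the multiplicities b satisfy
rlen i * b i <= b (i - 1) + b (i + 1).  From the short root downwards this
gives b i <= b (i - 1), so b is bounded by its value 0 before the first index
and vanishes. *)
Lemma weight_definite (x : seq 'I_n) :
  (forall i, exists m, (pairing r s i i)^-1 ^+ m *
     (weightf (chi (pairing r s) i) x / weightf (chi' (pairing r s) i) x) = 1) ->
  x = [::].
Proof.
move=> h; pose b (k : nat) := count (fun j : 'I_n => j == k :> nat) x.
pose b' (k : nat) := count (fun j : 'I_n => j.+1 == k) x.
have le i : (rlen i * b i <= b' i + b i.+1)%N.
  have [m] := h i; rewrite (eq_weightf _ (d := fun j => rs_mon (- pexp_r j i) (- pexp_s j i))); last first.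
    by move=> j; rewrite /chi pairingE rs_monV.
  rewrite [weightf (chi' _ _) x](eq_weightf _ (d := fun j => rs_mon (pexp_r i j) (pexp_s i j))); last first.
    by move=> j; rewrite /chi' pairingE.
  rewrite !weightf_rs_mon pairingE !rs_monV rs_monX !rs_monM => /rs_mon_eq1 [+ _].
  rewrite sumrN -opprD -big_split /= sum_pexp -[count_mem i x]/(b i) -/(b' i) -/(b i.+1).
  by rewrite /pexp_r eqxx /rlen; case: ifP => _; lia.
have bS (k : nat) : b' k.+1 = b k by apply: eq_count => j; rewrite eqSS.
have b0 : b' 0%N = 0%N by rewrite /b' (eq_count (a2 := pred0)) ?count_pred0.
have bn (k : nat) : (n <= k)%N -> b k = 0%N.
  move=> nk; rewrite /b (eq_count (a2 := pred0)) ?count_pred0 // => j /=.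
  by rewrite ltn_eqF // (leq_trans (ltn_ord j)).
(* b k <= b (k - 1), by descending induction from b n = 0. *)
have dec t (k : nat) : (k + t = n)%N -> (b k <= b' k)%N.
  elim: t k => [|t IH] k.
    rewrite addn0 => kn. by rewrite (bn k) ?kn.
  rewrite addnS -addSn => kt; have kn : (k < n)%N by lia.
  have := IH _ kt; rewrite bS => bk; have := le (Ordinal kn); rewrite /= /rlen /=.
  case: ltnP => [|nk]; first by lia.
  by rewrite (bn k.+1) //; lia.
have z (k : nat) : b k = 0%N.
  elim: k => [|k IH].
    by have := dec n 0%N (add0n n); rewrite b0; lia.
  have [kn|/bn //] := ltnP k.+1 n.
  by have := dec (n - k.+1)%N k.+1 (subnKC (ltnW kn)); rewrite bS IH; lia.
by move: z; rewrite /b; case: (x) => // j y /(_ (val j)) /=; rewrite eqxx.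
Qed.

(** For k.+1 < n the scalar attached to omega_k is r^(2 a_k) s^(2 a_(k+1)), where
the a_k are the coordinates of the weight in the orthonormal basis.  As n >= 2
all coordinates occur, and they determine the multiplicities. *)
Lemma pairing_weight_perm (x y : seq 'I_n) : (2 <= n)%N ->
  (forall k, weightf (fun j => pairing r s j k) x = weightf (fun j => pairing r s j k) y) ->
  perm_eq x y.
Proof.
move=> n2 h; pose b (k : nat) z := count (fun j : 'I_n => j == k :> nat) z.
pose b' (k : nat) z := count (fun j : 'I_n => j.+1 == k) z.
pose A (k : nat) z : int := (b k z)%:Z - (b' k z)%:Z.
have AE (k : 'I_n) z : (k.+1 < n)%N ->
    weightf (fun j => pairing r s j k) z = rs_mon (2 * A k z) (2 * A k.+1 z).
  move=> kn; rewrite (eq_weightf _ (d := fun j => rs_mon (pexp_r j k) (pexp_s j k))) => [|j]; last exact: pairingE.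
  rewrite weightf_rs_mon; congr rs_mon.
    elim: z => [|j z IH]; first by rewrite big_nil /A /=; lia.
    rewrite big_cons IH /A /b /b' /= /pexp_r -!val_eqE /= /rlen.
    by do ?[case: ifP => ?]; lia.
  elim: z => [|j z IH]; first by rewrite big_nil /A /=; lia.
  rewrite big_cons IH /A /b /b' /= /pexp_s -!val_eqE /= /rlen.
  by do ?[case: ifP => ?]; lia.
have Axy (k : nat) : (k.+1 < n)%N -> A k x = A k y /\ A k.+1 x = A k.+1 y.
  move=> kn; have := h (Ordinal (ltnW kn)); rewrite !AE //= => /rs_mon_inj; lia.
have bS (k : nat) z : b' k.+1 z = b k z by apply: eq_count => j; rewrite eqSS.
have b0 z : b' 0%N z = 0%N by rewrite /b' (eq_count (a2 := pred0)) ?count_pred0.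
have bE (k : nat) : (k < n)%N -> b k x = b k y.
  elim: k => [|k IH] kn.
    by have [+ _] := Axy 0%N n2; rewrite /A !b0; lia.
  by have [_] := Axy k kn; rewrite /A !bS IH; lia.
by apply/allP => j _ /=; apply/eqP; exact: (bE j (ltn_ord j)).
Qed.

End Pairing.

(** * Solutions of the defining relations *)

Section Solution.
Context {R : realType} {n : nat}.
Variables r s : R[i].
Hypothesis r_neq0 : r != 0.
Hypothesis s_neq0 : s != 0.
Hypothesis rs_generic : forall k l : int, r ^ k * s ^ l = 1 <-> k = 0 /\ l = 0.
Local Notation K := (Qrs r s).
Local Notation rr := (rQ r s).
Local Notation ss := (sQ r s).
Local Notation pr := (@pairing R n r s).
Context {A : algType K}.
Variable g : gen n -> A.
Hypothesis g_rel : forall y z, relU g y z -> y = z.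
Implicit Types (i j k : 'I_n).

Local Notation e := (fun i => g (GenE i)).
Local Notation f := (fun i => g (GenF i)).
Local Notation w := (fun i => g (GenO false false i)).
Local Notation wV := (fun i => g (GenO false true i)).
Local Notation w' := (fun i => g (GenO true false i)).
Local Notation w'V := (fun i => g (GenO true true i)).

Lemma sol_toral p q i p' q' j :
  g (GenO p q i) * g (GenO p' q' j) = g (GenO p' q' j) * g (GenO p q i).
Proof. exact/g_rel/rel_toral. Qed.

Lemma sol_wK p q i : g (GenO p q i) * g (GenO p (~~ q) i) = 1.
Proof.
have h p' : g (GenO p' false i) * g (GenO p' true i) = 1.
  by case: p'; apply: g_rel; [exact: rel_w'V | exact: rel_wV].
by case: q; rewrite /= ?h // sol_toral h.
Qed.

Lemma sol_conj (a b x : A) (c : K) p q i :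
  a = g (GenO p q i) -> b = g (GenO p (~~ q) i) -> a * x * b = c *: x -> a * x = c *: (x * a).
Proof.
move=> -> -> /(congr1 (fun z => z * g (GenO p q i))).
have h := sol_wK p (~~ q) i; rewrite negbK in h.
by rewrite -mulrA h mulr1 -scalerAl.
Qed.

Lemma sol_we i j : w j * e i = pr i j *: (e i * w j).
Proof. by apply: sol_conj; [reflexivity | reflexivity | exact/g_rel/rel_we]. Qed.
Lemma sol_wf i j : w j * f i = (pr i j)^-1 *: (f i * w j).
Proof. by apply: sol_conj; [reflexivity | reflexivity | exact/g_rel/rel_wf]. Qed.
Lemma sol_w'e i j : w' j * e i = (pr j i)^-1 *: (e i * w' j).
Proof. by apply: sol_conj; [reflexivity | reflexivity | exact/g_rel/rel_w'e]. Qed.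
Lemma sol_w'f i j : w' j * f i = pr j i *: (f i * w' j).
Proof. by apply: sol_conj; [reflexivity | reflexivity | exact/g_rel/rel_w'f]. Qed.

Definition delta i : K := (r_ r s i - s_ r s i)^-1.

Lemma sol_ef i j :
  e i * f j = f j * e i + (j == i)%:R *: (delta i *: (w i - w' i)).
Proof.
apply/eqP; rewrite addrC -subr_eq; apply/eqP; rewrite (g_rel (rel_ef g i j)) eq_sym.
by case: eqP => _; rewrite ?scale1r ?scale0r.
Qed.

Local Notation adf := (skew_ad f w wV).
Local Notation conjw := (torus_conj w wV).

Lemma adf_eigen i (a : K) u : conjw i u = a *: u ->
  adf i u = f i * u - a *: (u * f i) /\ conjw i (adf i u) = ((pr i i)^-1 * a) *: adf i u.
Proof.
move=> ua; split; first by rewrite /skew_ad ua scalerAl.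
have -> := conjw_adf (sol_wK false false) (sol_wK false true) sol_wf i u.
by rewrite ua linearZ /= scalerA.
Qed.

(** For the Cartan integer a_ik = 2 (alpha_i, alpha_k) / (alpha_i, alpha_i),
expanding skew_ad i ^ (1 - a_ik) (f_k) yields a multiple of the Serre
relation. *)
Lemma sol_serre i k : k != i -> nilf f w wV i (f k).
Proof.
move=> ki.
have rr0 : rr != 0 by exact: rQ_neq0.
have ss0 : ss != 0 by exact: sQ_neq0.
have c0 : conjw i (f k) = (pr k i)^-1 *: f k.
  by rewrite /torus_conj sol_wf -scalerAl -mulrA (sol_wK false false) mulr1.
have [E1 c1] := adf_eigen c0; have [E2 c2] := adf_eigen c1; have [E3 _] := adf_eigen c2.
move: E1 E2 E3 {c0 c1 c2} => E1 E2 E3.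
have ik : (i == k :> nat) = false by apply/negbTE; rewrite val_eqE eq_sym.
have [far|] := boolP ((i.+1 < k)%N || (k.+1 < i)%N).
  exists 1%N; rewrite /= E1 pairing_far // 1?orbC //.
  by rewrite invr1 scale1r (g_rel (rel_ff g far)).
rewrite negb_or -!leqNgt => /andP[ki1 ik1].
have [kE|kE] := eqVneq (k : nat) i.+1.
  have kn := ltn_ord k; have rl : rlen i = 2%N by rewrite /rlen -kE kn.
  have := g_rel (rel_fSerre g kE); rewrite r_X s_X rl => rel.
  rewrite pairing_diag // (pairing_pred _ _ kE) // rl in E1 E2.
  exists 2%N; rewrite [LHS]E2 E1.
  rewrite -[RHS](scaler0 _ (rr ^+ 2 * ss ^+ 2)^-1) -rel !mulrBr !mulrBl -!scalerAr -!scalerAl !mulrA.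
  by lin_split (K : fieldType); field; rewrite ?rr0 ?ss0 ?oner_neq0.
have iE : i = k.+1 :> nat by lia.
have [iN|iN] := ltnP i.+1 n.
  have rl : rlen i = 2%N by rewrite /rlen iN.
  have := g_rel (rel_fSerre' g iE iN); rewrite r_X s_X rl => rel.
  rewrite pairing_diag // (pairing_succ _ _ iE) // rl in E1 E2.
  exists 2%N; rewrite [LHS]E2 E1.
  rewrite -[RHS](scaler0 _ (rr ^+ 2 * ss ^+ 2)) -rel !mulrBr !mulrBl -!scalerAr -!scalerAl !mulrA.
  by lin_split (K : fieldType); field; rewrite ?rr0 ?ss0 ?oner_neq0.
have iN' : i.+1 = n by apply/eqP; rewrite eqn_leq iN ltn_ord.
have rl : rlen i = 1%N by rewrite /rlen iN' ltnn.
have X3 (x : A) : x ^+ 3 = x * x * x by rewrite !exprS expr0 mulr1 mulrA.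
have := g_rel (rel_fSerreN g iE iN'); rewrite /cst_c /cst_d r_X s_X rl !(X3 (g _)) => rel.
rewrite pairing_diag // (pairing_succ _ _ iE) // rl in E1 E2 E3.
exists 3%N; rewrite [LHS]E3 E2 E1.
rewrite -[RHS](scaler0 _ (- (rr * ss) ^+ 3)) -rel !mulrBr !mulrBl -!scalerAr -!scalerAl !mulrBr !mulrBl -!scalerAr -!scalerAl !mulrA.
by lin_split (K : fieldType); field; rewrite ?rr0 ?ss0 ?oner_neq0.
Qed.

Theorem sol_radical y : radical pr y -> evf f y = 0.
Proof.
apply: (radical_evf (delta := delta) _ _ _ (sol_wK false false) (sol_wK false true)
  (sol_wK true false) sol_wf sol_w'f sol_ef sol_serre).
- exact: pairing_neq0.
- by move=> i; rewrite invr_neq0 // rs_diff_neq0.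
- exact: pairing_generic.
- exact: weight_definite.
Qed.

End Solution.

(** * Serre operators on a module *)

Section SerreCommute.
Variables (K : fieldType) (V : lmodType K).
Implicit Types (v : V).

(** The Serre expressions of degree 1, 2, 3 in X, at arbitrary coefficients.
The lemmas below give the conditions on the coefficients under which an
operator a with [a, X] = D + D' (resp. [a, Z] = D + D') commutes with them; x,
y and x', y' are the scalars by which D and D' commute past X and Z. *)
Definition serre1 (X Z : V -> V) (c0 c1 : K) v : V := c0 *: Z (X v) + c1 *: X (Z v).
Definition serre2 (X Z : V -> V) (c0 c1 c2 : K) v : V :=
  c0 *: Z (X (X v)) + c1 *: X (Z (X v)) + c2 *: X (X (Z v)).
Definition serre3 (X Z : V -> V) (c0 c1 c2 c3 : K) v : V :=
  c0 *: Z (X (X (X v))) + c1 *: X (Z (X (X v))) + c2 *: X (X (Z (X v)))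
  + c3 *: X (X (X (Z v))).

Variables (X Z a D D' : {linear V -> V}) (x y x' y' : K).

Let linP (f : {linear V -> V}) : ((forall c v, f (c *: v) = c *: f v)%R
  * (forall u v, f (u + v) = f u + f v)%R)%type.
Proof. by split=> [c v|u v]; rewrite ?linearZ ?linearD. Qed.
Let linE := (linP X, linP Z, linP a, linP D, linP D').

Lemma serre1_is_linear c0 c1 : linear (serre1 X Z c0 c1).
Proof. by move=> c u v; rewrite /serre1 !linE; lin_split K; ring. Qed.
HB.instance Definition _ c0 c1 :=
  GRing.isLinear.Build K V V *:%R (serre1 X Z c0 c1) (serre1_is_linear c0 c1).
Lemma serre2_is_linear c0 c1 c2 : linear (serre2 X Z c0 c1 c2).
Proof. by move=> c u v; rewrite /serre2 !linE; lin_split K; ring. Qed.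
HB.instance Definition _ c0 c1 c2 :=
  GRing.isLinear.Build K V V *:%R (serre2 X Z c0 c1 c2) (serre2_is_linear c0 c1 c2).
Lemma serre3_is_linear c0 c1 c2 c3 : linear (serre3 X Z c0 c1 c2 c3).
Proof. by move=> c u v; rewrite /serre3 !linE; lin_split K; ring. Qed.
HB.instance Definition _ c0 c1 c2 c3 :=
  GRing.isLinear.Build K V V *:%R (serre3 X Z c0 c1 c2 c3) (serre3_is_linear c0 c1 c2 c3).

Let add_null (l r h : K) : h = 0 -> l = r + h -> l = r.
Proof. by move=> -> ->; rewrite addr0. Qed.

Hypothesis DX : forall v, D (X v) = x *: X (D v).
Hypothesis DX' : forall v, D' (X v) = x' *: X (D' v).
Hypothesis DZ : forall v, D (Z v) = y *: Z (D v).
Hypothesis DZ' : forall v, D' (Z v) = y' *: Z (D' v).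

Lemma serre1_lowerX c0 c1 :
  (forall v, a (X v) = X (a v) + (D v + D' v)) -> (forall v, a (Z v) = Z (a v)) ->
  c0 + c1 * y = 0 -> c0 + c1 * y' = 0 ->
  forall v, a (serre1 X Z c0 c1 v) = serre1 X Z c0 c1 (a v).
Proof.
move=> aX aZ h1 h2 v; rewrite /serre1 !(linE, aX, aZ, DZ, DZ').
lin_split K; first [by ring | by apply: (add_null h1); ring
 | by apply: (add_null h2); ring].
Qed.

Lemma serre1_lowerZ c0 c1 :
  (forall v, a (X v) = X (a v)) -> (forall v, a (Z v) = Z (a v) + (D v + D' v)) ->
  c0 * x + c1 = 0 -> c0 * x' + c1 = 0 ->
  forall v, a (serre1 X Z c0 c1 v) = serre1 X Z c0 c1 (a v).
Proof.
move=> aX aZ h1 h2 v; rewrite /serre1 !(linE, aX, aZ, DX, DX').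
lin_split K; first [by ring | by apply: (add_null h1); ring
 | by apply: (add_null h2); ring].
Qed.

Lemma serre2_lowerX c0 c1 c2 :
  (forall v, a (X v) = X (a v) + (D v + D' v)) -> (forall v, a (Z v) = Z (a v)) ->
  c0 * (1 + x) + c1 * x * y = 0 -> c1 + c2 * y * (1 + x) = 0 ->
  c0 * (1 + x') + c1 * x' * y' = 0 -> c1 + c2 * y' * (1 + x') = 0 ->
  forall v, a (serre2 X Z c0 c1 c2 v) = serre2 X Z c0 c1 c2 (a v).
Proof.
move=> aX aZ h1 h2 h3 h4 v; rewrite /serre2 !(linE, aX, aZ, DX, DZ, DX', DZ').
lin_split K; first [by ring | by apply: (add_null h1); ring
 | by apply: (add_null h2); ring | by apply: (add_null h3); ring
 | by apply: (add_null h4); ring].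
Qed.

Lemma serre2_lowerZ c0 c1 c2 :
  (forall v, a (X v) = X (a v)) -> (forall v, a (Z v) = Z (a v) + (D v + D' v)) ->
  c0 * x ^+ 2 + c1 * x + c2 = 0 -> c0 * x' ^+ 2 + c1 * x' + c2 = 0 ->
  forall v, a (serre2 X Z c0 c1 c2 v) = serre2 X Z c0 c1 c2 (a v).
Proof.
move=> aX aZ h1 h2 v; rewrite /serre2 !(linE, aX, aZ, DX, DX').
lin_split K; first [by ring | by apply: (add_null h1); ring
 | by apply: (add_null h2); ring].
Qed.

Lemma serre3_lowerX c0 c1 c2 c3 :
  (forall v, a (X v) = X (a v) + (D v + D' v)) -> (forall v, a (Z v) = Z (a v)) ->
  c0 * (1 + x + x ^+ 2) + c1 * x ^+ 2 * y = 0 -> c1 + c2 * x * y = 0 ->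
  c2 + c3 * y * (1 + x + x ^+ 2) = 0 ->
  c0 * (1 + x' + x' ^+ 2) + c1 * x' ^+ 2 * y' = 0 -> c1 + c2 * x' * y' = 0 ->
  c2 + c3 * y' * (1 + x' + x' ^+ 2) = 0 ->
  forall v, a (serre3 X Z c0 c1 c2 c3 v) = serre3 X Z c0 c1 c2 c3 (a v).
Proof.
move=> aX aZ h1 h2 h3 h4 h5 h6 v; rewrite /serre3 !(linE, aX, aZ, DX, DZ, DX', DZ').
(* The middle equations occur multiplied by the q-integer 1 + x. *)
have h2' : (c1 + c2 * x * y) * (1 + x) = 0 by rewrite h2 mul0r.
have h5' : (c1 + c2 * x' * y') * (1 + x') = 0 by rewrite h5 mul0r.
lin_split K; first [by ring | by apply: (add_null h1); ring
 | by apply: (add_null h2'); ring | by apply: (add_null h3); ring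
 | by apply: (add_null h4); ring | by apply: (add_null h5'); ring
 | by apply: (add_null h6); ring].
Qed.

Lemma serre3_lowerZ c0 c1 c2 c3 :
  (forall v, a (X v) = X (a v)) -> (forall v, a (Z v) = Z (a v) + (D v + D' v)) ->
  c0 * x ^+ 3 + c1 * x ^+ 2 + c2 * x + c3 = 0 ->
  c0 * x' ^+ 3 + c1 * x' ^+ 2 + c2 * x' + c3 = 0 ->
  forall v, a (serre3 X Z c0 c1 c2 c3 v) = serre3 X Z c0 c1 c2 c3 (a v).
Proof.
move=> aX aZ h1 h2 v; rewrite /serre3 !(linE, aX, aZ, DX, DX').
lin_split K; first [by ring | by apply: (add_null h1); ring
 | by apply: (add_null h2); ring].
Qed.

End SerreCommute.

(** * Modules over the free algebra *)

Section FreeAction.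
Context {R : realType} {n : nat} {r s : R[i]}.
Local Notation K := (Qrs r s).
Local Notation freeU := (@freeU R n r s).
Context {V : lmodType K}.
Variable ga : gen n -> {linear V -> V}.

Definition act (u : freeU) (v : V) : V :=
  malg_ext (fun m : fmonom (gen n) => foldr (fun x => ga x) v m) u.

Lemma actP c u u' v : act (c *: u + u') v = c *: act u v + act u' v.
Proof. by rewrite /act linearP. Qed.

Lemma act0 v : act 0 v = 0.
Proof. by rewrite /act linear0. Qed.

Lemma act_is_linear u : linear (act u).
Proof.
move=> c v w; move: u; apply: malg_ind => [|d m u IH].
  by rewrite !act0 scaler0 addr0.
rewrite !actP IH /act !malg_extU.
have -> : foldr (fun x => ga x) (c *: v + w) m =
    c *: foldr (fun x => ga x) v m + foldr (fun x => ga x) w m.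
  by elim: (fmonom_val m) => //= x l ->; rewrite linearP.
by lin_split (K : fieldType); ring.
Qed.
HB.instance Definition _ u :=
  GRing.isLinear.Build K V V *:%R (act u) (act_is_linear u).

Lemma actD u u' v : act (u + u') v = act u v + act u' v.
Proof. by rewrite -[u]scale1r actP !scale1r. Qed.

Lemma actZ c u v : act (c *: u) v = c *: act u v.
Proof. by rewrite -[_ *: u]addr0 actP act0 addr0. Qed.

Lemma actB u u' v : act (u - u') v = act u v - act u' v.
Proof. by rewrite actD -[- u']scaleN1r actZ scaleN1r. Qed.

Lemma act_genU x v : act (genU r s x) v = ga x v.
Proof. by rewrite /act /genU malg_extU fmU. Qed.

Lemma act1 v : act 1 v = v.
Proof. by rewrite /act malg_extU fm1. Qed.

Lemma actM u u' v : act (u * u') v = act u (act u' v).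
Proof.
move: u v; apply: malg_ind => [v|c m u IH v]; first by rewrite mul0r !act0.
rewrite mulrDl -scalerAl !actP.
rewrite [X in _ + X](IH v).
apply: congr2; last by [].
apply: congr1.
move: u' {IH}; apply: malg_ind => [|d m' u' IH']; first by rewrite mulr0 !act0 linear0.
rewrite mulrDr !actP linearP -freeU_scalerAr actP.
rewrite [X in _ + X]IH'.
apply: congr2; last by [].
apply: congr1.
by rewrite malgM_def fgmulUU mulr1 /= /act !malg_extU fmM foldr_cat.
Qed.

End FreeAction.

(** * Verma modules on words *)

Section VermaAction.
Context {R : realType} {n : nat}.
Variables r s : R[i].
Hypothesis r_neq0 : r != 0.
Hypothesis s_neq0 : s != 0.
Hypothesis rs_generic : forall k l : int, r ^ k * s ^ l = 1 <-> k = 0 /\ l = 0.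
Local Notation K := (Qrs r s).
Local Notation pr := (@pairing R n r s).
Local Notation T := (free_module_on K (seq 'I_n)).
Implicit Types (i j k : 'I_n) (y : T) (p q : bool).
Variables lam lam' : 'I_n -> K.
Hypothesis lam_neq0 : forall i, lam i != 0.
Hypothesis lam'_neq0 : forall i, lam' i != 0.

Let mulwZ j c y : mulw j (c *: y) = c *: mulw j y. Proof. exact: linearZ. Qed.
Let mulwB j y z : mulw j (y - z) = mulw j y - mulw j z. Proof. exact: linearB. Qed.
Let scalZ d (c : K) y : scal d (c *: y) = c *: scal d y. Proof. exact: linearZ. Qed.
Let scalB (d : 'I_n -> K) y z : scal d (y - z) = scal d y - scal d z.
Proof. exact: linearB. Qed.
Let derZ d i (c : K) y : der d i (c *: y) = c *: der d i y. Proof. exact: linearZ. Qed.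

(** The action of e_i on the Verma module of highest weight (lam, lam'), realized
on words in the f's: [e_i, f_i] = delta (omega_i - omega'_i) forces this
formula, the highest weight vector being the empty word. *)
Definition raiseE i y : T :=
  delta r s i *: (lam i *: derA pr i y - lam' i *: derB pr i y).

Lemma raiseE_is_linear i : linear (raiseE i).
Proof. by move=> c y z; rewrite /raiseE !linearP /=; lin_split (K : fieldType); ring. Qed.
HB.instance Definition _ i :=
  GRing.isLinear.Build K T T *:%R (raiseE i) (raiseE_is_linear i).

Definition torus_cst p q i : K :=
  let c := if p then lam' i else lam i in if q then c^-1 else c.
Definition torus_chr p q i j : K :=
  let c := if p then chi' pr i j else chi pr i j in if q then c^-1 else c.
Definition torusO p q i y : T := torus_cst p q i *: scal (torus_chr p q i) y.
Lemma torusO_is_linear p q i : linear (torusO p q i).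
Proof. by move=> c y z; rewrite /torusO !linearP /=; lin_split (K : fieldType); ring. Qed.
HB.instance Definition _ p q i :=
  GRing.isLinear.Build K T T *:%R (torusO p q i) (torusO_is_linear p q i).

Definition genact (x : gen n) : {linear T -> T} :=
  match x with
  | GenE i => raiseE i
  | GenF i => mulw i
  | GenO p q i => torusO p q i
  end.

Lemma torus_chr_neq0 p q i j : torus_chr p q i j != 0.
Proof. by case: p; case: q; rewrite /torus_chr /chi /chi' ?invr_neq0 ?pairing_neq0. Qed.

Lemma torusO_mulw p q i j y :
  torusO p q i (mulw j y) = torus_chr p q i j *: mulw j (torusO p q i y).
Proof.
by rewrite /torusO scal_mulw mulwZ; lin_split (K : fieldType); ring.
Qed.

Lemma torusO_raiseE p q i j y :
  torusO p q i (raiseE j y) = (torus_chr p q i j)^-1 *: raiseE j (torusO p q i y).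
Proof.
rewrite /torusO /raiseE /derA /derB.
rewrite scalZ scalB !scalZ.
rewrite !scal_der ?torus_chr_neq0 // !derZ.
by lin_split (K : fieldType); ring.
Qed.

Lemma raiseE_mulw i j y : raiseE i (mulw j y) = mulw j (raiseE i y) +
  (j == i)%:R *: (delta r s i *: (torusO false false i y - torusO true false i y)).
Proof.
rewrite /raiseE /derA /derB !der_mulw mulwZ mulwB.
rewrite !mulwZ /torusO /torus_cst.
by lin_split (K : fieldType); ring.
Qed.

Lemma scalC (c d : 'I_n -> K) y : scal c (scal d y) = scal d (scal c y).
Proof.
apply: (eq_linear (f := scal c \o scal d) (g := scal d \o scal c)) => w /=.
rewrite !scal_single !linearZ /= !scal_single.
by lin_split (K : fieldType); ring.
Qed.

Lemma torusOC p q i p' q' j y :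
  torusO p q i (torusO p' q' j y) = torusO p' q' j (torusO p q i y).
Proof. by rewrite /torusO !scalZ scalC; lin_split (K : fieldType); ring. Qed.

Lemma torusOK p q i y : torusO p q i (torusO p (~~ q) i y) = y.
Proof.
rewrite /torusO scalZ /= scalerA.
have -> : torus_cst p q i * torus_cst p (~~ q) i = 1.
  by case: p; case: q; rewrite /torus_cst /= ?mulVf ?mulfV.
rewrite scale1r; apply: (eq_linear (f := scal _ \o scal _) (g := idfun)) => w /=.
rewrite !scal_single linearZ /= scal_single scalerA -[RHS]scale1r; congr (_ *: _).
elim: w => [|j w IH]; first by rewrite /weightf !big_nil mulr1.
rewrite !weightf_cons mulrACA IH mulr1.
by case: p {IH}; case: q; rewrite /torus_chr /= ?mulVf ?mulfV /chi /chi' ?invr_neq0 ?pairing_neq0.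
Qed.

(** The empty word generates under left multiplications. *)
Lemma commute_mulw_eq0 (G : {linear T -> T}) :
  (forall j y, G (mulw j y) = mulw j (G y)) -> G (single [::]) = 0 -> forall y, G y = 0.
Proof.
move=> GM G1; apply: (eq_linear (f := G) (g := \0)) => w /=.
by elim: w => [//|j w IH]; rewrite -mulw_single GM IH linear0.
Qed.

Local Notation vac := (single [::] : T).

Lemma raiseE_vac i : raiseE i vac = 0.
Proof. by rewrite /raiseE /derA /derB !der_single /= !(linear0, addr0). Qed.

Lemma torusO_vac p q i : torusO p q i vac = torus_cst p q i *: vac.
Proof. by rewrite /torusO scal_single /weightf big_nil scale1r. Qed.

Section RadicalOperator.
Variable G : T -> T.
Hypothesis GE : forall i y, raiseE i (G y) = G (raiseE i y).
Hypothesis GO : forall p q i, exists c, forall y, torusO p q i (G y) = c *: G (torusO p q i y).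
Hypothesis G0 : forall y, coef [::] (G y) = 0.

(** The submodule generated by the values of G.  As G commutes with raising
operators and, up to scalars, with the torus, left multiplications are all that
is needed to close these values under the action. *)
Inductive rad_module : T -> Prop :=
| RadG y : rad_module (G y)
| RadP c y z : rad_module y -> rad_module z -> rad_module (c *: y + z)
| Rad0 : rad_module 0
| RadM j y : rad_module y -> rad_module (mulw j y).

Lemma radZ c y : rad_module y -> rad_module (c *: y).
Proof. by move=> h; rewrite -[_ *: _]addr0; apply: RadP => //; exact: Rad0. Qed.

Lemma rad_torusO p q i y : rad_module y -> rad_module (torusO p q i y).
Proof.
elim=> {y} [y|c y z _ IHy _ IHz||j y _ IH].
- by have [c ->] := GO p q i; apply: radZ; exact: RadG.
- by rewrite linearP; exact: RadP.
- by rewrite linear0; exact: Rad0.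
- by rewrite torusO_mulw; apply: radZ; exact: RadM.
Qed.

Lemma rad_raiseE i y : rad_module y -> rad_module (raiseE i y).
Proof.
elim=> {y} [y|c y z _ IHy _ IHz||j y Wy IH].
- by rewrite GE; exact: RadG.
- by rewrite linearP; exact: RadP.
- by rewrite linear0; exact: Rad0.
rewrite raiseE_mulw addrC; apply: RadP; last exact: RadM.
apply: radZ; rewrite addrC -scaleN1r; apply: RadP; exact: rad_torusO.
Qed.

Lemma rad_coef y : rad_module y -> coef [::] y = 0.
Proof.
elim=> {y} // [c y z _ IHy _ IHz||j y _ _].
- by rewrite coefP IHy IHz mulr0 addr0.
- exact: coef0.
- exact: coef_mulw_nil.
Qed.

(** A submodule whose generators have no component on the highest weight vector,
and which the raising operators preserve, has no such component either. *)
Lemma act_radical (a : freeU n r s) y : coef [::] (act genact a (G y)) = 0.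
Proof.
apply: rad_coef; move: a; apply: malg_ind => [|c m a IH].
  by rewrite act0; exact: Rad0.
rewrite actP; apply: RadP => //; rewrite /act malg_extU.
elim: (fmonom_val m) => [|[i|i|p q i] l IHl] /=; first exact: RadG.
- exact: rad_raiseE.
- exact: RadM.
- exact: rad_torusO.
Qed.

End RadicalOperator.

End VermaAction.

(** * The Serre relations on Verma modules *)

Section SerreAction.
Context {R : realType} {n : nat}.
Variables r s : R[i].
Hypothesis r_neq0 : r != 0.
Hypothesis s_neq0 : s != 0.
Local Notation K := (Qrs r s).
Local Notation pr := (@pairing R n r s).
Local Notation T := (free_module_on K (seq 'I_n)).
Implicit Types (i j k : 'I_n) (y v : T) (p q : bool).
Variables lam lam' : 'I_n -> K.

Local Notation raiseE := (raiseE lam lam').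
Local Notation torusO := (torusO lam lam').

Let mulwD j u v : mulw j (u + v) = mulw j u + mulw j v. Proof. exact: linearD. Qed.
Let mulwZ j c v : mulw j (c *: v) = c *: mulw j v. Proof. exact: linearZ. Qed.
Let raiseED j u v : raiseE j (u + v) = raiseE j u + raiseE j v. Proof. exact: linearD. Qed.
Let raiseEZ j c v : raiseE j (c *: v) = c *: raiseE j v. Proof. exact: linearZ. Qed.

(** The two halves of [e_i, f_i], as operators that commute with raiseE and mulw
up to a scalar. *)
Definition torusD (c : K) p i y : T := c *: torusO p false i y.
Lemma torusD_is_linear c p i : linear (torusD c p i).
Proof. by move=> d y z; rewrite /torusD linearP /=; lin_split (K : fieldType); ring. Qed.
HB.instance Definition _ c p i :=
  GRing.isLinear.Build K T T *:%R (torusD c p i) (torusD_is_linear c p i).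

Lemma torusD_raiseE c p i j y : torusD c p i (raiseE j y) =
  (if p then (pr i j)^-1 else pr j i) *: raiseE j (torusD c p i y).
Proof.
rewrite /torusD torusO_raiseE // [raiseE j (c *: _)]linearZ /torus_chr /chi /chi' /=.
by case: p; rewrite ?invrK; lin_split (K : fieldType); ring.
Qed.

Lemma torusD_mulw c p i j y : torusD c p i (mulw j y) =
  (if p then pr i j else (pr j i)^-1) *: mulw j (torusD c p i y).
Proof.
rewrite /torusD torusO_mulw [mulw j (c *: _)]linearZ /torus_chr /chi /chi' /=.
by case: p; lin_split (K : fieldType); ring.
Qed.

Lemma raiseE_mulw_eq i y : raiseE i (mulw i y) = mulw i (raiseE i y) +
  (torusD (delta r s i) false i y + torusD (- delta r s i) true i y).
Proof. by rewrite raiseE_mulw eqxx scale1r /torusD; lin_split (K : fieldType); ring. Qed.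

Lemma mulw_raiseE_eq i y : mulw i (raiseE i y) = raiseE i (mulw i y) +
  (torusD (- delta r s i) false i y + torusD (delta r s i) true i y).
Proof. by rewrite raiseE_mulw eqxx scale1r /torusD; lin_split (K : fieldType); ring. Qed.

Lemma raiseE_mulw_neq i j y : j != i -> raiseE i (mulw j y) = mulw j (raiseE i y).
Proof. by move=> /negbTE ji; rewrite raiseE_mulw ji scale0r addr0. Qed.

(** The equations of the commutation lemmas for Serre expressions with X of index
i and Z of index k: x and y are the scalars by which the torus element of i
commutes past X and Z, and z is that of the torus element of k and X. *)
Definition serre1_cond (x y z c0 c1 : K) := c0 + c1 * y = 0 /\ c0 * z + c1 = 0.
Definition serre2_cond (x y z c0 c1 c2 : K) :=
  [/\ c0 * (1 + x) + c1 * x * y = 0, c1 + c2 * y * (1 + x) = 0 &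
      c0 * z ^+ 2 + c1 * z + c2 = 0].
Definition serre3_cond (x y z c0 c1 c2 c3 : K) :=
  [/\ c0 * (1 + x + x ^+ 2) + c1 * x ^+ 2 * y = 0, c1 + c2 * x * y = 0,
      c2 + c3 * y * (1 + x + x ^+ 2) = 0 &
      c0 * z ^+ 3 + c1 * z ^+ 2 + c2 * z + c3 = 0].

Section Pair.
Variables (i k : 'I_n).
Hypothesis ik : k != i.
Let ki : i != k. Proof. by rewrite eq_sym. Qed.

(** A Serre expression in the e's commutes with all left multiplications and
kills the highest weight vector, so it acts by 0; the same argument serves in
the other degrees.  For words of f's, the Serre expression only commutes with
the raising operators. *)
Lemma serre1_raiseE c0 c1 :
  serre1_cond (pr i i) (pr k i) (pr i k) c0 c1 ->
  serre1_cond ((pr i i)^-1) ((pr i k)^-1) ((pr k i)^-1) c0 c1 ->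
  forall v, serre1 (raiseE i) (raiseE k) c0 c1 v = 0.
Proof.
move=> [h1 h2] [h1' h2']; apply: commute_mulw_eq0 => [j y|]; last first.
  by rewrite /= /serre1 !raiseE_vac !(linear0, addr0).
symmetry; have [->|ji] := eqVneq j i.
  by apply: (serre1_lowerX (torusD_raiseE _ false i k) (torusD_raiseE _ true i k)) => // v;
    [exact: mulw_raiseE_eq | rewrite /= raiseE_mulw_neq].
have [->|jk] := eqVneq j k.
  by apply: (serre1_lowerZ (torusD_raiseE _ false k i) (torusD_raiseE _ true k i)) => // v;
    [rewrite /= raiseE_mulw_neq | exact: mulw_raiseE_eq].
have ci v : mulw j (raiseE i v) = raiseE i (mulw j v) by rewrite raiseE_mulw_neq.
have ck v : mulw j (raiseE k v) = raiseE k (mulw j v) by rewrite raiseE_mulw_neq.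
by rewrite /= /serre1 !(mulwD, mulwZ, ci, ck).
Qed.

Lemma serre1_mulw c0 c1 :
  serre1_cond ((pr i i)^-1) ((pr k i)^-1) ((pr i k)^-1) c0 c1 ->
  serre1_cond (pr i i) (pr i k) (pr k i) c0 c1 ->
  forall j v, raiseE j (serre1 (mulw i) (mulw k) c0 c1 v) =
    serre1 (mulw i) (mulw k) c0 c1 (raiseE j v).
Proof.
move=> [h1 h2] [h1' h2'] j v; have [->|ji] := eqVneq j i.
  by apply: (serre1_lowerX (torusD_mulw _ false i k) (torusD_mulw _ true i k)) => // y;
    [exact: raiseE_mulw_eq | rewrite /= raiseE_mulw_neq].
have [->|jk] := eqVneq j k.
  by apply: (serre1_lowerZ (torusD_mulw _ false k i) (torusD_mulw _ true k i)) => // y;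
    [rewrite /= raiseE_mulw_neq | exact: raiseE_mulw_eq].
rewrite eq_sym in ji; rewrite eq_sym in jk.
by rewrite /= /serre1 !(raiseED, raiseEZ, raiseE_mulw_neq).
Qed.

Lemma serre2_raiseE c0 c1 c2 :
  serre2_cond (pr i i) (pr k i) (pr i k) c0 c1 c2 ->
  serre2_cond ((pr i i)^-1) ((pr i k)^-1) ((pr k i)^-1) c0 c1 c2 ->
  forall v, serre2 (raiseE i) (raiseE k) c0 c1 c2 v = 0.
Proof.
move=> [h1 h2 h3] [h1' h2' h3']; apply: commute_mulw_eq0 => [j y|]; last first.
  by rewrite /= /serre2 !raiseE_vac !(linear0, addr0).
symmetry; have [->|ji] := eqVneq j i.
  by apply: (serre2_lowerX (torusD_raiseE _ false i i) (torusD_raiseE _ true i i)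
      (torusD_raiseE _ false i k) (torusD_raiseE _ true i k)) => // v;
    [exact: mulw_raiseE_eq | rewrite /= raiseE_mulw_neq].
have [->|jk] := eqVneq j k.
  by apply: (serre2_lowerZ (torusD_raiseE _ false k i) (torusD_raiseE _ true k i)) => // v;
    [rewrite /= raiseE_mulw_neq | exact: mulw_raiseE_eq].
have ci v : mulw j (raiseE i v) = raiseE i (mulw j v) by rewrite raiseE_mulw_neq.
have ck v : mulw j (raiseE k v) = raiseE k (mulw j v) by rewrite raiseE_mulw_neq.
by rewrite /= /serre2 !(mulwD, mulwZ, ci, ck).
Qed.

Lemma serre2_mulw c0 c1 c2 :
  serre2_cond ((pr i i)^-1) ((pr k i)^-1) ((pr i k)^-1) c0 c1 c2 ->
  serre2_cond (pr i i) (pr i k) (pr k i) c0 c1 c2 ->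
  forall j v, raiseE j (serre2 (mulw i) (mulw k) c0 c1 c2 v) =
    serre2 (mulw i) (mulw k) c0 c1 c2 (raiseE j v).
Proof.
move=> [h1 h2 h3] [h1' h2' h3'] j v; have [->|ji] := eqVneq j i.
  by apply: (serre2_lowerX (torusD_mulw _ false i i) (torusD_mulw _ true i i)
      (torusD_mulw _ false i k) (torusD_mulw _ true i k)) => // y;
    [exact: raiseE_mulw_eq | rewrite /= raiseE_mulw_neq].
have [->|jk] := eqVneq j k.
  by apply: (serre2_lowerZ (torusD_mulw _ false k i) (torusD_mulw _ true k i)) => // y;
    [rewrite /= raiseE_mulw_neq | exact: raiseE_mulw_eq].
rewrite eq_sym in ji; rewrite eq_sym in jk.
by rewrite /= /serre2 !(raiseED, raiseEZ, raiseE_mulw_neq).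
Qed.

Lemma serre3_raiseE c0 c1 c2 c3 :
  serre3_cond (pr i i) (pr k i) (pr i k) c0 c1 c2 c3 ->
  serre3_cond ((pr i i)^-1) ((pr i k)^-1) ((pr k i)^-1) c0 c1 c2 c3 ->
  forall v, serre3 (raiseE i) (raiseE k) c0 c1 c2 c3 v = 0.
Proof.
move=> [h1 h2 h3 h4] [h1' h2' h3' h4']; apply: commute_mulw_eq0 => [j y|]; last first.
  by rewrite /= /serre3 !raiseE_vac !(linear0, addr0).
symmetry; have [->|ji] := eqVneq j i.
  by apply: (serre3_lowerX (torusD_raiseE _ false i i) (torusD_raiseE _ true i i)
      (torusD_raiseE _ false i k) (torusD_raiseE _ true i k)) => // v;
    [exact: mulw_raiseE_eq | rewrite /= raiseE_mulw_neq].
have [->|jk] := eqVneq j k.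
  by apply: (serre3_lowerZ (torusD_raiseE _ false k i) (torusD_raiseE _ true k i)) => // v;
    [rewrite /= raiseE_mulw_neq | exact: mulw_raiseE_eq].
have ci v : mulw j (raiseE i v) = raiseE i (mulw j v) by rewrite raiseE_mulw_neq.
have ck v : mulw j (raiseE k v) = raiseE k (mulw j v) by rewrite raiseE_mulw_neq.
by rewrite /= /serre3 !(mulwD, mulwZ, ci, ck).
Qed.

Lemma serre3_mulw c0 c1 c2 c3 :
  serre3_cond ((pr i i)^-1) ((pr k i)^-1) ((pr i k)^-1) c0 c1 c2 c3 ->
  serre3_cond (pr i i) (pr i k) (pr k i) c0 c1 c2 c3 ->
  forall j v, raiseE j (serre3 (mulw i) (mulw k) c0 c1 c2 c3 v) =
    serre3 (mulw i) (mulw k) c0 c1 c2 c3 (raiseE j v).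
Proof.
move=> [h1 h2 h3 h4] [h1' h2' h3' h4'] j v; have [->|ji] := eqVneq j i.
  by apply: (serre3_lowerX (torusD_mulw _ false i i) (torusD_mulw _ true i i)
      (torusD_mulw _ false i k) (torusD_mulw _ true i k)) => // y;
    [exact: raiseE_mulw_eq | rewrite /= raiseE_mulw_neq].
have [->|jk] := eqVneq j k.
  by apply: (serre3_lowerZ (torusD_mulw _ false k i) (torusD_mulw _ true k i)) => // y;
    [rewrite /= raiseE_mulw_neq | exact: raiseE_mulw_eq].
rewrite eq_sym in ji; rewrite eq_sym in jk.
by rewrite /= /serre3 !(raiseED, raiseEZ, raiseE_mulw_neq).
Qed.

End Pair.
End SerreAction.

(** * The defining relations on Verma modules *)

Section RelationAction.
Context {R : realType} {n : nat}.
Variables r s : R[i].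
Hypothesis r_neq0 : r != 0.
Hypothesis s_neq0 : s != 0.
Hypothesis rs_generic : forall k l : int, r ^ k * s ^ l = 1 <-> k = 0 /\ l = 0.
Local Notation K := (Qrs r s).
Local Notation rr := (rQ r s).
Local Notation ss := (sQ r s).
Local Notation pr := (@pairing R n r s).
Local Notation T := (free_module_on K (seq 'I_n)).
Implicit Types (i j k : 'I_n) (v : T) (p q : bool).
Variables lam lam' : 'I_n -> K.
Hypothesis lam_neq0 : forall i, lam i != 0.
Hypothesis lam'_neq0 : forall i, lam' i != 0.
Variables (A : lalgType K) (g : gen n -> A) (ev : A -> T -> T).
Hypothesis evM : forall x y v, ev (x * y) v = ev x (ev y v).
Hypothesis evD : forall x y v, ev (x + y) v = ev x v + ev y v.
Hypothesis evB : forall x y v, ev (x - y) v = ev x v - ev y v.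
Hypothesis evZ : forall (c : K) x v, ev (c *: x) v = c *: ev x v.
Hypothesis ev1 : forall v, ev 1 v = v.
Hypothesis evg : forall x v, ev (g x) v = genact lam lam' x v.

(** The conditions under which the values of G generate a submodule without
component on the highest weight vector, by [act_radical]. *)
Definition radical_op (G : T -> T) :=
  [/\ forall i v, raiseE lam lam' i (G v) = G (raiseE lam lam' i v),
      forall p q i, exists c, forall v,
        torusO lam lam' p q i (G v) = c *: G (torusO lam lam' p q i v) &
      forall v, coef [::] (G v) = 0].

Let ev0 v : ev 0 v = 0.
Proof. by rewrite -(subrr 0) evB subrr. Qed.

Let rr0 : rr != 0. Proof. exact: rQ_neq0. Qed.
Let ss0 : ss != 0. Proof. exact: sQ_neq0. Qed.

Let mulwZ j c v : mulw j (c *: v) = c *: mulw j v. Proof. exact: linearZ. Qed.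
Let torusOD p q j u v : torusO lam lam' p q j (u + v) =
  torusO lam lam' p q j u + torusO lam lam' p q j v.
Proof. exact: linearD. Qed.
Let torusOZ p q j c v : torusO lam lam' p q j (c *: v) = c *: torusO lam lam' p q j v.
Proof. exact: linearZ. Qed.

Lemma radical_op1 i k c0 c1 : k != i ->
  serre1_cond ((pr i i)^-1) ((pr k i)^-1) ((pr i k)^-1) c0 c1 ->
  serre1_cond (pr i i) (pr i k) (pr k i) c0 c1 ->
  radical_op (serre1 (mulw i) (mulw k) c0 c1).
Proof.
move=> ki h h'; split=> [j v|p q j|v]; first exact: serre1_mulw.
  exists (torus_chr r s p q j i * torus_chr r s p q j k) => v.
  rewrite /serre1 !(torusOD, torusOZ, torusO_mulw, mulwZ).
  by lin_split (K : fieldType); ring.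
by rewrite /serre1 !(coefD, coefZ, coef_mulw_nil, mulr0, addr0).
Qed.

Lemma radical_op2 i k c0 c1 c2 : k != i ->
  serre2_cond ((pr i i)^-1) ((pr k i)^-1) ((pr i k)^-1) c0 c1 c2 ->
  serre2_cond (pr i i) (pr i k) (pr k i) c0 c1 c2 ->
  radical_op (serre2 (mulw i) (mulw k) c0 c1 c2).
Proof.
move=> ki h h'; split=> [j v|p q j|v]; first exact: serre2_mulw.
  exists (torus_chr r s p q j i ^+ 2 * torus_chr r s p q j k) => v.
  rewrite /serre2 !(torusOD, torusOZ, torusO_mulw, mulwZ).
  by lin_split (K : fieldType); ring.
by rewrite /serre2 !(coefD, coefZ, coef_mulw_nil, mulr0, addr0).
Qed.

Lemma radical_op3 i k c0 c1 c2 c3 : k != i ->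
  serre3_cond ((pr i i)^-1) ((pr k i)^-1) ((pr i k)^-1) c0 c1 c2 c3 ->
  serre3_cond (pr i i) (pr i k) (pr k i) c0 c1 c2 c3 ->
  radical_op (serre3 (mulw i) (mulw k) c0 c1 c2 c3).
Proof.
move=> ki h h'; split=> [j v|p q j|v]; first exact: serre3_mulw.
  exists (torus_chr r s p q j i ^+ 3 * torus_chr r s p q j k) => v.
  rewrite /serre3 !(torusOD, torusOZ, torusO_mulw, mulwZ).
  by lin_split (K : fieldType); ring.
by rewrite /serre3 !(coefD, coefZ, coef_mulw_nil, mulr0, addr0).
Qed.

Let far_neq i j : (i.+1 < j)%N || (j.+1 < i)%N -> j != i.
Proof. by move=> far; apply/eqP => ji; move: far; rewrite ji; lia. Qed.

Let succ_neq i k : k = i.+1 :> nat -> k != i.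
Proof. by move=> kE; rewrite -val_eqE /= kE; apply/eqP; lia. Qed.

Let X3 (x : A) : x ^+ 3 = x * x * x.
Proof. by rewrite !exprS expr0 mulr1 mulrA. Qed.

Local Ltac solve_cond :=
  split; rewrite ?pairing_diag //; field; rewrite ?rr0 ?ss0 ?oner_neq0.

(** All relations hold on the Verma module realized by words, except the Serre
relations between the f's, which produce operators of the second kind. *)
Lemma relU_ev y z : relU g y z -> (forall v, ev y v = ev z v) \/
  exists2 G, radical_op G & forall v, ev y v - ev z v = G v.
Proof.
case=> {y z}.
- by left=> v; rewrite !evM !evg /= torusOC.
- by left=> v; rewrite evM !evg /= ev1 (torusOK _ _ _ _ false false).
- by left=> v; rewrite evM !evg /= ev1 (torusOK _ _ _ _ true false).
- move=> i j; left=> v; rewrite !evM evZ !evg /= torusO_raiseE //.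
  by rewrite (torusOK _ _ _ _ false false) // /torus_chr /chi invrK.
- move=> i j; left=> v; rewrite !evM evZ !evg /= torusO_mulw.
  by rewrite (torusOK _ _ _ _ false false).
- move=> i j; left=> v; rewrite !evM evZ !evg /= torusO_raiseE //.
  by rewrite (torusOK _ _ _ _ true false).
- move=> i j; left=> v; rewrite !evM evZ !evg /= torusO_mulw.
  by rewrite (torusOK _ _ _ _ true false).
- move=> i j; left=> v; rewrite evB !evM !evg /= raiseE_mulw addrC addrA addNr add0r.
  by rewrite eq_sym; case: eqP => _; rewrite ?scale1r ?scale0r ?ev0 ?evZ ?evB ?evg.
- move=> i j far; left=> v; have ji := far_neq far.
  have far' : (j.+1 < i)%N || (i.+1 < j)%N by rewrite orbC.
  rewrite ev0 -(@serre1_raiseE _ _ r s r_neq0 s_neq0 lam lam' i j ji (-1) 1 _ _ v).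
  + by rewrite evB !evM !evg /serre1 /= scale1r scaleN1r addrC.
  + by split; rewrite ?(pairing_far _ _ far) ?(pairing_far _ _ far') //; ring.
  + by split; rewrite ?(pairing_far _ _ far) ?(pairing_far _ _ far') // invr1; ring.
- move=> i j far; right; have ji := far_neq far.
  have far' : (j.+1 < i)%N || (i.+1 < j)%N by rewrite orbC.
  exists (serre1 (mulw i) (mulw j) (-1) 1) => [|v].
    apply: radical_op1 => //.
      by split; rewrite ?(pairing_far _ _ far) ?(pairing_far _ _ far') // invr1; ring.
    by split; rewrite ?(pairing_far _ _ far) ?(pairing_far _ _ far') //; ring.
  by rewrite evB ev0 subr0 !evM !evg /serre1 /= scale1r scaleN1r addrC.
- move=> i i1 iE; left=> v; have ji := succ_neq iE.
  have rl : rlen i = 2%N by rewrite /rlen -iE ltn_ord.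
  rewrite ev0 -(@serre2_raiseE _ _ r s r_neq0 s_neq0 lam lam' i i1 ji
    (rr ^+ 2 * ss ^+ 2) (- (rr ^+ 2 + ss ^+ 2)) 1 _ _ v).
  + rewrite evD evB !evZ !evM !evg r_X s_X rl /serre2 /=.
    by lin_split (K : fieldType); ring.
  + by rewrite pairing_diag // (pairing_succ _ _ iE) // (pairing_pred _ _ iE) // rl; solve_cond.
  + by rewrite pairing_diag // (pairing_succ _ _ iE) // (pairing_pred _ _ iE) // rl; solve_cond.
- move=> i i1 iE; right; have ji := succ_neq iE.
  have rl : rlen i = 2%N by rewrite /rlen -iE ltn_ord.
  exists (serre2 (mulw i) (mulw i1) 1 (- (rr ^+ 2 + ss ^+ 2)) (rr ^+ 2 * ss ^+ 2)) => [|v].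
    apply: radical_op2 => //;
    by rewrite pairing_diag // (pairing_succ _ _ iE) // (pairing_pred _ _ iE) // rl; solve_cond.
  rewrite ev0 subr0 evD evB !evZ !evM !evg r_X s_X rl /serre2 /=.
  by lin_split (K : fieldType); ring.
- move=> j j1 iE j1n; left=> v; have ji := succ_neq iE; rewrite eq_sym in ji.
  have rl : rlen j1 = 2%N by rewrite /rlen j1n.
  rewrite ev0 -(@serre2_raiseE _ _ r s r_neq0 s_neq0 lam lam' j1 j ji
    ((rr ^+ 2)^-1 * (ss ^+ 2)^-1) (- ((rr ^+ 2)^-1 + (ss ^+ 2)^-1)) 1 _ _ v).
  + rewrite evD evB !evZ !evM !evg r_X s_X rl /serre2 /=.
    by lin_split (K : fieldType); ring.
  + by rewrite pairing_diag // (pairing_succ _ _ iE) // (pairing_pred _ _ iE) // rl; solve_cond.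
  + by rewrite pairing_diag // (pairing_succ _ _ iE) // (pairing_pred _ _ iE) // rl; solve_cond.
- move=> j j1 iE j1n; right; have ji := succ_neq iE; rewrite eq_sym in ji.
  have rl : rlen j1 = 2%N by rewrite /rlen j1n.
  exists (serre2 (mulw j1) (mulw j) 1 (- ((rr ^+ 2)^-1 + (ss ^+ 2)^-1))
    ((rr ^+ 2)^-1 * (ss ^+ 2)^-1)) => [|v].
    apply: radical_op2 => //;
    by rewrite pairing_diag // (pairing_succ _ _ iE) // (pairing_pred _ _ iE) // rl; solve_cond.
  rewrite ev0 subr0 evD evB !evZ !evM !evg r_X s_X rl /serre2 /=.
  by lin_split (K : fieldType); ring.
- move=> l m iE mn; left=> v; have ji := succ_neq iE; rewrite eq_sym in ji.
  have rl : rlen m = 1%N by rewrite /rlen mn ltnn.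
  pose c := rr^-1 ^+ 2 + rr^-1 * ss^-1 + ss^-1 ^+ 2; pose d := rr^-1 * ss^-1.
  rewrite ev0 -(@serre3_raiseE _ _ r s r_neq0 s_neq0 lam lam' m l ji
    (- d ^+ 3) (d * c) (- c) 1 _ _ v).
  + rewrite evB evD evB !evZ !evM !evg /cst_c /cst_d r_X s_X rl !expr1 /serre3 /c /d /=.
    by lin_split (K : fieldType); ring.
  + by rewrite pairing_diag // (pairing_succ _ _ iE) // (pairing_pred _ _ iE) // rl /d /c; solve_cond.
  + by rewrite pairing_diag // (pairing_succ _ _ iE) // (pairing_pred _ _ iE) // rl /d /c; solve_cond.
- move=> l m iE mn; right; have ji := succ_neq iE; rewrite eq_sym in ji.
  have rl : rlen m = 1%N by rewrite /rlen mn ltnn.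
  pose c := rr^-1 ^+ 2 + rr^-1 * ss^-1 + ss^-1 ^+ 2; pose d := rr^-1 * ss^-1.
  exists (serre3 (mulw m) (mulw l) 1 (- c) (d * c) (- d ^+ 3)) => [|v].
    apply: radical_op3 => //;
    by rewrite pairing_diag // (pairing_succ _ _ iE) // (pairing_pred _ _ iE) // rl /d /c; solve_cond.
  rewrite ev0 subr0 evB evD evB !evZ !evM !evg /cst_c /cst_d r_X s_X rl !expr1 /serre3 /c /d /=.
  by lin_split (K : fieldType); ring.
Qed.

End RelationAction.

(** * The vacuum expectation on U *)

Lemma mulr_sandwich (A : pzRingType) (a b c d x : A) :
  a * (b * x * c) * d = (a * b) * x * (c * d).
Proof. by rewrite !mulrA. Qed.

Section VacuumExpectation.
Local Open Scope classical_set_scope.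
Local Open Scope ring_scope.
Context {R : realType} {n : nat}.
Variables r s : R[i].
Hypothesis r_neq0 : r != 0.
Hypothesis s_neq0 : s != 0.
Local Notation K := (Qrs r s).
Local Notation T := (free_module_on K (seq 'I_n)).
Local Notation U := (U n r s).
Local Notation freeU := (freeU n r s).
Implicit Types (x y : U).
Variables lam lam' : 'I_n -> K.
Hypothesis lam_neq0 : forall i, lam i != 0.
Hypothesis lam'_neq0 : forall i, lam' i != 0.

Local Notation vac := (single [::] : T).
Local Notation ga := (genact lam lam').

(** The component of u v on v, for v the highest weight vector. *)
Definition vev_free (u : freeU) : K := coef [::] (act ga u vac).

Lemma vev_freeP c (u v : freeU) : vev_free (c *: u + v) = c * vev_free u + vev_free v.
Proof. by rewrite /vev_free actP coefP. Qed.

Lemma vev_free0 : vev_free 0 = 0.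
Proof. by rewrite /vev_free act0 coef0. Qed.

Lemma vev_freeB (u v : freeU) : vev_free (u - v) = vev_free u - vev_free v.
Proof. by rewrite /vev_free actB -scaleN1r addrC coefP addrC mulN1r. Qed.

Lemma vev_free_relU (u v : freeU) : relU (genU r s) u v ->
  forall a b : freeU, vev_free (a * (u - v) * b) = 0.
Proof.
move=> uv a b; rewrite /vev_free actM actM actB.
have [E|[G [GE GO G0] E]] := relU_ev r_neq0 s_neq0 lam_neq0 lam'_neq0
  (actM ga) (actD ga) (actB ga) (actZ ga) (act1 ga) (act_genU ga) uv.
  by rewrite E subrr linear0 coef0.
by rewrite E; exact: act_radical.
Qed.

(** The elements u with vev (a u b) = 0 for all a and b form a two-sided ideal,
which contains the relations by [relU_ev] and [act_radical]. *)
Lemma vev_free_ideal (u : freeU) : u \in @idealU R n r s -> vev_free u = 0.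
Proof.
pose S : set freeU := [set u | forall a b, vev_free (a * u * b) = 0].
have inS v : (forall a b, vev_free (a * v * b) = 0) -> v \in S by exact: mem_set.
have outS v : v \in S -> forall a b, vev_free (a * v * b) = 0 by exact: set_mem.
have h : {subset @idealU R n r s <= S}.
  apply: idealU_smallest => [|v w /vev_free_relU]; last exact: inS.
  split; first split.
  - by apply: inS => a b; rewrite mulr0 mul0r vev_free0.
  - move=> v w /outS hv /outS hw; apply: inS => a b.
    have -> : a * (v - w) * b = a * v * b - a * w * b.
      by rewrite mulrBr; exact: mulrBl.
    rewrite vev_freeB; apply: etrans (congr2 (fun c d : K => c - d) (hv a b) (hw a b)) _.
    exact: subrr.
  - move=> c d v /outS hv; apply: inS => a b.
    rewrite mulr_sandwich.
    exact: (hv (a * c) (d * b)).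
by move=> /h/outS/(_ 1 1); rewrite mul1r mulr1.
Qed.

Definition vev (x : U) : K := vev_free (repr x).

Lemma vev_pi (u : freeU) : vev (piU u) = vev_free u.
Proof.
by apply/eqP; rewrite -subr_eq0 -vev_freeB vev_free_ideal // repr_piU.
Qed.

Lemma vevP c x y : vev (c *: x + y) = c * vev x + vev y.
Proof.
have [u ->] := piU_surj x; have [v ->] := piU_surj y.
by rewrite (vev_pi u) (vev_pi v) -vev_freeP -vev_pi linearP.
Qed.

Lemma vev1 : vev 1 = 1.
Proof.
by rewrite -(rmorph1 (@piU R n r s)) vev_pi /vev_free act1 coef_single.
Qed.

Lemma vev_mulE x i : vev (x * Ue r s i) = 0.
Proof.
have [u ->] := piU_surj x; rewrite /Ue -rmorphM vev_pi /vev_free actM act_genU.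
by rewrite /= raiseE_vac linear0 coef0.
Qed.

Lemma vev_mulO x p q i : vev (x * Uomega r s p q i) = torus_cst lam lam' p q i * vev x.
Proof.
have [u ->] := piU_surj x; rewrite /Uomega -rmorphM !vev_pi /vev_free actM act_genU.
by rewrite /= torusO_vac linearZ /= coefZ.
Qed.

Lemma vev_Fmul x i : vev (Uf r s i * x) = 0.
Proof.
have [u ->] := piU_surj x; rewrite /Uf -rmorphM vev_pi /vev_free actM act_genU.
exact: coef_mulw_nil.
Qed.

End VacuumExpectation.

(** * The anti-automorphism exchanging e and f *)

(** The defining relations for the images of generators are images of the
defining relations, as both sides are built with the algebra operations. *)
Lemma relU_lift (R : realType) (n : nat) (r s : R[i]) (A B : lalgType (Qrs r s))
    (h : {lrmorphism B -> A}) (g : gen n -> B) Y Z :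
  relU (h \o g) Y Z -> exists y z, [/\ relU g y z, Y = h y & Z = h z].
Proof.
have hZ (a : Qrs r s) x : h (a *: x) = a *: h x by exact: linearZ.
have hB x x' : h (x - x') = h x - h x' by exact: rmorphB.
have hD x x' : h (x + x') = h x + h x' by exact: rmorphD.
have hM x x' : h (x * x') = h x * h x' by exact: rmorphM.
have hX x m : h (x ^+ m) = h x ^+ m by exact: rmorphXn.
have h1 : h 1 = 1 by exact: rmorph1.
have h0 : h 0 = 0 by exact: rmorph0.
have lift y z : relU g y z -> forall Y Z, h y = Y -> h z = Z ->
    exists y z, [/\ relU g y z, Y = h y & Z = h z].
  by move=> yz ? ? <- <-; exists y, z.
case=> {Y Z}.
- by move=> p q p' q' i j; apply: (lift _ _ (rel_toral g p q p' q' i j)); rewrite hM.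
- by move=> i; apply: (lift _ _ (rel_wV g i)); rewrite ?hM.
- by move=> i; apply: (lift _ _ (rel_w'V g i)); rewrite ?hM.
- by move=> i j; apply: (lift _ _ (rel_we g i j)); rewrite ?hZ ?hM.
- by move=> i j; apply: (lift _ _ (rel_wf g i j)); rewrite ?hZ ?hM.
- by move=> i j; apply: (lift _ _ (rel_w'e g i j)); rewrite ?hZ ?hM.
- by move=> i j; apply: (lift _ _ (rel_w'f g i j)); rewrite ?hZ ?hM.
- move=> i j; apply: (lift _ _ (rel_ef g i j)); rewrite ?hB ?hM //.
  by case: ifP => _; rewrite ?hZ ?hB ?h0.
- by move=> i j far; apply: (lift _ _ (rel_ee g far)); rewrite ?h0 ?hB ?hM.
- by move=> i j far; apply: (lift _ _ (rel_ff g far)); rewrite ?h0 ?hB ?hM.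
- move=> i j e; apply: (lift _ _ (rel_eSerre g e)); last exact: h0.
  by rewrite !(hB, hD) !hZ !hM !(exprS, expr0, mulr1).
- move=> i j e; apply: (lift _ _ (rel_fSerre g e)); last exact: h0.
  by rewrite !(hB, hD) !hZ !hM !(exprS, expr0, mulr1).
- move=> i j e e'; apply: (lift _ _ (rel_eSerre' g e e')); last exact: h0.
  by rewrite !(hB, hD) !hZ !hM !(exprS, expr0, mulr1).
- move=> i j e e'; apply: (lift _ _ (rel_fSerre' g e e')); last exact: h0.
  by rewrite !(hB, hD) !hZ !hM !(exprS, expr0, mulr1).
- move=> i j e e'; apply: (lift _ _ (rel_eSerreN g e e')); last exact: h0.
  by rewrite !(hB, hD) !hZ !hM !(exprS, expr0, mulr1).
- move=> i j e e'; apply: (lift _ _ (rel_fSerreN g e e')); last exact: h0.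
  by rewrite !(hB, hD) !hZ !hM !(exprS, expr0, mulr1).
Qed.

Section UGenerators.
Local Open Scope classical_set_scope.
Local Open Scope ring_scope.
Context {R : realType} {n : nat}.
Variables r s : R[i].
Local Notation U := (U n r s).

Definition gU (x : gen n) : U := piU (genU r s x).

Lemma gU_rel (y z : U) : relU gU y z -> y = z.
Proof.
move=> /(@relU_lift R n r s U (freeU n r s) (@piU R n r s) (genU r s)).
by move=> [u [v [uv -> ->]]]; exact: piU_relU.
Qed.

End UGenerators.

Section AntiAutomorphism.
Context {R : realType} {n : nat}.
Variables r s : R[i].
Local Notation K := (Qrs r s).
Local Notation pr := (@pairing R n r s).
Hypothesis r_neq0 : r != 0.
Hypothesis s_neq0 : s != 0.

Definition swap_gen (x : gen n) : gen n :=
  match x with GenE i => GenF i | GenF i => GenE i | GenO p q i => GenO p q i end.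

Variables (A : algType K) (g : gen n -> A).
Hypothesis g_rel : forall y z, relU g y z -> y = z.
Variables (B : lalgType K) (h : gen n -> B) (t : {linear B -> A}).
Hypothesis tM : forall x y, t (x * y) = t y * t x.
Hypothesis t1 : t 1 = 1.
Hypothesis tg : forall x, t (h x) = g (swap_gen x).

Let sol_unconj (a b x : A) (c : K) p q i : c != 0 ->
  a = g (GenO p q i) -> b = g (GenO p (~~ q) i) -> a * x = c^-1 *: (x * a) ->
  b * (x * a) = c *: x.
Proof.
move=> c0 -> ->.
move=> /(congr1 (fun z => c *: z)); rewrite scalerA mulfV // scale1r => <-.
rewrite -scalerAr mulrA.
have := sol_wK g_rel p (~~ q) i; rewrite negbK => ->.
by rewrite mul1r.
Qed.

(** The list of relations is stable under reading products backwards and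
exchanging e with f.  With B the free algebra, this is what allows t to
pass to the quotient. *)
Lemma relU_swap y z : relU h y z -> t y = t z.
Proof.
have tZ (a : K) x : t (a *: x) = a *: t x by exact: linearZ.
have tB x x' : t (x - x') = t x - t x' by exact: linearB.
have tD x x' : t (x + x') = t x + t x' by exact: linearD.
have t0 : t 0 = 0 by exact: linear0.
have pr0 i j : pr i j != 0 by exact: pairing_neq0.
have X2 (x : A) : x ^+ 2 = x * x by rewrite expr2.
have X3 (x : A) : x ^+ 3 = x * (x * x) by rewrite exprS expr2.
case=> {y z}.
- by move=> p q p' q' i j; rewrite !tM !tg /= (sol_toral g_rel).
- by move=> i; rewrite !tM !tg t1 (sol_wK g_rel false true).
- by move=> i; rewrite !tM !tg t1 (sol_wK g_rel true true).
- move=> i j; rewrite !tM tZ !tg /=.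
  by apply: (sol_unconj (p := false) (q := false) _ erefl erefl); rewrite ?(sol_wf g_rel).
- move=> i j; rewrite !tM tZ !tg /=.
  by apply: (sol_unconj (p := false) (q := false) _ erefl erefl); rewrite ?invrK ?(sol_we g_rel) ?invr_neq0.
- move=> i j; rewrite !tM tZ !tg /=.
  by apply: (sol_unconj (p := true) (q := false) _ erefl erefl); rewrite ?invrK ?(sol_w'f g_rel) ?invr_neq0.
- move=> i j; rewrite !tM tZ !tg /=.
  by apply: (sol_unconj (p := true) (q := false) _ erefl erefl); rewrite ?(sol_w'e g_rel).
- move=> i j; rewrite !tB !tM !tg /= (g_rel (rel_ef g j i)) eq_sym.
  by case: eqP => [->|_]; rewrite ?t0 // tZ tB !tg.
- by move=> i j far; rewrite !tB !tM !tg t0 /= (g_rel (rel_ff g _)) // orbC.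
- by move=> i j far; rewrite !tB !tM !tg t0 /= (g_rel (rel_ee g _)) // orbC.
- move=> i j e; rewrite t0 -[RHS](g_rel (rel_fSerre g e)).
  by rewrite tD tB !tZ !tM !tg /= ?X3 ?X2 !mulrA.
- move=> i j e; rewrite t0 -[RHS](g_rel (rel_eSerre g e)).
  by rewrite tD tB !tZ !tM !tg /= ?X3 ?X2 !mulrA.
- move=> i j e e'; rewrite t0 -[RHS](g_rel (rel_fSerre' g e e')).
  by rewrite tD tB !tZ !tM !tg /= ?X3 ?X2 !mulrA.
- move=> i j e e'; rewrite t0 -[RHS](g_rel (rel_eSerre' g e e')).
  by rewrite tD tB !tZ !tM !tg /= ?X3 ?X2 !mulrA.
- move=> i j e e'; rewrite t0 -[RHS](g_rel (rel_fSerreN g e e')).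
  by rewrite tB tD tB !tZ !tM !tg /= ?X3 ?X2 !mulrA.
- move=> i j e e'; rewrite t0 -[RHS](g_rel (rel_eSerreN g e e')).
  by rewrite tB tD tB !tZ !tM !tg /= ?X3 ?X2 !mulrA.
Qed.

End AntiAutomorphism.

Lemma prod_rev_cat (A : pzRingType) (I : Type) (F : I -> A) (l m : seq I) :
  \prod_(x <- rev (l ++ m)) F x = (\prod_(x <- rev m) F x) * \prod_(x <- rev l) F x.
Proof. by rewrite rev_cat big_cat. Qed.

Section Tau.
Local Open Scope classical_set_scope.
Local Open Scope ring_scope.
Context {R : realType} {n : nat}.
Variables r s : R[i].
Hypothesis r_neq0 : r != 0.
Hypothesis s_neq0 : s != 0.
Local Notation K := (Qrs r s).
Local Notation U := (U n r s).
Local Notation freeU := (freeU n r s).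

(** The anti-morphism of the free algebra into U given by [swap_gen]. *)
Definition tau_free (u : freeU) : U :=
  malg_ext (fun m : fmonom (gen n) => \prod_(x <- rev m) gU r s (swap_gen x)) u.

Lemma tau_freeP c u v : tau_free (c *: u + v) = c *: tau_free u + tau_free v.
Proof. by rewrite /tau_free linearP. Qed.

Lemma tau_free_is_linear : linear tau_free. Proof. exact: tau_freeP. Qed.
HB.instance Definition _ :=
  GRing.isLinear.Build K freeU U *:%R tau_free tau_free_is_linear.

Lemma tau_free0 : tau_free 0 = 0.
Proof. exact: linear0. Qed.

Lemma tau_freeU (m : fmonom (gen n)) :
  tau_free (mkmalgU m 1) = \prod_(x <- rev m) gU r s (swap_gen x).
Proof. exact: malg_extU. Qed.

Lemma tau_freeM u v : tau_free (u * v) = tau_free v * tau_free u.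
Proof.
move: u; apply: malg_ind => [|c m u IH]; first by rewrite mul0r !tau_free0 mulr0.
rewrite mulrDl -scalerAl !tau_freeP mulrDr [X in _ + X]IH -scalerAr.
apply: congr2; last by [].
apply: congr1.
move: v {IH}; apply: malg_ind => [|d m' v IH']; first by rewrite mulr0 !tau_free0 mul0r.
rewrite mulrDr.
rewrite -freeU_scalerAr.
rewrite tau_freeP.
rewrite [X in _ + X]IH'.
rewrite [X in _ = X * _]tau_freeP.
rewrite mulrDl.
rewrite -scalerAl.
apply: congr2; last by [].
apply: congr1.
have -> : mkmalgU m 1 * mkmalgU m' 1 = mkmalgU (monalg.mul m m') 1 :> freeU.
  by rewrite malgM_def fgmulUU mulr1.
rewrite !tau_freeU fmM.
exact: prod_rev_cat.
Qed.

Lemma tau_free1 : tau_free 1 = 1.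
Proof. by rewrite /tau_free malg_extU fm1 big_nil. Qed.

Lemma tau_free_gen x : tau_free (genU r s x) = gU r s (swap_gen x).
Proof. by rewrite /tau_free malg_extU fmU big_seq1. Qed.

Lemma tau_freeB u v : tau_free (u - v) = tau_free u - tau_free v.
Proof. exact: linearB. Qed.

Lemma tau_free_ideal (u : freeU) : u \in @idealU R n r s -> tau_free u = 0.
Proof.
pose S : set freeU := [set u | tau_free u = 0].
have inS v : tau_free v = 0 -> v \in S by exact: mem_set.
have outS v : v \in S -> tau_free v = 0 by exact: set_mem.
have h : {subset @idealU R n r s <= S}.
  apply: idealU_smallest => [|v w vw].
    split; first split.
    - by apply: inS; exact: tau_free0.
    - move=> v w /outS hv /outS hw; apply: inS; rewrite tau_freeB.
      by apply: etrans (congr2 (fun x y => x - y) hv hw) _; exact: subrr.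
    - move=> c d v /outS hv; apply: inS; rewrite tau_freeM tau_freeM.
      by apply: etrans (congr1 (fun x => _ * (x * _)) hv) _; rewrite mul0r mulr0.
  apply: inS; rewrite tau_freeB; apply/eqP; rewrite subr_eq0; apply/eqP.
  exact: (relU_swap r_neq0 s_neq0 (@gU_rel R n r s) (t := tau_free) tau_freeM
    tau_free1 tau_free_gen vw).
by move=> /h/outS.
Qed.

Definition tau (x : U) : U := tau_free (repr x).

Lemma tau_pi u : tau (piU u) = tau_free u.
Proof.
by apply/eqP; rewrite -subr_eq0 -tau_freeB tau_free_ideal // repr_piU.
Qed.

Lemma tau_is_linear : linear tau.
Proof.
move=> c x y; have [u ->] := piU_surj x; have [v ->] := piU_surj y.
have E : c *: piU u + piU v = piU (c *: u + v).
  exact: (esym (etrans (piUD (c *: u) v) (congr1 (fun a => a + piU v) (piUZ c u)))).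
apply: etrans (congr1 tau E) _; apply: etrans (tau_pi _) _; apply: etrans (tau_freeP _ _ _) _; apply: esym.
exact: (congr2 (fun a b => c *: a + b) (tau_pi u) (tau_pi v)).
Qed.
HB.instance Definition _ := GRing.isLinear.Build K U U *:%R tau tau_is_linear.

Lemma tauM x y : tau (x * y) = tau y * tau x.
Proof.
have [u ->] := piU_surj x; have [v ->] := piU_surj y.
have E : piU u * piU v = piU (u * v) by apply: esym; exact: piUM.
apply: etrans (congr1 tau E) _; apply: etrans (tau_pi _) _; apply: etrans (tau_freeM _ _) _; apply: esym.
exact: (congr2 *%R (tau_pi v) (tau_pi u)).
Qed.

Lemma tau1 : tau 1 = 1.
Proof. by rewrite -(rmorph1 (@piU R n r s)) tau_pi tau_free1. Qed.

Lemma tau_gen x : tau (gU r s x) = gU r s (swap_gen x).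
Proof. by rewrite /gU tau_pi tau_free_gen. Qed.

End Tau.

(** * Torus monomials *)

Section Torus.
Context {R : realType} {n : nat}.
Variables r s : R[i].
Hypothesis r_neq0 : r != 0.
Hypothesis s_neq0 : s != 0.
Local Notation K := (Qrs r s).
Local Notation pr := (@pairing R n r s).
Variables (A : algType K) (g : gen n -> A).
Hypothesis g_rel : forall y z, relU g y z -> y = z.
Local Notation e i := (g (GenE i)).
Local Notation f i := (g (GenF i)).
Local Notation O p q i := (g (GenO p q i)).
Implicit Types (i j k : 'I_n) (p q : bool).

(** The monoid generated by the omega_i, omega'_i and their inverses. *)
Inductive torus : A -> Prop :=
| torus1 : torus 1
| torusM p q k x : torus x -> torus (O p q k * x).

Lemma torus_gen p q k : torus (O p q k).
Proof. by rewrite -[g _]mulr1; apply: torusM; exact: torus1. Qed.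

Lemma torus_mul x y : torus x -> torus y -> torus (x * y).
Proof. by elim=> [|p q k z _ IH] ty; rewrite ?mul1r // -mulrA; apply: torusM; exact: IH. Qed.

Lemma torus_prod (I : Type) (l : seq I) F : (forall k : I, torus (F k)) -> torus (\prod_(i <- l) F i).
Proof.
move=> h; elim: l => [|i l IH]; rewrite ?big_nil ?big_cons; first exact: torus1.
exact: torus_mul.
Qed.

Lemma torus_exp x m : torus x -> torus (x ^+ m).
Proof.
by move=> tx; elim: m => [|m IH]; rewrite ?expr0 ?exprS; [exact: torus1 | exact: torus_mul].
Qed.

Lemma torus_comm p q k x : torus x -> O p q k * x = x * O p q k.
Proof.
by elim=> [|p' q' k' z _ IH]; rewrite ?mulr1 ?mul1r // mulrA (sol_toral g_rel) -!mulrA IH.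
Qed.

Lemma quasi_torus (a x : A) :
  (forall p k, exists2 c : K, c != 0 & O p false k * a = c *: (a * O p false k)) ->
  torus x -> exists2 c : K, c != 0 & x * a = c *: (a * x).
Proof.
move=> qa; have {}qa p q k : exists2 c : K, c != 0 & O p q k * a = c *: (a * O p q k).
  have [c c0 E] := qa p k; case: q; last by exists c.
  exists c^-1; rewrite ?invr_neq0 //.
  have := congr1 (fun x => c^-1 *: (O p true k * x * O p true k)) E.
  rewrite mulrA (sol_wK g_rel p true k) mul1r -scalerAr -scalerAl scalerA mulVf // scale1r => ->.
  by rewrite -!mulrA (sol_wK g_rel p false k) mulr1.
elim=> [|p q k z _ [c c0 IH]]; first by exists 1; rewrite ?oner_neq0 // mulr1 mul1r scale1r.
have [d d0 E] := qa p q k; exists (c * d); first by rewrite mulf_neq0.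
by rewrite -mulrA IH -scalerAr [_ * (a * z)]mulrA E -scalerAl scalerA mulrA.
Qed.

Lemma torus_e x i : torus x -> exists2 c : K, c != 0 & x * e i = c *: (e i * x).
Proof.
apply: quasi_torus => p k; case: p; [exists (pr k i)^-1 | exists (pr i k)];
  rewrite ?invr_neq0 ?pairing_neq0 //; [exact: sol_w'e | exact: sol_we].
Qed.

Lemma torus_f x i : torus x -> exists2 c : K, c != 0 & x * f i = c *: (f i * x).
Proof.
apply: quasi_torus => p k; case: p; [exists (pr k i) | exists (pr i k)^-1];
  rewrite ?invr_neq0 ?pairing_neq0 //; [exact: sol_w'f | exact: sol_wf].
Qed.

(** x to the power k when y is the inverse of x. *)
Definition zp (x y : A) (k : int) : A :=
  match k with Posz m => x ^+ m | Negz m => y ^+ m.+1 end.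

Lemma zpS x y (k : int) : x * y = 1 -> x * zp x y k = zp x y (k + 1).
Proof.
move=> xy; case: k => [m|[|m]].
- have -> : Posz m + 1 = m.+1 by lia.
  by rewrite /zp -exprS.
- exact: xy.
- have -> : Negz m.+1 + 1 = Negz m by lia.
  by rewrite /zp exprS mulrA xy mul1r.
Qed.

Lemma zpP x y (k : int) : y * x = 1 -> y * zp x y k = zp x y (k - 1).
Proof.
move=> yx; case: k => [[|m]|m].
- have -> : Posz 0 - 1 = Negz 0 by lia.
  by rewrite /zp expr0 mulr1.
- have -> : Posz m.+1 - 1 = m by lia.
  by rewrite /zp exprS mulrA yx mul1r.
- have -> : Negz m - 1 = Negz m.+1 by lia.
  by rewrite /zp -exprS.
Qed.

Definition zgen p k (m : int) : A := zp (O p false k) (O p true k) m.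

Lemma torus_zgen p k m : torus (zgen p k m).
Proof. by case: m => m; apply: torus_exp; exact: torus_gen. Qed.

Lemma zgenM p q k m : O p q k * zgen p k m = zgen p k (m + (if q then - 1 else 1)).
Proof.
case: q; first exact/zpP/(sol_wK g_rel p true).
exact/zpS/(sol_wK g_rel p false).
Qed.

Lemma mul_prod_at (I : eqType) (l : seq I) (F G : I -> A) (x : A) (k : I) :
  uniq l -> k \in l -> (forall i : I, x * F i = F i * x) ->
  G k = x * F k -> (forall i : I, i != k -> G i = F i) ->
  x * \prod_(i <- l) F i = \prod_(i <- l) G i.
Proof.
move=> + + xF Gk GF; elim: l => // i l IH /= /andP[il ul]; rewrite in_cons !big_cons.
have [ki _|ki /= kl] := eqVneq k i.
  rewrite -ki mulrA Gk; congr (_ * _); rewrite big_seq [RHS]big_seq; apply: eq_bigr => j jl.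
  by rewrite GF //; apply: contraNneq il => jk; rewrite -ki -jk.
by rewrite mulrA xF -mulrA (IH ul kl) GF // eq_sym.
Qed.

Definition torus_mon (m : rootlattice n * rootlattice n) : A :=
  (\prod_i zgen true i (m.1 i)) * (\prod_i zgen false i (m.2 i)).

Lemma torus_tmon m : torus (torus_mon m).
Proof. by apply: torus_mul; apply: torus_prod => i; exact: torus_zgen. Qed.

Definition shift (a : rootlattice n) k (z : int) : rootlattice n :=
  [ffun i => a i + (if i == k then z else 0)].

Lemma gen_prod_zgen p q k (a : rootlattice n) : O p q k * (\prod_i zgen p i (a i)) =
  \prod_i zgen p i (shift a k (if q then - 1 else 1) i).
Proof.
apply: (@mul_prod_at _ _ _ _ _ k); rewrite ?index_enum_uniq ?mem_index_enum //.
- by move=> i; apply: torus_comm; exact: torus_zgen.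
- by rewrite zgenM ffunE eqxx.
- by move=> i /negbTE ik; rewrite ffunE ik addr0.
Qed.

Lemma gen_tmon p q k m : exists m', O p q k * torus_mon m = torus_mon m'.
Proof.
case: p.
  exists (shift m.1 k (if q then - 1 else 1), m.2).
  by rewrite /torus_mon mulrA gen_prod_zgen.
exists (m.1, shift m.2 k (if q then - 1 else 1)).
rewrite /torus_mon -gen_prod_zgen mulrA torus_comm ?mulrA //.
by apply: torus_prod => i; exact: torus_zgen.
Qed.

Lemma tmon0 : torus_mon (0, 0) = 1.
Proof. by rewrite /torus_mon !big1 ?mulr1 // => i _; rewrite ffunE. Qed.

Lemma torus_tmonE x : torus x -> exists m, x = torus_mon m.
Proof.
elim=> [|p q k z _ [m ->]]; first by exists (0, 0); rewrite tmon0.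
by have [m' E] := gen_tmon p q k m; exists m'.
Qed.

Section Character.
Variables (lam lam' : 'I_n -> K) (v : A -> K).
Hypothesis lam_neq0 : forall i, lam i != 0.
Hypothesis lam'_neq0 : forall i, lam' i != 0.
Hypothesis vO : forall x p q i, v (x * O p q i) = torus_cst lam lam' p q i * v x.

(** The value of the character omega_i |-> lam i, omega'_i |-> lam' i. *)
Definition tchar (m : rootlattice n * rootlattice n) : K :=
  (\prod_i lam' i ^ m.1 i) * (\prod_i lam i ^ m.2 i).

Lemma v_zgen x p k m : v (x * zgen p k m) = (if p then lam' k else lam k) ^ m * v x.
Proof.
have vX q l y : v (y * O p q k ^+ l) = torus_cst lam lam' p q k ^+ l * v y.
  elim: l y => [|l IH] y; first by rewrite !expr0 mulr1 mul1r.
  by rewrite exprS mulrA IH vO mulrA -exprSr.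
case: m => m; rewrite /zgen /zp vX /torus_cst //.
by rewrite NegzE -exprnN exprVn.
Qed.

Lemma v_tmon x m : v (x * torus_mon m) = tchar m * v x.
Proof.
have vP p (a : rootlattice n) (l : seq 'I_n) y : v (y * \prod_(i <- l) zgen p i (a i)) =
    (\prod_(i <- l) (if p then lam' i else lam i) ^ a i) * v y.
  elim: l y => [|i l IH] y; first by rewrite !big_nil mulr1 mul1r.
  by rewrite !big_cons mulrA IH v_zgen mulrA; congr (_ * _); rewrite mulrC.
rewrite /torus_mon mulrA (vP false m.2) (vP true m.1) mulrA.
by apply: (congr1 (fun c : K => c * v x)); exact: mulrC.
Qed.

End Character.

End Torus.

(** * Spanning by triangular monomials *)

Lemma lincombP (K : nzRingType) (V : lmodType K) (I : Type) (F : I -> V) a (l l' : seq (K * I)) :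
  \sum_(q <- [seq (a * q.1, q.2) | q <- l] ++ l') q.1 *: F q.2 =
  a *: (\sum_(q <- l) q.1 *: F q.2) + \sum_(q <- l') q.1 *: F q.2.
Proof.
rewrite big_cat big_map scaler_sumr; congr (_ + _).
by apply: eq_bigr => q _; rewrite scalerA.
Qed.

Section Spanning.
Context {R : realType} {n : nat}.
Variables r s : R[i].
Hypothesis r_neq0 : r != 0.
Hypothesis s_neq0 : s != 0.
Local Notation K := (Qrs r s).
Local Notation T := (free_module_on K (seq 'I_n)).
Variables (A : algType K) (g : gen n -> A).
Hypothesis g_rel : forall y z, relU g y z -> y = z.
Local Notation e i := (g (GenE i)).
Local Notation f i := (g (GenF i)).
Local Notation O p q i := (g (GenO p q i)).
Implicit Types (i j k : 'I_n).

Definition eword (w : seq 'I_n) : A := \prod_(i <- w) e i.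
Definition fword (w : seq 'I_n) : A := \prod_(i <- w) f i.

(** A word of f's, the exponents of a torus monomial, and a word of e's. *)
Definition mono : Type := (seq 'I_n * (rootlattice n * rootlattice n) * seq 'I_n)%type.
Definition mono_val (q : mono) : A := fword q.1.1 * torus_mon g q.1.2 * eword q.2.

Definition spanned (x : A) := exists l : seq (K * mono), x = \sum_(q <- l) q.1 *: mono_val q.2.

Lemma spannedP c x y : spanned x -> spanned y -> spanned (c *: x + y).
Proof.
move=> [l ->] [l' ->]; exists ([seq (c * q.1, q.2) | q <- l] ++ l').
by rewrite lincombP.
Qed.

Lemma spanned0 : spanned 0.
Proof. by exists [::]; rewrite big_nil. Qed.

Lemma spannedZ c x : spanned x -> spanned (c *: x).
Proof. by move=> h; rewrite -[_ *: _]addr0; apply: spannedP => //; exact: spanned0. Qed.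

Lemma spannedD x y : spanned x -> spanned y -> spanned (x + y).
Proof. by move=> hx hy; rewrite -[x]scale1r; exact: spannedP. Qed.

Lemma spanned_sum (I : Type) (l : seq I) (F : I -> A) :
  (forall q, spanned (F q)) -> spanned (\sum_(q <- l) F q).
Proof. by move=> h; apply: big_ind => //; [exact: spanned0 | exact: spannedD]. Qed.

Lemma spanned_mval q : spanned (mono_val q).
Proof. by exists [:: (1, q)]; rewrite big_seq1 scale1r. Qed.

Lemma spanned_mull a x : (forall q, spanned (a * mono_val q)) -> spanned x -> spanned (a * x).
Proof.
move=> h [l ->]; rewrite mulr_sumr; apply: spanned_sum => q.
by rewrite -scalerAr; exact: spannedZ.
Qed.

Lemma torus_fw x w : torus g x -> exists2 c : K, c != 0 & x * fword w = c *: (fword w * x).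
Proof.
move=> tx; elim: w => [|i w [c c0 IH]].
  by exists 1; rewrite ?oner_neq0 // /fword big_nil mul1r mulr1 scale1r.
have [d d0 E] := torus_f r_neq0 s_neq0 g_rel i tx; exists (d * c); first by rewrite mulf_neq0.
rewrite /fword big_cons mulrA E -scalerAl -[_ * x * _]mulrA IH -scalerAr scalerA.
by rewrite mulrA.
Qed.

Lemma spanned_f i q : spanned (f i * mono_val q).
Proof.
case: q => [[w' m] w]; have := spanned_mval (i :: w', m, w).
by rewrite /mono_val /= /fword big_cons !mulrA.
Qed.

Lemma spanned_O p q k x : spanned (O p q k * mono_val x).
Proof.
case: x => [[w' m] w].
have [c _ E] := torus_fw w' (torus_gen g p q k).
have [m' Em] := gen_tmon r_neq0 s_neq0 g_rel p q k m.
have -> : O p q k * mono_val (w', m, w) = c *: mono_val (w', m', w).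
  by rewrite /mono_val /= -Em !mulrA E -!scalerAl.
exact/spannedZ/spanned_mval.
Qed.

(** e_i moves to the right through the f's; each crossing leaves a torus element
acting on a shorter monomial. *)
Lemma spanned_e i q : spanned (e i * mono_val q).
Proof.
case: q => [[w' m] w]; elim: w' => [|k w' IH].
  have [c c0 E] := torus_e r_neq0 s_neq0 g_rel i (torus_tmon g m).
  have -> : e i * mono_val ([::], m, w) = c^-1 *: mono_val ([::], m, i :: w).
    rewrite /mono_val /=; move: (torus_mon g m) E => t E.
    rewrite /fword big_nil !mul1r /eword big_cons !mulrA E -scalerAl.
    by rewrite scalerA mulVf // scale1r.
  exact/spannedZ/spanned_mval.
have -> : mono_val (k :: w', m, w) = f k * mono_val (w', m, w).
  by rewrite /mono_val /= /fword big_cons !mulrA.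
rewrite mulrA (sol_ef g_rel) mulrDl -mulrA; apply: spannedD.
  by apply: spanned_mull IH; exact: spanned_f.
rewrite -!scalerAl; apply/spannedZ/spannedZ.
rewrite mulrBl -scaleN1r addrC; apply: spannedP; exact: spanned_O.
Qed.

Hypothesis g_span : forall x, exists l : seq (K * seq (gen n)),
  x = \sum_(q <- l) q.1 *: \prod_(k <- q.2) g k.

Theorem spannedT x : spanned x.
Proof.
have [l ->] := g_span x; apply: spanned_sum => -[c u]; apply: spannedZ => /=.
elim: u => [|a u IH].
  rewrite big_nil; have := spanned_mval ([::], (0, 0), [::]).
  by rewrite /mono_val /fword /eword /= !big_nil tmon0 !mulr1.
rewrite big_cons; apply: spanned_mull IH; case: a => *.
- exact: spanned_e.
- exact: spanned_f.
- exact: spanned_O.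
Qed.

End Spanning.

(** * The contravariant form of a Verma module *)

Section VermaPairing.
Context {R : realType} {n : nat}.
Variables r s : R[i].
Local Notation K := (Qrs r s).
Local Notation T := (free_module_on K (seq 'I_n)).
Local Notation pr := (@pairing R n r s).
Implicit Types (i : 'I_n) (w x z : seq 'I_n) (y : T).

Section Highest.
Variables lam lam' : 'I_n -> K.
Definition raises w y : T := foldr (raiseE lam lam') y w.
(** The contravariant form of the Verma module of highest weight (lam, lam')
between a word of e's and y; see [v_left]. *)
Definition vpair w y : K := coef [::] (raises w y).

Lemma raises_is_linear w : linear (raises w).
Proof. by move=> c y z; rewrite /raises; elim: w => //= i w ->; exact: linearP. Qed.
HB.instance Definition _ w := GRing.isLinear.Build K T T *:%R (raises w) (raises_is_linear w).

Lemma raises_insupp z w y : insupp (perm_eq z) y ->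
  insupp (fun u => perm_eq z (w ++ u)) (raises w y).
Proof.
move=> hy; elim: w => [//|i w IH] /=.
have H u v : perm_eq z (w ++ u) -> perm_eq u (i :: v) -> perm_eq z (i :: w ++ v).
  move=> /perm_trans h; rewrite -(perm_cat2l w) => /h /perm_trans; apply.
  by rewrite -(cat1s i v) -(cat1s i (w ++ v)) perm_catCA.
rewrite /raiseE; apply: insuppZ; rewrite -scaleNr; apply: insuppD; apply: insuppZ.
  exact: insupp_der H IH.
exact: insupp_der H IH.
Qed.

Lemma raises_vac w x : (size x <= size w)%N ->
  raises w (single x) = vpair w (single x) *: single [::].
Proof.
move=> le; apply: coef_inj => u; rewrite coefZ coef_single.
case: u => [|k u]; first by rewrite eqxx mulr1.
rewrite (_ : ([::] == k :: u) = false) // mulr0; apply/eqP; apply: contraT => c0.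
have := @raises_insupp x w _ (insupp_single (perm_refl x)) _ c0.
by move=> /perm_size; rewrite size_cat /=; lia.
Qed.

Lemma vpair_perm w x : ~~ perm_eq w x -> vpair w (single x) = 0.
Proof.
apply: contraNeq => c0.
have := @raises_insupp x w _ (insupp_single (perm_refl x)) _ c0.
by rewrite cats0 perm_sym.
Qed.
End Highest.

Section OneParameter.
Variables N N' : 'I_n -> nat.
Hypothesis NN' : forall i, (N i < N' i)%N.
Definition ppow (M : 'I_n -> nat) (b : K) i : K := b ^+ M i.
Definition wsum (M : 'I_n -> nat) w : int := \sum_(i <- w) (M i)%:Z.
Definition wdelta w : K := \prod_(i <- w) delta r s i.

(** Each raising operator is b^(N i) derA - b^(N' i) derB up to delta, and only
its first term contributes to the lowest power of b, since N i < N' i. *)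
Lemma low_vpair w y : low (fun b => vpair (ppow N b) (ppow N' b) w y) (wsum N w)
  (wdelta w * form pr w y).
Proof.
elim/last_ind: w y => [|w i IH] y.
  rewrite /wsum /wdelta !big_nil mul1r; exact: lowC.
rewrite /wsum /wdelta !big_rcons /=.
have E b : vpair (ppow N b) (ppow N' b) (rcons w i) y =
    delta r s i * (b ^ (N i)%:Z * vpair (ppow N b) (ppow N' b) w (derA pr i y) +
    (-1) * (b ^ (N' i)%:Z * vpair (ppow N b) (ppow N' b) w (derB pr i y))).
  rewrite {1}/vpair /raises foldr_rcons -/(raises _ _ _ _) [raiseE _ _ _ _]/raiseE.
  rewrite linearZ /= linearB /= !linearZ /= coefZ coefD -scaleN1r !coefZ.
  by rewrite !mulN1r mulrN.
apply: (@low_eq _ _ _ _ _ (fun b _ => esym (E b))).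
have -> : form pr (rcons w i) y = form pr w (derA pr i y) by rewrite /form /derAs foldr_rcons.
have -> : wdelta w * delta r s i * form pr w (derA pr i y) =
  delta r s i * (1 * (wdelta w * form pr w (derA pr i y)) + (-1) * 0).
  by rewrite mulr0 addr0 mul1r mulrA [X in X * _]mulrC.
rewrite [\sum_(j <- w) _ + _]addrC; apply: lowZ; apply: lowD.
  by apply: lowM; [exact: lowX | exact: IH].
apply: lowZ; apply: low_weaken (lowM (lowX _ _) (IH (derB pr i y))).
by rewrite ltrD2r; exact: NN'.
Qed.

(** The pairing of words vanishes unless they are permutations of each other;
so the exponent can be read off either word. *)
Lemma low_vpair_r w x : low (fun b => vpair (ppow N b) (ppow N' b) w (single x)) (wsum N x)
  (wdelta x * form pr w (single x)).
Proof.
have [wx|nwx] := boolP (perm_eq w x).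
  have -> : wsum N x = wsum N w by rewrite /wsum; apply: perm_big; rewrite perm_sym.
  have -> : wdelta x = wdelta w by rewrite /wdelta; apply: perm_big; rewrite perm_sym.
  exact: low_vpair.
rewrite form_perm ?mulr0; last exact: insupp_single.
apply: (@low_eq _ (fun=> 0)); last exact: low0.
by move=> b _; rewrite vpair_perm.
Qed.

End OneParameter.
End VermaPairing.

(** * Verma modules separate weight-zero elements *)

Section Faithful.
Context {R : realType} {n : nat}.
Variables r s : R[i].
Hypothesis r_neq0 : r != 0.
Hypothesis s_neq0 : s != 0.
Hypothesis rs_generic : forall k l : int, r ^ k * s ^ l = 1 <-> k = 0 /\ l = 0.
Local Notation K := (Qrs r s).
Local Notation pr := (@pairing R n r s).
Local Notation T := (free_module_on K (seq 'I_n)).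
Variables (A : algType K) (g : gen n -> A).
Hypothesis g_rel : forall y z, relU g y z -> y = z.
Hypothesis g_span : forall x, exists l : seq (K * seq (gen n)),
  x = \sum_(q <- l) q.1 *: \prod_(k <- q.2) g k.
Local Notation e i := (g (GenE i)).
Local Notation f i := (g (GenF i)).
Local Notation O p q i := (g (GenO p q i)).
Local Notation ff := (fun i => g (GenF i)).
Local Notation ew := (eword g).
Local Notation fw := (fword g).
Local Notation mval := (mono_val g).
Local Notation tmon := (torus_mon g).
Local Notation single := (single : seq 'I_n -> T).
Implicit Types (i j k : 'I_n) (u x : A) (y : T).

Lemma e_evf_sol i y : e i * evf ff y = evf ff y * e i +
  delta r s i *: (evf ff (derA pr i y) * O false false i - evf ff (derB pr i y) * O true false i).
Proof. exact: (e_evf (sol_wf g_rel) (sol_w'f g_rel) (sol_ef g_rel)). Qed.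

Lemma evf_fw w : evf ff (single w) = fw w.
Proof. exact: evf_single. Qed.

Variable v : ('I_n -> K) -> ('I_n -> K) -> A -> K.
Definition nowhere0 (lam : 'I_n -> K) := forall i, lam i != 0.
Hypothesis vP : forall lam lam', nowhere0 lam -> nowhere0 lam' ->
  forall c x z, v lam lam' (c *: x + z) = c * v lam lam' x + v lam lam' z.
Hypothesis v1 : forall lam lam', nowhere0 lam -> nowhere0 lam' -> v lam lam' 1 = 1.
Hypothesis vE : forall lam lam', nowhere0 lam -> nowhere0 lam' ->
  forall x i, v lam lam' (x * e i) = 0.
Hypothesis vO : forall lam lam', nowhere0 lam -> nowhere0 lam' ->
  forall x p q i, v lam lam' (x * O p q i) = torus_cst lam lam' p q i * v lam lam' x.
Hypothesis vF : forall lam lam', nowhere0 lam -> nowhere0 lam' ->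
  forall x i, v lam lam' (f i * x) = 0.

Section Highest.
Variables lam lam' : 'I_n -> K.
Hypothesis lam_neq0 : nowhere0 lam.
Hypothesis lam'_neq0 : nowhere0 lam'.
Local Notation vl := (v lam lam').

Lemma v0 : vl 0 = 0.
Proof.
have := vP lam_neq0 lam'_neq0 1 0 0; rewrite scale1r addr0 mul1r => h.
by apply: (@addrI _ (vl 0)); rewrite addr0 -h.
Qed.

Lemma vZ c x : vl (c *: x) = c * vl x.
Proof. by rewrite -[c *: x]addr0 vP // v0 addr0. Qed.

Lemma vD x z : vl (x + z) = vl x + vl z.
Proof. by rewrite -[x]scale1r vP // mul1r scale1r. Qed.

Lemma v_sum (I : Type) (l : seq I) (c : I -> K) (F : I -> A) :
  vl (\sum_(q <- l) c q *: F q) = \sum_(q <- l) c q * vl (F q).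
Proof. by elim: l => [|q l IH]; rewrite ?big_nil ?v0 // !big_cons vP // IH. Qed.

(** In vev (u e_i y) the e_i can be moved to the right of y, where it dies; the
commutator is y acted upon by the raising operator. *)
Lemma v_raise u w y : vl (u * ew w * evf ff y) = vl (u * evf ff (raises lam lam' w y)).
Proof.
elim: w u => [|i w IH] u; first by rewrite /eword big_nil mulr1.
rewrite /eword big_cons mulrA -/(eword g w) IH /=.
move: (raises lam lam' w y) => z.
have evZ c t : evf ff (c *: t) = c *: evf ff t by exact: linearZ.
have evB t t' : evf ff (t - t') = evf ff t - evf ff t' by exact: linearB.
rewrite -mulrA e_evf_sol /raiseE evZ evB !evZ.
move: (evf ff z) (evf ff (derA pr i z)) (evf ff (derB pr i z)) => c a b.
have -> : u * (c * e i + delta r s i *: (a * O false false i - b * O true false i)) =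
    u * c * e i + delta r s i *: (u * a * O false false i + (-1) *: (u * b * O true false i)).
  by rewrite mulrDr mulrA -scalerAr mulrBr !mulrA scaleN1r.
have -> : u * (delta r s i *: (lam i *: a - lam' i *: b)) =
    delta r s i *: (lam i *: (u * a) + (- lam' i) *: (u * b)).
  by rewrite -scalerAr mulrBr -!scalerAr scaleNr.
rewrite !(vD, vZ) vE // !vO // /torus_cst add0r.
by rewrite mulN1r mulNr.
Qed.

Lemma v_evf y : vl (evf ff y) = coef [::] y.
Proof.
move: y; apply: single_ind => [|c w y IH]; first by rewrite linear0 v0 coef0.
rewrite linearP /= vP // coefP IH evf_fw coef_single; congr (_ * _ + _).
by case: w => [|k w]; rewrite /fword ?big_nil ?big_cons ?v1 ?vF.
Qed.

Lemma v_right u w (x : seq 'I_n) : (size x <= size w)%N ->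
  vl (u * ew w * fw x) = vpair lam lam' w (single x) * vl u.
Proof.
move=> le; rewrite -evf_fw v_raise raises_vac // linearZ /= evf_fw /fword big_nil.
by rewrite -scalerAr mulr1 vZ.
Qed.

Lemma v_left w (x : seq 'I_n) : vl (ew w * fw x) = vpair lam lam' w (single x).
Proof. by rewrite -[ew w]mul1r -evf_fw v_raise mul1r v_evf. Qed.

(** When w2 is not longer than the word of e's, the latter times w2 acts on the
highest weight vector by a scalar, the first pairing to come out. *)
Lemma v_mono w1 (q : mono) w2 : (size w2 <= size q.2)%N ->
  vl (ew w1 * mval q * fw w2) = vpair lam lam' w1 (single q.1.1) * tchar lam lam' q.1.2 *
    vpair lam lam' q.2 (single w2).
Proof.
move=> le; have vt x := v_tmon (vO lam_neq0 lam'_neq0) x q.1.2.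
rewrite /mono_val; move: (tmon _) (tchar _ _ _) vt => t c vt.
rewrite !mulrA v_right // vt v_left.
by rewrite mulrC [c * _]mulrC.
Qed.

End Highest.

Variable tau : {linear A -> A}.
Hypothesis tauM : forall x z, tau (x * z) = tau z * tau x.
Hypothesis tau1 : tau 1 = 1.
Hypothesis tau_g : forall x : gen n, tau (g x) = g (swap_gen x).

Lemma tau_torus t : torus g t -> tau t = t.
Proof.
elim=> [|p q k z tz IH]; first exact: tau1.
by rewrite tauM IH tau_g (torus_comm g_rel).
Qed.

Lemma tau_ew w : tau (ew w) = fw (rev w).
Proof.
elim: w => [|i w IH]; first by rewrite /eword /fword !big_nil tau1.
by rewrite /eword big_cons tauM tau_g -/(eword g w) IH rev_cons /fword big_rcons.
Qed.

Lemma tau_fw w : tau (fw w) = ew (rev w).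
Proof.
elim: w => [|i w IH]; first by rewrite /eword /fword !big_nil tau1.
by rewrite /fword big_cons tauM tau_g -/(fword g w) IH rev_cons /eword big_rcons.
Qed.

Lemma tau_mval (q : mono) : tau (mval q) = mval (rev q.2, q.1.2, rev q.1.1).
Proof.
rewrite /mono_val 2!tauM tau_ew tau_fw tau_torus; last exact: torus_tmon.
by move: (tmon _) => t; rewrite mulrA.
Qed.

(** Both sides vanish on monomials involving some e or f, and tau fixes the
torus. *)
Lemma v_tau lam lam' : nowhere0 lam -> nowhere0 lam' ->
  forall x, v lam lam' (tau x) = v lam lam' x.
Proof.
move=> l0 l0' x; have [l ->] := spannedT r_neq0 s_neq0 g_rel g_span x.
rewrite linear_sum /=; under eq_bigr do rewrite linearZ /=.
rewrite !v_sum //; apply: eq_bigr => -[c [[x' m] z]] _; congr (_ * _); rewrite tau_mval /=.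
have vFw k w t : v lam lam' (mval (k :: w, m, t)) = 0.
  by rewrite /mono_val /fword big_cons; move: (tmon _) => a; rewrite -!mulrA vF.
have vEw k w t : v lam lam' (mval (t, m, rcons w k)) = 0.
  by rewrite /mono_val /eword big_rcons; move: (tmon _) => a; rewrite !mulrA vE.
case: x' => [|i x'].
  case/lastP: z => [//|z k]; rewrite vEw rev_rcons; exact: vFw.
by rewrite vFw rev_cons; exact: vEw.
Qed.

Lemma ppow_nowhere0 (N : 'I_n -> nat) (b : K) : b != 0 -> nowhere0 (ppow N b).
Proof. by move=> b0 i; rewrite expf_neq0. Qed.

Let rr0 : rQ r s != 0. Proof. exact: rQ_neq0. Qed.
Let rr_generic m : rQ r s ^+ m.+1 != 1.
Proof.
apply/eqP => h; have : rs_mon r s m.+1 0 = 1 by rewrite /rs_mon expr0z mulr1.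
by move=> /(rs_mon_eq1 rs_generic) [].
Qed.

Lemma wdelta_neq0 (w : seq 'I_n) : wdelta r s w != 0.
Proof. by rewrite prodf_seq_neq0; apply/allP => i _; rewrite invr_neq0 ?rs_diff_neq0. Qed.

(** Both numbers are lowest terms of the same function of b, read once on
e_w f_x and once on its image under tau; the two words have the same weight or
both sides vanish. *)
Lemma form_sym (w x : seq 'I_n) : form pr w (single x) = form pr (rev x) (single (rev w)).
Proof.
(* Any exponents with N < N' would do. *)
pose N (i : 'I_n) := 0%N; pose N' (i : 'I_n) := 1%N.
have NN' i : (N i < N' i)%N by [].
have h1 := low_vpair NN' w (single x).
have h2 := low_vpair_r r s NN' (rev x) (rev w).
have E : wsum N (rev w) = wsum N w by rewrite /wsum; apply: perm_big; rewrite perm_rev.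
have Ed : wdelta r s (rev w) = wdelta r s w by rewrite /wdelta; apply: perm_big; rewrite perm_rev.
rewrite E Ed in h2.
apply: (mulfI (wdelta_neq0 w)); apply: (low_unique rr0 rr_generic h1).
apply: low_eq h2 => b b0; have [l0 l0'] := (ppow_nowhere0 N b0, ppow_nowhere0 N' b0).
rewrite -(v_left l0 l0') -(v_left l0 l0') -(v_tau l0 l0') tauM tau_ew tau_fw.
by rewrite !revK.
Qed.

Lemma evf_sum (I : Type) (l : seq I) (c : I -> K) (w : I -> seq 'I_n) :
  (forall z, \sum_(q <- l) c q * form pr z (single (w q)) = 0) ->
  \sum_(q <- l) c q *: fw (w q) = 0.
Proof.
move=> h; have E : \sum_(q <- l) c q *: fw (w q) = evf ff (\sum_(q <- l) c q *: single (w q)).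
  by rewrite linear_sum; apply: eq_bigr => q _; rewrite linearZ /= evf_fw.
rewrite E; apply: (sol_radical r_neq0 s_neq0 rs_generic g_rel) => z.
rewrite -[RHS](h z); elim: l {h E} => [|q l IH]; first by rewrite !big_nil form0.
by rewrite !big_cons form_linear IH.
Qed.

(** By the symmetry of the form and tau, from the statement on the f's. *)
Lemma ew_sum (I : Type) (l : seq I) (c : I -> K) (w : I -> seq 'I_n) :
  (forall z, \sum_(q <- l) c q * form pr (w q) (single z) = 0) ->
  \sum_(q <- l) c q *: ew (w q) = 0.
Proof.
move=> h; have : \sum_(q <- l) c q *: fw (rev (w q)) = 0.
  by apply: evf_sum => z; rewrite -[RHS](h (rev z)); apply: eq_bigr => q _; rewrite [in RHS]form_sym revK.
move/(congr1 tau); rewrite linear0 linear_sum => {2}<-.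
by apply: eq_bigr => q _; rewrite linearZ /= tau_fw revK.
Qed.

Lemma tchar_ppow (N N' : 'I_n -> nat) (b : K) m : b != 0 ->
  tchar (ppow N b) (ppow N' b) m = b ^ expdot N N' m.
Proof.
move=> b0; have S (M : 'I_n -> nat) (a : 'I_n -> int) :
    \prod_i ppow M b i ^ a i = b ^ (\sum_i (M i)%:Z * a i).
  apply: (big_rec2 (fun (x : K) (y : int) => x = b ^ y)) => [|i x y _ ->]; first by rewrite expr0z.
  by rewrite expfzDr // /ppow exprnP exprz_exp.
by rewrite /expdot expfzDr // -!S.
Qed.

Lemma low_v_mono (N N' : 'I_n -> nat) w1 (q : mono) w2 : (forall i, (N i < N' i)%N) ->
  (size w2 <= size q.2)%N ->
  low (fun b => v (ppow N b) (ppow N' b) (ew w1 * mval q * fw w2))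
    (wsum N w1 + expdot N N' q.1.2 + wsum N w2)
    (wdelta r s w1 * wdelta r s w2 * (form pr w1 (single q.1.1) * form pr q.2 (single w2))).
Proof.
move=> NN' le; rewrite mulrACA.
have h1 := low_vpair NN' w1 (single q.1.1).
have h2 := lowX (Qrs r s : fieldType) (expdot N N' q.1.2).
have h3 := low_vpair_r r s NN' q.2 w2.
have := lowM (lowM h1 h2) h3; rewrite mulr1.
apply: low_eq => b b0.
by rewrite (v_mono (ppow_nowhere0 N b0) (ppow_nowhere0 N' b0)) // tchar_ppow.
Qed.

Lemma v_mono_size lam lam' : nowhere0 lam -> nowhere0 lam' ->
  forall w1 (q : mono) w2, (size w2 < size q.2)%N ->
  v lam lam' (ew w1 * mval q * fw w2) = 0.
Proof.
move=> l0 l0' w1 q w2 lt; rewrite v_mono //; last exact: ltnW.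
rewrite [X in _ * X]vpair_perm ?mulr0 //.
by apply/negP => /perm_size E; rewrite E ltnn in lt.
Qed.

Lemma form_size w (x : seq 'I_n) : size w != size x -> form pr w (single x) = 0.
Proof.
by move=> ne; apply: form_perm; apply: insupp_single; apply: contra ne => /perm_size->.
Qed.

(** For fixed w2, the sums of form(w, w2) f_(w') vanish.  By [ew_sum] and
[kernel_factor] each e_w is a fixed linear function of the row
form(w, -), so the sum of f_(w') t e_w is a combination of these. *)
Lemma mval_sum h m (l : seq (K * mono)) :
  (forall q, q \in l -> [/\ size q.2.1.1 = h, size q.2.2 = h & q.2.1.2 = m]) ->
  (forall w1 w2, size w1 = h -> size w2 = h -> \sum_(q <- l)
    q.1 * (form pr w1 (single q.2.1.1) * form pr q.2.2 (single w2)) = 0) ->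
  \sum_(q <- l) q.1 *: mval q.2 = 0.
Proof.
move=> hl hf.
have F0 (w2 : seq 'I_n) : size w2 = h ->
    \sum_(q <- l) (q.1 * form pr q.2.2 (single w2)) *: fw q.2.1.1 = 0.
  move=> sw2; apply: (evf_sum (w := fun q : K * mono => q.2.1.1)) => z.
  have [sz|sz] := eqVneq (size z) h.
    by rewrite -[RHS](hf z w2) //; apply: eq_bigr => q _; rewrite -mulrA; congr (_ * _); exact: mulrC.
  rewrite big_seq big1 // => q ql; have [sq _ _] := hl q ql.
  by rewrite [form pr z _]form_size ?mulr0 // sq.
have [Q QE] : exists Q : h.-tuple 'I_n -> h.-tuple 'I_n -> K, forall w : h.-tuple 'I_n,
    ew w = \sum_(u : h.-tuple 'I_n) (\sum_(t : h.-tuple 'I_n) Q u t * form pr w (single t)) *: ew u.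
  apply: (@kernel_factor _ _ A (fun t w : h.-tuple 'I_n => form pr w (single t)) (fun w : h.-tuple 'I_n => ew w)) => c hc.
  apply: (ew_sum (w := fun t : h.-tuple 'I_n => val t)) => z.
  have [sz|sz] := eqVneq (size z) h.
    by rewrite -[RHS](hc (tcast sz (in_tuple z))) val_tcast.
  by rewrite big1 // => t _; rewrite form_size ?mulr0 // size_tuple eq_sym.
have EE (w : seq 'I_n) : size w = h -> ew w = \sum_(u : h.-tuple 'I_n)
    (\sum_(t : h.-tuple 'I_n) Q u t * form pr w (single t)) *: ew u.
  by move=> sw; have := QE (tcast sw (in_tuple w)); rewrite val_tcast.
transitivity (\sum_(u : h.-tuple 'I_n) \sum_(t : h.-tuple 'I_n)
    Q u t *: ((\sum_(q <- l) (q.1 * form pr q.2.2 (single t)) *: fw q.2.1.1) * tmon m * ew u)); last first.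
  by rewrite big1 // => u _; rewrite big1 // => t _; rewrite F0 ?size_tuple // !mul0r scaler0.
under [RHS]eq_bigr => u _ do under eq_bigr => t _ do rewrite !mulr_suml scaler_sumr.
under [RHS]eq_bigr => u _ do rewrite exchange_big.
rewrite [RHS]exchange_big /= big_seq [RHS]big_seq; apply: eq_bigr => q ql.
have [s1 s2 qm] := hl q ql.
rewrite /mono_val qm (EE q.2.2) //; move: (tmon m) => a.
rewrite mulr_sumr scaler_sumr; apply: eq_bigr => u _.
rewrite scaler_suml mulr_sumr scaler_sumr; apply: eq_bigr => t _.
rewrite -!scalerAl -scalerAr !scalerA; congr (_ *: _).
by rewrite mulrCA.
Qed.

(** Induction on the number of terms: [mval_sum] removes those of smallest
length h and, among them, of lowest exponent. *)
Theorem faithful (l : seq (K * mono)) :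
  (forall q, q \in l -> size q.2.1.1 = size q.2.2) ->
  (forall lam lam', nowhere0 lam -> nowhere0 lam' -> forall w1 w2,
    v lam lam' (ew w1 * (\sum_(q <- l) q.1 *: mval q.2) * fw w2) = 0) ->
  \sum_(q <- l) q.1 *: mval q.2 = 0.
Proof.
have [k] := ubnP (size l); elim: k l => // k IH l; rewrite ltnS => sl hl hv.
have [->|ne] := eqVneq l [::]; first by rewrite big_nil.
have [q1 q1l q1min] := exists_min (fun q => (size q.2.2)%:Z) ne.
(* Longer monomials contribute 0 against w1 and w2 of length h, and the other
   torus monomials contribute higher powers of b. *)
pose h := size q1.2.2; pose L := [seq q <- l | size q.2.2 == h].
have [N [N' [NN' Ninj]]] := separating_exponents [seq q.2.1.2 | q <- l].
have Lne : L != [::] by rewrite -has_filter; apply/hasP; exists q1.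
have [q0 + q0min] := exists_min (fun q => expdot N N' q.2.1.2) Lne.
rewrite mem_filter => /andP[/eqP q0h q0l].
pose m := q0.2.1.2; pose key (q : K * mono) := (size q.2.2 == h) && (q.2.1.2 == m).
have part0 : \sum_(q <- [seq q <- l | key q]) q.1 *: mval q.2 = 0.
  apply: (@mval_sum h m) => [q|w1 w2 s1 s2].
    by rewrite mem_filter => /andP[/andP[/eqP qh /eqP qm] ql]; rewrite hl.
  have d0 : wdelta r s w1 * wdelta r s w2 != 0 by rewrite mulf_neq0 ?wdelta_neq0.
  apply: (mulfI d0); rewrite mulr0.
  pose G (q : K * mono) (b : K) := q.1 * v (ppow N b) (ppow N' b) (ew w1 * mval q.2 * fw w2).
  apply: (low_zero rr0 rr_generic (g := fun b => \sum_(q <- l) G q b)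
    (D := wsum N w1 + expdot N N' m + wsum N w2)) => [b b0|].
    have [l0 l0'] := (ppow_nowhere0 N b0, ppow_nowhere0 N' b0).
    rewrite -[RHS](hv _ _ l0 l0' w1 w2) mulr_sumr mulr_suml.
    under [in RHS]eq_bigr do rewrite -scalerAr -scalerAl.
    by rewrite v_sum.
  rewrite big_filter mulr_sumr big_mkcond /=; apply: low_sum => q ql.
  have [qh|qh] := eqVneq (size q.2.2) h; last first.
    rewrite /key (negbTE qh) /=; apply: (@low_eq _ (fun=> 0)); last exact: low0.
    move=> b b0; have [l0 l0'] := (ppow_nowhere0 N b0, ppow_nowhere0 N' b0).
    rewrite /G v_mono_size ?mulr0 // s2 ltn_neqAle eq_sym qh.
    by have := q1min q ql; rewrite lez_nat.
  have low_q := low_v_mono w1 (q := q.2) (w2 := w2) NN'.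
  rewrite qh s2 leqnn in low_q; have {}low_q := lowZ q.1 (low_q isT).
  rewrite /key qh eqxx /=; have [qm|qm] := eqVneq q.2.1.2 m.
    by rewrite mulrCA -qm.
  apply: low_weaken low_q; rewrite ltrD2r ltrD2l lt_neqAle q0min ?andbT; last first.
    by rewrite mem_filter qh eqxx.
  apply: contra qm => /eqP E; apply/eqP/esym; apply: Ninj E; apply/mapP; [by exists q0 | by exists q].
have E : \sum_(q <- l) q.1 *: mval q.2 = \sum_(q <- [seq q <- l | ~~ key q]) q.1 *: mval q.2.
  by rewrite (bigID key) /= -big_filter part0 add0r big_filter.
rewrite E; apply: IH.
- apply: leq_trans sl; rewrite size_filter -(count_predC key l) addnC -addn1 leq_add2l -has_count.
  by apply/hasP; exists q0 => //; rewrite /key q0h !eqxx.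
- by move=> q; rewrite mem_filter => /andP[_]; exact: hl.
- by move=> lam lam' l0 l0' w1 w2; rewrite -E; exact: hv.
Qed.

(** Induction on the number of terms: for exponents N, N' that separate the
monomials, the one of lowest exponent has coefficient 0. *)
Lemma torus_indep (l : seq (K * (rootlattice n * rootlattice n))) :
  \sum_(q <- l) q.1 *: tmon q.2 = 0 -> forall m, \sum_(q <- l | q.2 == m) q.1 = 0.
Proof.
have [k] := ubnP (size l); elim: k l => // k IH l; rewrite ltnS => sl hl m.
have [->|ne] := eqVneq l [::]; first by rewrite big_nil.
have [N [N' [NN' Ninj]]] := separating_exponents [seq q.2 | q <- l].
have [q0 q0l q0min] := exists_min (fun q => expdot N N' q.2) ne.
have part0 : \sum_(q <- l | q.2 == q0.2) q.1 = 0.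
  apply: (low_zero rr0 rr_generic (g := fun b => \sum_(q <- l) q.1 * b ^ expdot N N' q.2)
    (D := expdot N N' q0.2)) => [b b0|].
    have [l0 l0'] := (ppow_nowhere0 N b0, ppow_nowhere0 N' b0).
    have := congr1 (v (ppow N b) (ppow N' b)) hl; rewrite v0 // v_sum // => E0; rewrite -[RHS]E0.
    apply: eq_bigr => q _; rewrite -[tmon q.2]mul1r (v_tmon (vO l0 l0')) v1 //.
    by rewrite tchar_ppow // mulr1.
  rewrite big_mkcond /=; apply: low_sum => q ql.
  have low_q := lowZ q.1 (lowX (Qrs r s : fieldType) (expdot N N' q.2)); rewrite mulr1 in low_q.
  have [<-//|qm] := eqVneq q.2 q0.2.
  apply: low_weaken low_q; rewrite lt_neqAle q0min ?andbT //.
  by apply: contra qm => /eqP E; apply/eqP/esym; apply: Ninj E; apply/mapP; [exists q0 | exists q].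
have [->//|mq0] := eqVneq m q0.2.
have El : \sum_(q <- [seq q <- l | q.2 != q0.2]) q.1 *: tmon q.2 = 0.
  rewrite big_filter -[RHS]hl [RHS](bigID (fun q => q.2 == q0.2)) /=.
  rewrite [X in _ = X + _](eq_bigr (fun q => q.1 *: tmon q0.2)) => [|q /eqP->//].
  by rewrite -scaler_suml part0 scale0r add0r.
rewrite -[RHS](IH _ _ El m).
  rewrite big_filter_cond /=; apply: eq_bigl => q; case: eqP => [->|]; rewrite ?andbF ?andbT //.
apply: leq_trans sl; rewrite size_filter -(count_predC (fun q => q.2 == q0.2) l) addnC -addn1 leq_add2l -has_count.
by apply/hasP; exists q0.
Qed.

Section Central.
Variable k : 'I_n.
Local Notation wconj := (torus_conj (fun i => O false false i) (fun i => O false true i) k).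

Let wK : O false false k * O false true k = 1. Proof. exact: (sol_wK g_rel). Qed.

Let wconjM x z : wconj (x * z) = wconj x * wconj z.
Proof. exact: (conjwM (sol_wK g_rel false true)). Qed.

Lemma wconj_prod (F : 'I_n -> A) (c : 'I_n -> K) w : (forall i, wconj (F i) = c i *: F i) ->
  wconj (\prod_(i <- w) F i) = weightf c w *: \prod_(i <- w) F i.
Proof.
move=> h; elim: w => [|i w IH]; first by rewrite /weightf !big_nil scale1r /torus_conj mulr1 wK.
by rewrite !big_cons wconjM h IH -scalerAl -scalerAr scalerA weightf_cons.
Qed.

(** The eigenvalue of conjugation by omega_k on a triangular monomial. *)
Definition wratio (q : mono) : K :=
  weightf (fun j => pr j k) q.2 / weightf (fun j => pr j k) q.1.1.

Lemma wconj_mval q : wconj (mval q) = wratio q *: mval q.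
Proof.
have hE i : wconj (e i) = pr i k *: e i.
  by rewrite /torus_conj (sol_we g_rel) -scalerAl -mulrA wK mulr1.
have hF i : wconj (f i) = (pr i k)^-1 *: f i.
  by rewrite /torus_conj (sol_wf g_rel) -scalerAl -mulrA wK mulr1.
have hT : wconj (tmon q.1.2) = tmon q.1.2.
  rewrite /torus_conj (torus_comm g_rel); last exact: torus_tmon.
  by move: (tmon _) => t; rewrite -mulrA wK mulr1.
rewrite /mono_val; move: (tmon _) hT => t hT; rewrite !wconjM hT /eword /fword.
rewrite (wconj_prod _ hE) (wconj_prod _ hF) -!scalerAl -scalerAr scalerA /wratio mulrC.
by rewrite /weightf prodfV.
Qed.

(** A sum of eigenvectors that is fixed, with eigenvalues different from 1, is
0: applying the map minus its first eigenvalue a multiplies z by 1 - a and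
shortens the sum. *)
Lemma fixed_eigen (l : seq (K * A)) z : wconj z = z -> z = \sum_(q <- l) q.2 ->
  (forall q, q \in l -> wconj q.2 = q.1 *: q.2 /\ q.1 != 1) -> z = 0.
Proof.
have [m] := ubnP (size l); elim: m l z => // m IH [|[a y] l] z /= sl zf zE hl.
  by rewrite zE big_nil.
have [ya a1] := hl (a, y) (mem_head _ _); rewrite /= in ya a1.
have a0 : 1 - a != 0 by rewrite subr_eq0 eq_sym.
have {}hl q (ql : q \in l) := hl q (mem_behead (s := (a, y) :: l) ql).
apply: (IH [seq (q.1, ((1 - a)^-1 * (q.1 - a)) *: q.2) | q <- l]); rewrite ?size_map //.
  rewrite big_map /=; under eq_bigr do rewrite -scalerA.
  rewrite -scaler_sumr; have <- : (1 - a) *: z = \sum_(q <- l) (q.1 - a) *: q.2.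
    rewrite scalerBl scale1r -{1}zf zE big_cons linearD /= ya scalerDr opprD addrACA subrr add0r.
    rewrite [wconj _]linear_sum /= scaler_sumr -sumrB big_seq [RHS]big_seq; apply: eq_bigr => q ql.
    by rewrite (hl q ql).1 -scalerBl.
  by rewrite scalerA mulVf // scale1r.
move=> _ /mapP[q ql ->] /=; have [h1 h2] := hl q ql; split=> //.
by rewrite linearZ /= h1 !scalerA mulrC.
Qed.

Lemma wratio_filter (l : seq (K * mono)) :
  wconj (\sum_(q <- l) q.1 *: mval q.2) = \sum_(q <- l) q.1 *: mval q.2 ->
  \sum_(q <- l) q.1 *: mval q.2 = \sum_(q <- l | wratio q.2 == 1) q.1 *: mval q.2.
Proof.
set z := \sum_(q <- l) _; set z1 := \sum_(q <- l | _) _ => zf.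
have z1f : wconj z1 = z1.
  rewrite linear_sum; apply: eq_bigr => q /eqP q1.
  by rewrite linearZ /= wconj_mval q1 scale1r.
apply/eqP; rewrite -subr_eq0; apply/eqP.
apply: (@fixed_eigen [seq (wratio q.2, q.1 *: mval q.2) | q <- l & wratio q.2 != 1]).
- by rewrite linearB /= zf z1f.
- rewrite big_map big_filter /z (bigID (fun q => wratio q.2 == 1)) /= -/z1.
  by rewrite addrC addrK.
- move=> _ /mapP[q + ->] /=; rewrite mem_filter => /andP[q1 _]; split=> //.
  by rewrite linearZ /= wconj_mval !scalerA mulrC.
Qed.

End Central.

(** Restrict the sum successively to the terms fixed by each omega_k; the
remaining ones have weight 0. *)
Theorem central_balanced z : (2 <= n)%N -> (forall x, z * x = x * z) ->
  exists l : seq (K * mono), z = \sum_(q <- l) q.1 *: mval q.2 /\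
    (forall q, q \in l -> perm_eq q.2.1.1 q.2.2).
Proof.
move=> n2 zc; have [l zE] := spannedT r_neq0 s_neq0 g_rel g_span z.
have zf k : torus_conj (fun i => O false false i) (fun i => O false true i) k z = z.
  by rewrite /torus_conj -zc -mulrA (sol_wK g_rel false false) mulr1.
have H ks : z = \sum_(q <- [seq q <- l | all (fun k => wratio k q.2 == 1) ks]) q.1 *: mval q.2.
  elim: ks => [|k ks IH] /=; first by rewrite filter_predT.
  have := zf k; rewrite {1 2}IH => /wratio_filter; rewrite -IH => {1}->.
  by rewrite [LHS]big_filter_cond [RHS]big_filter; apply: eq_bigl => q; rewrite andbC.
exists [seq q <- l | all (fun k => wratio k q.2 == 1) (enum 'I_n)]; split; first exact: H.
move=> q; rewrite mem_filter => /andP[/allP h _].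
have ne k w : weightf (fun j => pr j k) w != 0.
  by apply: weightf_neq0 => j; exact: pairing_neq0.
apply: (pairing_weight_perm r_neq0 s_neq0 rs_generic n2) => k.
have /eqP := h k (mem_enum _ k); rewrite /wratio => E.
by rewrite -[RHS]divr1 -E invf_div mulrCA mulfV ?mulr1.
Qed.

(** z can be moved to the left of e_(w1) and f_(w2), where its leading f is
killed by vev: so [faithful] applies. *)
Theorem central_eq0 z (l : seq (K * mono)) : (forall x, z * x = x * z) ->
  z = \sum_(q <- l) q.1 *: mval q.2 ->
  (forall q, q \in l -> size q.2.1.1 = size q.2.2 /\ q.2.1.1 != [::]) -> z = 0.
Proof.
move=> zc zE hl; rewrite zE; apply: faithful => [q /hl[]//|lam lam' l0 l0' w1 w2].
rewrite -zE -zc -mulrA zE mulr_suml; under eq_bigr do rewrite -scalerAl.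
rewrite v_sum // big_seq big1 // => -[c [[[|i w'] m] w]] /hl[_] // _ /=.
rewrite /mono_val; move: (tmon _) => t.
by rewrite /fword big_cons -!mulrA vF // mulr0.
Qed.

(** Rescaling the torus monomials by nonzero scalars is injective, in the form
of relations between possibly repeated monomials. *)
Lemma tmon_twist (chi : rootlattice n * rootlattice n -> K)
    (l : seq (K * (rootlattice n * rootlattice n))) : (forall m, chi m != 0) ->
  \sum_(q <- l) (q.1 * chi q.2) *: tmon q.2 = 0 -> \sum_(q <- l) q.1 *: tmon q.2 = 0.
Proof.
move=> chi0 h; have {}h m : \sum_(q <- l | q.2 == m) q.1 = 0.
  have := @torus_indep [seq (q.1 * chi q.2, q.2) | q <- l].
  rewrite big_map => /(_ h m); rewrite big_map /=.
  rewrite (eq_bigr (fun q => q.1 * chi m)) => [|q /eqP->//].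
  by rewrite -mulr_suml => /eqP; rewrite mulf_eq0 (negbTE (chi0 m)) orbF => /eqP.
have [k] := ubnP (size l); elim: k l h => // k IH [|q0 l] h sl; first by rewrite big_nil.
pose l' := [seq q <- q0 :: l | q.2 != q0.2].
have E : \sum_(q <- l') q.1 *: tmon q.2 = \sum_(q <- q0 :: l) q.1 *: tmon q.2.
  rewrite /l' big_filter [RHS](bigID (fun q => q.2 == q0.2)) /=.
  rewrite [X in _ = X + _](eq_bigr (fun q => q.1 *: tmon q0.2)) => [|q /eqP->//].
  by rewrite -scaler_suml h scale0r add0r.
rewrite -E; apply: IH => [m|].
  have [->|mq0] := eqVneq m q0.2.
    by rewrite big_filter_cond big1 // => q /andP[/negbTE->].
  rewrite -[RHS](h m) big_filter_cond; apply: eq_bigl => q.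
  by case: (q.2 =P m) => [->|_]; rewrite ?andbF // mq0.
rewrite ltnS in sl; apply: leq_trans sl; rewrite /l' /= eqxx /=.
by rewrite ltnS size_filter count_size.
Qed.

End Faithful.

(** * The Harish-Chandra homomorphism *)

Lemma mulr_linear_l (K : comNzRingType) (A : algType K) a (u v w : A) :
  (a *: u + v) * w = a *: (u * w) + v * w.
Proof. by rewrite mulrDl -scalerAl. Qed.

Lemma mulr_linear_ll (K : comNzRingType) (A : algType K) a (u v t w : A) :
  (a *: u + v) * t * w = a *: (u * t * w) + v * t * w.
Proof. by rewrite !mulr_linear_l. Qed.

Lemma mulr_linear_r (K : comNzRingType) (A : algType K) a (u v w : A) :
  w * (a *: u + v) = a *: (w * u) + w * v.
Proof. by rewrite mulrDr -scalerAr. Qed.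

Lemma mulr_sum_mid (K : comNzRingType) (A : algType K) (I : Type) (l : seq I) (c : I -> K)
    (F : I -> A) u v :
  u * (\sum_(q <- l) c q *: F q) * v = \sum_(q <- l) c q *: (u * F q * v).
Proof.
by rewrite mulr_sumr mulr_suml; apply: eq_bigr => q _; rewrite -scalerAr -scalerAl.
Qed.

Lemma sum_sub_filter (V : zmodType) (I : Type) (l : seq I) (P : pred I) (F : I -> V) :
  \sum_(q <- l) F q - \sum_(q <- [seq q <- l | P q]) F q =
  \sum_(q <- [seq q <- l | ~~ P q]) F q.
Proof. by rewrite (bigID P) /= !big_filter addrAC subrr add0r. Qed.

Lemma central_sub (A : pzRingType) (z z' : A) : (forall x, z * x = x * z) ->
  (forall x, z' * x = x * z') -> forall x, (z - z') * x = x * (z - z').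
Proof. by move=> zc zc' x; rewrite mulrBl mulrBr zc zc'. Qed.

Lemma subr_shift (V : zmodType) (a b c : V) : a - b = (a - c) - (b - c).
Proof. by rewrite opprB addrA subrK. Qed.

Section Final.
Local Open Scope classical_set_scope.
Local Open Scope ring_scope.
Context {R : realType} {n : nat}.
Variables r s : R[i].
Hypothesis r_neq0 : r != 0.
Hypothesis s_neq0 : s != 0.
Hypothesis rs_generic : forall k l : int, r ^ k * s ^ l = 1 <-> k = 0 /\ l = 0.
Local Notation K := (Qrs r s).
Local Notation U := (U n r s).
Local Notation U0 := (@U0 R n r s).
Local Notation HC_kernel := (@HC_kernel R n r s).
Local Notation freeU := (freeU n r s).
Local Notation g := (@gU R n r s).

Lemma mkmalgU_cons x (l : seq (gen n)) :
  mkmalgU (FMonom (x :: l)) 1 = genU r s x * mkmalgU (FMonom l) 1 :> freeU.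
Proof.
rewrite /genU malgM_def fgmulUU mulr1; congr (mkmalgU _ _).
by apply: val_inj; rewrite /= fmM fmU.
Qed.

Lemma pi_monomial (l : seq (gen n)) : piU (mkmalgU (FMonom l) 1 : freeU) = \prod_(k <- l) g k.
Proof.
elim: l => [|x l IH]; last by rewrite mkmalgU_cons piUM IH big_cons.
rewrite big_nil -(rmorph1 (@piU R n r s)); congr piU.
by congr (mkmalgU _ _); apply: val_inj; rewrite /= fm1.
Qed.

Lemma gU_span (x : U) : exists l : seq (K * seq (gen n)),
  x = \sum_(q <- l) q.1 *: \prod_(k <- q.2) g k.
Proof.
have [u ->] := piU_surj x; move: u; apply: malg_ind => [|c [m] u [l IH]].
  by exists [::]; rewrite big_nil; exact: linear0.
exists ((c, m) :: l); rewrite big_cons -IH /= -pi_monomial.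
exact: (etrans (piUD _ _) (congr1 (fun a => a + piU u) (piUZ c _))).
Qed.

Lemma lspan_ind (G : set U) (P : U -> Prop) : P 0 ->
  (forall a u v, P u -> P v -> P (a *: u + v)) -> (forall x, G x -> P x) ->
  forall x, lspan G x -> P x.
Proof.
move=> P0 PL PG x; apply=> /=; split=> //; split; first exact/mem_set.
by move=> a u v /set_mem hu /set_mem hv; apply/mem_set/PL.
Qed.

Lemma lspan_gen (G : set U) x : G x -> lspan G x.
Proof. by move=> Gx S /= [_]; apply. Qed.

Lemma lspan0 (G : set U) : lspan G 0.
Proof. by move=> S /= [[h _] _]; exact/set_mem. Qed.

Lemma lspanP (G : set U) a u v : lspan G u -> lspan G v -> lspan G (a *: u + v).
Proof.
move=> hu hv S hS; have [[_ hl] _] := hS.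
by apply/set_mem/hl; apply/mem_set; [exact: hu | exact: hv].
Qed.

Lemma lspanB (G : set U) u v : lspan G u -> lspan G v -> lspan G (u - v).
Proof. by move=> hu hv; rewrite addrC -scaleN1r; exact: lspanP. Qed.

Lemma lspan_sum (G : set U) (I : eqType) (l : seq I) (c : I -> K) (F : I -> U) :
  (forall q, q \in l -> lspan G (F q)) -> lspan G (\sum_(q <- l) c q *: F q).
Proof.
elim: l => [|q l IH] h; first by rewrite big_nil; exact: lspan0.
rewrite big_cons; apply: lspanP; first by apply: h; exact: mem_head.
by apply: IH => q' q'l; apply: h; rewrite in_cons q'l orbT.
Qed.

Lemma U0_torus x : torus g x -> U0 x.
Proof.
elim=> [|p q k z _ h] S hS; have [[h1 _ hM] hG] := hS; first exact/set_mem.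
by apply/set_mem/hM; apply/mem_set; [apply: hG; exists p, q, k | exact: h].
Qed.

Lemma U0P a u v : U0 u -> U0 v -> U0 (a *: u + v).
Proof.
move=> hu hv S hS; have [[_ hl _] _] := hS.
by apply/set_mem/hl; apply/mem_set; [exact: hu | exact: hv].
Qed.

(** The torus words are closed under products, so their span is an algebra. *)
Lemma U0_lspan x : U0 x -> lspan (torus g) x.
Proof.
move=> h; apply: (h (lspan (torus g))); split=> /=; last first.
  by move=> _ [p [q [i ->]]]; apply: lspan_gen; exact: torus_gen.
split; first by apply/mem_set; apply: lspan_gen; exact: torus1.
  by move=> a u v /set_mem hu /set_mem hv; apply/mem_set; exact: lspanP.
move=> u v /set_mem hu /set_mem hv; apply/mem_set; move: u hu.
apply: lspan_ind => [|a u u' IHu IHu'|t tt].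
- rewrite (mul0r v); exact: lspan0.
- rewrite (mulr_linear_l a u u' v); exact: (lspanP a IHu IHu').
move: v hv; apply: lspan_ind => [|a v v' IHv IHv'|t' tt'].
- rewrite (mulr0 t); exact: lspan0.
- rewrite (mulr_linear_r a v v' t); exact: (lspanP a IHv IHv').
by apply: lspan_gen; exact: torus_mul.
Qed.

Lemma U0_tmon_sum x : U0 x -> exists l : seq (K * (rootlattice n * rootlattice n)),
  x = \sum_(q <- l) q.1 *: torus_mon g q.2.
Proof.
move/U0_lspan; move: x; apply: lspan_ind => [|a u v [l ->] [l' ->]|t].
- by exists [::]; rewrite big_nil.
- exists ([seq (a * q.1, q.2) | q <- l] ++ l').
  exact: esym (lincombP _ _ _ _).
- move/(torus_tmonE r_neq0 s_neq0 (@gU_rel R n r s)) => [m ->].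
  by exists [:: (1, m)]; rewrite big_seq1 scale1r.
Qed.

(** The elements of the kernel of the projection, as explicit sums. *)
Definition balanced (x : U) := exists l : seq (K * mono),
  x = \sum_(q <- l) q.1 *: mono_val g q.2 /\
  (forall q, q \in l -> perm_eq q.2.1.1 q.2.2 /\ q.2.1.1 != [::]).

Lemma balanced0 : balanced 0.
Proof. by exists [::]; rewrite big_nil. Qed.

Lemma balancedP a u v : balanced u -> balanced v -> balanced (a *: u + v).
Proof.
move=> [l [-> hl]] [l' [-> hl']]; exists ([seq (a * q.1, q.2) | q <- l] ++ l'); split.
  exact: esym (lincombP _ _ _ _).
by move=> q; rewrite mem_cat => /orP[/mapP[q' /hl ? ->]|/hl'].
Qed.

Lemma HC_kernel_mval w' m w : perm_eq w' w -> w' != [::] -> HC_kernel (mono_val g (w', m, w)).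
Proof.
move=> ww; case: w' ww => // i w' ww _; apply: lspan_gen.
exists (fun k => count_mem k (i :: w')), (fword g (i :: w')), (torus_mon g m), (eword g w); split=> //.
- by exists i; rewrite /= eqxx.
- by apply: lspan_gen; exists (i :: w').
- by apply: U0_torus; exact: torus_tmon.
- by apply: lspan_gen; exists w => // k; move/permP: ww => ->.
Qed.

Lemma HC_kernel_balanced x : HC_kernel x -> balanced x.
Proof.
move: x; apply: lspan_ind => [|a u v|_ [nu [y [t [z [[i nui] hy ht hz ->]]]]]].
- exact: balanced0.
- exact: balancedP.
have [l ->] := U0_tmon_sum ht.
move: y hy; apply: lspan_ind => [|a u v hu hv|_ [w' hw' ->]].
- rewrite !mul0r; exact: balanced0.
- rewrite mulr_linear_ll; exact: (balancedP a hu hv).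
move: z hz; apply: lspan_ind => [|a u v hu hv|_ [w hw ->]].
- rewrite mulr0; exact: balanced0.
- rewrite mulr_linear_r; exact: (balancedP a hu hv).
exists [seq (q.1, (w', q.2, w)) | q <- l]; split.
  rewrite big_map; exact: mulr_sum_mid.
move=> _ /mapP[q _ ->] /=; split.
  by apply/allP => k _ /=; rewrite hw hw'.
by apply: contraNneq nui => w0; rewrite -(hw' i) w0.
Qed.

Let vP (lam lam' : 'I_n -> K) : nowhere0 lam -> nowhere0 lam' ->
  forall c x z, vev lam lam' (c *: x + z) = c * vev lam lam' x + vev lam lam' z.
Proof. exact: vevP. Qed.
Let v1 (lam lam' : 'I_n -> K) : nowhere0 lam -> nowhere0 lam' -> vev lam lam' 1 = 1.
Proof. exact: vev1. Qed.
Let vE (lam lam' : 'I_n -> K) : nowhere0 lam -> nowhere0 lam' ->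
  forall x i, vev lam lam' (x * g (GenE i)) = 0.
Proof. exact: vev_mulE. Qed.
Let vO (lam lam' : 'I_n -> K) : nowhere0 lam -> nowhere0 lam' ->
  forall x p q i, vev lam lam' (x * g (GenO p q i)) = torus_cst lam lam' p q i * vev lam lam' x.
Proof. exact: vev_mulO. Qed.
Let vF (lam lam' : 'I_n -> K) : nowhere0 lam -> nowhere0 lam' ->
  forall x i, vev lam lam' (g (GenF i) * x) = 0.
Proof. exact: vev_Fmul. Qed.

Lemma central_HC_kernel z : (forall x, z * x = x * z) -> HC_kernel z -> z = 0.
Proof.
move=> zc /HC_kernel_balanced[l [zE hl]].
have H := @central_eq0 R n r s r_neq0 s_neq0 rs_generic U g (@gU_rel R n r s) gU_span
  (fun lam lam' => vev lam lam') vP v1 vE vO vF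
  (@tau R n r s) (tauM r_neq0 s_neq0) (@tau1 R n r s r_neq0 s_neq0) (@tau_gen R n r s r_neq0 s_neq0) z l zc zE.
have h q : q \in l -> size q.2.1.1 = size q.2.2 /\ q.2.1.1 != [::].
  by move=> /hl[/perm_size].
exact: (H r_neq0 s_neq0 h).
Qed.

(** In the sum of [central_balanced], the terms without f's have no e's either
and form an element of U_0; the others lie in the kernel of the projection. *)
Lemma HC_projP z : (2 <= n)%N -> (forall x, z * x = x * z) ->
  U0 (HC_proj z) /\ HC_kernel (z - HC_proj z).
Proof.
move=> n2 zc; apply: (@xgetPex U 0 [set u | U0 u /\ HC_kernel (z - u)]).
have [l [zE hl]] := central_balanced r_neq0 s_neq0 rs_generic (@gU_rel R n r s) gU_span n2 zc.
pose l0 := [seq q <- l | q.2.1.1 == [::]]; pose l1 := [seq q <- l | q.2.1.1 != [::]].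
(* An empty word of f's forces an empty word of e's, by weight. *)
exists (\sum_(q <- l0) q.1 *: mono_val g q.2); split.
  have H : lspan (torus g) (\sum_(q <- l0) q.1 *: mono_val g q.2).
    apply: lspan_sum => -[c [[w' m] w]]; rewrite mem_filter /= => /andP[/eqP-> /hl /=].
    rewrite perm_sym => /perm_nilP->; apply: lspan_gen.
    rewrite /mono_val /fword /eword !big_nil mul1r mulr1; exact: torus_tmon.
  move: H; apply: lspan_ind => [|a u v|t]; [|exact: U0P|exact: U0_torus].
  rewrite -(subrr (1 : U)) addrC -scaleN1r; apply: U0P; apply: U0_torus; exact: torus1.
have -> : z - \sum_(q <- l0) q.1 *: mono_val g q.2 = \sum_(q <- l1) q.1 *: mono_val g q.2.
  rewrite zE; exact: (sum_sub_filter l (fun q : K * mono => q.2.1.1 == [::])).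
apply: lspan_sum => -[c [[w' m] w]]; rewrite mem_filter /= => /andP[w0 /hl /= ww].
exact: HC_kernel_mval.
Qed.

Lemma varrho_neq0 (lam : 'rV[R]_n) eta phi : varrho r s lam eta phi != 0.
Proof.
have r0 : rQ r s != 0 by exact: rQ_neq0.
have s0 : sQ r s != 0 by exact: sQ_neq0.
have ze x (a : R) : x != 0 -> zexp x a != 0 :> K by move=> x0; exact: expfz_neq0.
rewrite /varrho mulf_neq0 //; apply/prodf_neq0 => i _; apply: expfz_neq0.
  by rewrite /varrho_omega'; case: ifP => _; rewrite mulf_neq0 ?ze ?mulf_neq0.
by rewrite /varrho_omega; case: ifP => _; rewrite mulf_neq0 ?ze ?mulf_neq0.
Qed.

Lemma HC_gammaP (lam : 'rV[R]_n) u : U0 u ->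
  exists c : seq (K * (rootlattice n * rootlattice n)),
    u = \sum_(p <- c) p.1 *: torus_mon g p.2 /\
    HC_gamma lam u = \sum_(p <- c) (p.1 * varrho r s lam p.2.1 p.2.2) *: torus_mon g p.2.
Proof.
move=> /U0_tmon_sum[c uE].
apply: (@xgetPex U 0 [set y | exists c : seq (K * (rootlattice n * rootlattice n)),
  u = \sum_(p <- c) p.1 *: torus_mon g p.2 /\
  y = \sum_(p <- c) (p.1 * varrho r s lam p.2.1 p.2.2) *: torus_mon g p.2]).
exists (\sum_(p <- c) (p.1 * varrho r s lam p.2.1 p.2.2) *: torus_mon g p.2), c.
by split; [exact: uE | reflexivity].
Qed.

(** The difference of the two sums representing the images is a relation
between torus monomials, to which [tmon_twist] applies. *)
Lemma HC_gamma_inj (lam : 'rV[R]_n) u v : U0 u -> U0 v ->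
  HC_gamma lam u = HC_gamma lam v -> u = v.
Proof.
move=> /(HC_gammaP lam)[c [uE ->]] /(HC_gammaP lam)[d [vE' ->]] E.
apply/esym/eqP; rewrite -subr_eq0 addrC -scaleN1r; apply/eqP.
rewrite uE vE' -lincombP.
apply: (tmon_twist r_neq0 rs_generic vP v1 vO (chi := fun m => varrho r s lam m.1 m.2)).
  by move=> m; exact: varrho_neq0.
rewrite big_cat big_map /=; under eq_bigr do rewrite mulN1r mulNr scaleNr.
by rewrite sumrN E addNr.
Qed.

End Final.

Theorem theorem3p1 (R : realType) (n : nat) (r s : R[i])
  (hn : (2 <= n)%N) (heven : ~~ odd n)
  (hr : r != 0) (hs : s != 0) (hrs : r != s) (hrs2 : r ^+ 2 + s ^+ 2 != 1)
  (hgen : forall k l : int, r ^ k * s ^ l = 1 <-> k = 0 /\ l = 0) :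
  {in centerU n r s &, injective (HC n r s)}.
Proof.
move=> z z' /set_mem zc /set_mem zc' E.
have [u0 uk] := HC_projP hr hs hgen hn zc.
have [u0' uk'] := HC_projP hr hs hgen hn zc'.
have Eu := HC_gamma_inj hr hs hgen u0 u0' E.
apply/eqP; rewrite -subr_eq0; apply/eqP.
apply: (central_HC_kernel hr hs hgen (central_sub zc zc')).
rewrite (subr_shift z z' (HC_proj z)) [in z' - _]Eu; exact: lspanB.
Qed.
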